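(* Assume that one of the following three sets of assumptions (A1), (A2), (A3) is satisfied. In each of them it is required that, for the indicated $\alpha$, $$\mathbb{E}\rho^\alpha=1,\quad \mathbb{E}[\rho^\alpha\log^+\rho]<\infty,\quad\text{and the distribution of }\log\rho\text{ is nonarithmetic};\qquad(\ast)$$ (A1) $(\ast)$ holds for some $\alpha\in(0,2]$, $\mathbb{E}\xi^{\max(2\alpha,1)}<\infty$ and $\mathbb{E}(\rho\xi)^\alpha<\infty$; (A2) $(\ast)$ holds for some $\alpha\in(1/2,2]$, $\mathbb{P}\{\xi>t\}\sim t^{-2\alpha}\ell(t)$ as $t\to\infty$ for some slowly varying function $\ell$ with $\lim_{t\to\infty}\ell(t)=0$, $\mathbb{E}\xi^{2\alpha}=\infty$, and $\mathbb{E}(\rho\xi)^\alpha<\infty$; (A3) $(\ast)$ holds for some $\alpha\in(1/2,2)$, $\mathbb{P}\{\xi>t\}\sim t^{-2\alpha}\ell(t)$ as $t\to\infty$ for some slowly varying function $\ell$ with $\lim_{t\to\infty}\ell(t)=C_\ell\in(0,\infty)$ (so that $\mathbb{E}\xi^{2\alpha}=\infty$), and $\mathbb{E}\rho^{\alpha+\varepsilon}<\infty$ and $\mathbb{E}[\rho^\alpha\xi^{\alpha+\varepsilon}]<\infty$ for some $\varepsilon>0$. Let $A_\alpha$, $B_\alpha$, $C_1$ be the constants from the limit relations for $T_n$ recalled in the context. Then, as $k\to\infty$, under $\mathbb{P}$: - if $\alpha\in(0,1)$, then $\dfrac{X_k}{B_\alpha^{-\alpha}k^\alpha}\overset{\rm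 d}{\longrightarrow}\mathcal{S}_\alpha^{-\alpha}$; - if $\alpha=1$, then $\dfrac{X_k-A_1^{-1}\widehat a(k)}{A_1^{-2}B_1k(\log k)^{-2}}\overset{\rm d}{\longrightarrow}-C_1-\mathcal{S}_1$ for some sequence $\widehat a(k)\sim k(\log k)^{-1}$; - if $\alpha\in(1,2)$, then $\dfrac{X_k-A_\alpha^{-1}k}{A_\alpha^{-(1+1/\alpha)}B_\alpha k^{1/\alpha}}\overset{\rm d}{\longrightarrow}-\mathcal{S}_\alpha$; - if $\alpha=2$, then $\dfrac{X_k-A_2^{-1}k}{A_2^{-3/2}B_2(k\log k)^{1/2}}\overset{\rm d}{\longrightarrow}\mathcal{N}(0,1)$, where $\mathcal{N}(0,1)$ is a standard normal random variable.
   Context: Write $\mathbb{N}=\{1,2,\ldots\}$, $\log^+x=\max(0,\log x)$. Let $(\xi,\lambda)$ be a random vector with $\xi\in\mathbb{N}$ and $\lambda\in(0,1)$ a.s. ($\xi$ and $\lambda$ may be dependent), and put $\rho:=(1-\lambda)/\lambda$. Let $((\xi_k,\lambda_k))_{k\in\mathbb{Z}}$ be independent copies of $(\xi,\lambda)$. Put $S_0=0$, $S_n=\sum_{k=1}^n\xi_k$ for $n>0$ and $S_n=-\sum_{k=n+1}^{0}\xi_k$ for $n<0$. The sparse random environment $\omega=(\omega_n)_{n\in\mathbb{Z}}$ is defined by $\omega_n=\lambda_{k+1}$ if $n=S_k$ for some $k\in\mathbb{Z}$, and $\omega_n=1/2$ otherwise. Given $\omega$, under the quenched law $\mathbb{P}_\omega$,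 $(X_n)_{n\ge0}$ is a Markov chain on $\mathbb{Z}$ with $X_0=0$ which jumps from $i$ to $i+1$ with probability $\omega_i$ and from $i$ to $i-1$ with probability $1-\omega_i$. $\mathbb{P}$ denotes the annealed law (the average of $\mathbb{P}_\omega$ over $\omega$) and $\mathbb{E}$ the corresponding expectation. $T_n:=\inf\{k\ge0:X_k=n\}$ are the first passage times. $\overset{\rm d}{\longrightarrow}$ denotes convergence in distribution under $\mathbb{P}$. For $\alpha\in(0,2)$, $\mathcal{S}_\alpha$ is a random variable with the $\alpha$-stable distribution given by: $-\log\mathbb{E}\exp(-u\mathcal{S}_\alpha)=\Gamma(1-\alpha)u^\alpha$, $u\ge0$, if $\alpha\in(0,1)$; $\log\mathbb{E}\exp({\rm i}u\mathcal{S}_1)=-(\pi/2)|u|-{\rm i}u\log|u|$, $u\in\mathbb{R}$; and $\log\mathbb{E}\exp({\rm i}u\mathcal{S}_\alpha)=|u|^\alpha\frac{\Gamma(2-\alpha)}{\alpha-1}\big(\cos(\pi\alpha/2)-{\rm i}\sin(\pi\alpha/2)\,{\rm sign}\,u\big)$, $u\in\mathbb{R}$, if $\alpha\in(1,2)$. Here $\Gamma$ is the gamma function. Constants: under the assumptions of the claim there exist constants $A_\alpha>0$, $B_\alpha>0$, $C_1\in\mathbb{R}$ such that, as $n\to\infty$: $T_n/(B_\alpha n^{1/\alpha})\overset{\rm d}{\to}\mathcal{S}_\alpha$ if $\alpha\in(0,1)$; $(T_n-A_1a(n))/(B_1n)\overset{\rm d}{\to}C_1+\mathcal{S}_1$ for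 some $a(n)\sim n\log n$ if $\alpha=1$; $(T_n-A_\alpha n)/(B_\alpha n^{1/\alpha})\overset{\rm d}{\to}\mathcal{S}_\alpha$ if $\alpha\in(1,2)$; $(T_n-A_2n)/(B_2(n\log n)^{1/2})\overset{\rm d}{\to}\mathcal{N}(0,1)$ if $\alpha=2$. The claim uses these constants. *)

(* Defs.v *)
From HB Require Import structures.
From mathcomp Require Import all_boot all_order all_algebra.
From mathcomp Require Import all_classical all_reals all_analysis.
From mathcomp Require Import measurable_realfun complex.

Set Implicit Arguments.
Unset Strict Implicit.
Unset Printing Implicit Defensive.

Import Order.TTheory GRing.Theory Num.Theory.
Import numFieldNormedType.Exports.

Local Open Scope classical_set_scope.
Local Open Scope ring_scope.

Definition asymp_equiv (R : realType) (I : Type) (F : set_system I)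
    (f g : I -> R) : Prop :=
  f i / g i @[i --> F] --> (1 : R).

Section Families.
Context (d d' : measure_display) (T : measurableType d) (T' : measurableType d')
  (R : realType) (P : probability T R).

Definition same_law (Y Z : T -> T') : Prop :=
  forall B : set T', measurable B -> P (Y @^-1` B) = P (Z @^-1` B).

Definition mutually_independent (I : eqType) (Y : I -> T -> T') : Prop :=
  forall (J : seq I) (B : I -> set T'), uniq J ->
    (forall i, measurable (B i)) ->
    P (\bigcap_(i in [set` J]) (Y i @^-1` B i)) =
      (\prod_(i <- J) P (Y i @^-1` B i))%E.

Definition iid_copies (I : eqType) (Y0 : T -> T') (Y : I -> T -> T') : Prop :=
  (forall i, same_law (Y i) Y0) /\ mutually_independent Y.

End Families.

HB.instance Definition _ := isPointed.Build int 0.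

Definition cylinders : set (set (nat -> int)) :=
  [set A | exists n i, A = [set x : nat -> int | x n = i]].

(* Trajectories of the walk, with the product sigma-algebra; the walk (X_n) is
   the coordinate process. *)
Notation path_space := (g_sigma_algebraType cylinders).

Section Environment.
Context (R : realType).

(* [S_ xi n], with [Negz m] standing for -(m+1): the sum over -m <= k <= 0. *)
Definition S_ (xi : int -> nat) (n : int) : int :=
  match n with
  | Posz m => \sum_(1 <= k < m.+1) (xi k%:Z)%:Z
  | Negz m => - \sum_(0 <= j < m.+1) (xi (- j%:Z))%:Z
  end.

(* When xi > 0 the index k with S_k = n is unique, so that the choice made by
   [cid] is immaterial. *)
Definition environment (xi : int -> nat) (lam : int -> R) (n : int) : R :=
  match pselect (exists k : int, S_ xi k = n) with
  | left h => lam (sval (cid h) + 1)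
  | right _ => 2^-1
  end.

Definition jump (omega : int -> R) (i j : int) : R :=
  if j == i + 1 then omega i else if j == i - 1 then 1 - omega i else 0.

Definition quenched_law (omega : int -> R) (Q : probability path_space R) : Prop :=
  Q [set X : path_space | X 0%N = 0] = 1%E /\
  forall (n : nat) (x : nat -> int),
    Q [set X : path_space | forall m, (m <= n.+1)%N -> X m = x m] =
    (Q [set X : path_space | forall m, (m <= n)%N -> X m = x m] *
      (jump omega (x n) (x n.+1))%:E)%E.

(* Measurability of w |-> P_omega(A) is what makes the average meaningful; it
   could only fail on the null set where (xi, lam) leaves its range. *)
Definition annealed_law d (T : measurableType d) (P : probability T R)
    (omega : T -> int -> R) (Pq : (int -> R) -> probability path_space R)
    (PP : probability path_space R) : Prop :=
  forall A : set path_space, measurable A ->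
    measurable_fun [set: T] (fun w => Pq (omega w) A) /\
    PP A = (\int[P]_w Pq (omega w) A)%E.

Definition first_passage (n : int) (X : path_space) : \bar R :=
  ereal_inf [set (k%:R)%:E | k in [set k : nat | X k = n]].

End Environment.

Section Laws.
Context (R : realType).

(* The Y_n may be infinite with positive probability (first passage times), the
   limit Z is real-valued. *)
Definition cvg_in_distribution (d d' : measure_display) (T : measurableType d)
    (T' : measurableType d') (P : probability T R) (Y : nat -> T -> \bar R)
    (P' : probability T' R) (Z : T' -> R) : Prop :=
  forall t : R, {for t, continuous (fun s : R => P' [set z | Z z <= s])} ->
    P [set w | (Y n w <= t%:E)%E] @[n --> \oo] --> P' [set z | Z z <= t].

Definition Gamma (z : R) : R :=
  \int[@lebesgue_measure R]_(x in `]0, +oo[) (x `^ (z - 1) * expR (- x)).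

Definition cexp (z : R[i]) : R[i] :=
  Complex (expR (complex.Re z) * cos (complex.Im z))
          (expR (complex.Re z) * sin (complex.Im z)).

Definition char_fun (nu : probability (measurableTypeR R) R) (u : R) : R[i] :=
  Complex (\int[nu]_x cos (u * x)) (\int[nu]_x sin (u * x)).

(* For alpha >= 1, log E exp(iuS) = z is expressed as E exp(iuS) = exp z. *)
Definition stable_law (alpha : R) (nu : probability (measurableTypeR R) R) : Prop :=
  [/\ 0 < alpha < 1 -> forall u, 0 <= u ->
        (- lne ('E_nu[fun s => expR (- u * s)%R]) =
           (Gamma (1 - alpha) * u `^ alpha)%R%:E)%E,
      alpha = 1 -> forall u,
        char_fun nu u = cexp (Complex (- (pi / 2) * `|u|) (- (u * ln `|u|)))
    & 1 < alpha < 2 -> forall u,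
        char_fun nu u = cexp
          (real_complex R (`|u| `^ alpha * (Gamma (2 - alpha) / (alpha - 1))) *
           Complex (cos (pi * alpha / 2)) (- (sin (pi * alpha / 2) * Num.sg u)))].

End Laws.

Section Assumptions.
Context (R : realType) (d : measure_display) (T : measurableType d)
  (P : probability T R) (xi : T -> nat) (lam : T -> R).

Let rho (w : T) : R := (1 - lam w) / lam w.
Let xiR (w : T) : R := (xi w)%:R.

Definition arithmetic (Y : T -> R) : Prop :=
  exists2 h : R, 0 < h & {ae P, forall w, exists m : int, Y w = m%:~R * h}.

Definition slowly_varying (ell : R -> R) : Prop :=
  (exists t0 : R, measurable_fun `[t0, +oo[ ell /\
     forall t, t0 <= t -> 0 < ell t) /\
  forall c : R, 0 < c -> ell (c * t) / ell t @[t --> +oo] --> (1 : R).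

Definition cond_star (alpha : R) : Prop :=
  [/\ ('E_P[fun w => (rho w `^ alpha)%R] = 1)%E,
      ('E_P[fun w => (rho w `^ alpha * Num.max 0 (ln (rho w)))%R] < +oo)%E
    & ~ arithmetic (fun w => ln (rho w))].

Definition tail_xi (alpha : R) (ell : R -> R) : Prop :=
  asymp_equiv (pinfty_nbhs R) (fun t => fine (P [set w | t < xiR w]))
    (fun t => t `^ (- (2 * alpha)) * ell t).

Definition A1 (alpha : R) : Prop :=
  [/\ 0 < alpha <= 2, cond_star alpha,
      ('E_P[fun w => (xiR w `^ (Num.max (2 * alpha) 1))%R] < +oo)%E
    & ('E_P[fun w => ((rho w * xiR w) `^ alpha)%R] < +oo)%E].

Definition A2 (alpha : R) : Prop :=
  [/\ 2^-1 < alpha <= 2, cond_star alpha,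
      exists ell : R -> R, [/\ slowly_varying ell, tail_xi alpha ell
        & ell t @[t --> +oo] --> (0 : R)],
      ('E_P[fun w => (xiR w `^ (2 * alpha))%R] = +oo)%E
    & ('E_P[fun w => ((rho w * xiR w) `^ alpha)%R] < +oo)%E].

Definition A3 (alpha : R) : Prop :=
  [/\ 2^-1 < alpha < 2, cond_star alpha,
      exists ell : R -> R, [/\ slowly_varying ell, tail_xi alpha ell
        & exists2 C : R, 0 < C & ell t @[t --> +oo] --> C]
    & exists2 eps : R, 0 < eps &
        ('E_P[fun w => (rho w `^ (alpha + eps))%R] < +oo)%E /\
        ('E_P[fun w => (rho w `^ alpha * xiR w `^ (alpha + eps))%R] < +oo)%E].

End Assumptions.

Section Limits.
Context (R : realType) (PP : probability path_space R)
  (nu : probability (measurableTypeR R) R).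

(* The law [nu] is that of S_alpha; it plays no role for alpha = 2. *)

Let T_law (c b : nat -> R) (nu' : probability (measurableTypeR R) R) Z :=
  cvg_in_distribution PP
    (fun n X => (first_passage R n%:Z X - (c n)%:E) * ((b n)^-1)%:E)%E nu' Z.

(* A is not used when alpha < 1, and C1 only when alpha = 1. *)
Definition passage_time_limits (alpha A B C1 : R) : Prop :=
  [/\ 0 < alpha < 1 ->
        T_law (fun=> 0) (fun n => B * n%:R `^ alpha^-1) nu (fun s => s),
      alpha = 1 -> exists2 a : nat -> R,
        asymp_equiv \oo a (fun n => n%:R * ln n%:R) &
        T_law (fun n => A * a n) (fun n => B * n%:R) nu (fun s => C1 + s),
      1 < alpha < 2 ->
        T_law (fun n => A * n%:R) (fun n => B * n%:R `^ alpha^-1) nu (fun s => s)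
    & alpha = 2 ->
        T_law (fun n => A * n%:R) (fun n => B * (n%:R * ln n%:R) `^ 2^-1)
          (normal_prob 0 1) (fun s => s)].

Let X_law (c b : nat -> R) (nu' : probability (measurableTypeR R) R) Z :=
  cvg_in_distribution PP
    (fun k (X : path_space) => (((X k)%:~R - c k) / b k)%:E) nu' Z.

Definition walk_limits (alpha A B C1 : R) : Prop :=
  [/\ 0 < alpha < 1 ->
        X_law (fun=> 0) (fun k => B `^ (- alpha) * k%:R `^ alpha)
          nu (fun s => s `^ (- alpha)),
      alpha = 1 -> exists2 ahat : nat -> R,
        asymp_equiv \oo ahat (fun k => k%:R * (ln k%:R)^-1) &
        X_law (fun k => A^-1 * ahat k)
          (fun k => A ^- 2 * B * k%:R * (ln k%:R) ^- 2) nu (fun s => - C1 - s),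
      1 < alpha < 2 ->
        X_law (fun k => A^-1 * k%:R)
          (fun k => A `^ (- (1 + alpha^-1)) * B * k%:R `^ alpha^-1)
          nu (fun s => - s)
    & alpha = 2 ->
        X_law (fun k => A^-1 * k%:R)
          (fun k => A `^ (- (3 / 2)) * B * (k%:R * ln k%:R) `^ 2^-1)
          (normal_prob 0 1) (fun s => s)].

End Limits.

(* Main.v *)
(** The walk and its first passage times are inverse to each other up to
    backtracking: as the walk moves by unit steps,
      P (T_(n+m) <= k) - P (X visits n after n+m, before time k)
        <= P (X_k >= n) <= P (T_n <= k),
    and the backtracking probability tends to 0 as m -> oo, uniformly in n and k.
    Indeed, given the environment it is at most the sum over l >= m of the
    products of the odds (1 - omega_j)/omega_j over the l sites above n.  The
    value E rho^alpha = 1 and nonarithmeticity give E rho^(alpha/2) < 1, so these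
    sums converge almost surely; and they can be averaged over the environment
    because, by stationarity of the site data, a fixed level n lies at distance
    r from the next marked site with probability at most P (xi > r), which is
    summable.

    Hence P (X_k <= r) is asymptotically P (T_n > k) with n = floor r + 1, and each
    limit law for X follows from the one for T by computing the limit of
    (k - c(n))/b(n), where c and b are the centring and norming of T.  For
    alpha <> 1 this is regular variation of b.

    For alpha = 1 the centring a(n) ~ n log n is not explicit, and one needs
    (a(n+m) - a(n))/n -> x whenever m log n / n -> x.  After the passage at S_k,
    the walk sees an environment with the original law, S_k ~ k E xi, and
    T_v/(A v log v) -> 1 in probability; so with k ~ m/E xi the law of T_(n+m) is
    asymptotically that of T_n shifted by A x n up to o(n), and the limit law
    being nondegenerate, the centrings must be shifted accordingly. *)

Require Import Defs.
From HB Require Import structures.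
From mathcomp Require Import all_boot all_order all_algebra.
From mathcomp Require Import all_classical all_reals all_analysis.
From mathcomp Require Import measurable_realfun ring lra zify.

Set Implicit Arguments.
Unset Strict Implicit.
Unset Printing Implicit Defensive.

Import Order.TTheory GRing.Theory Num.Theory.
Import numFieldNormedType.Exports.
Local Open Scope classical_set_scope.
Local Open Scope ring_scope.

(** * The quenched walk *)

(** A quenched law is known only through its recursion on initial path segments. Probabilistic
    statements are therefore made for events decided by finitely many steps. Such an event is a
    countable disjoint union of cylinders, so an identity between measures can be tested on
    cylinders, and quenched probabilities become explicit measurable functions of the site data.
    Random times enter by splitting over their finitely many possible values. Two choices shape the
    transience estimate. The exponent alpha/2 is at most 1, so summability of the powers gives
    summability of the terms, and it turns E rho^alpha = 1 into a statement about the mean square of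
    rho^(alpha/2) - 1. Truncating the bound at 1 makes the length of a gap a dominating function,
    integrable because E xi is finite. Limit distribution functions may have jumps as far as the
    argument is concerned: bounds are one-sided and pass through nearby continuity points. *)

Definition path_cylinder (n : nat) (x : nat -> int) : set path_space :=
  [set X | forall m, (m <= n)%N -> X m = x m].

(** Replaces the sigma-algebra generated by the first [n.+1] positions. Positions are integers, so
    this invariance alone already forces measurability. *)
Definition finite_horizon (n : nat) (A : set path_space) : Prop :=
  forall X Y : path_space, (forall m, (m <= n)%N -> X m = Y m) -> A X -> A Y.

Lemma measurable_coordinate n i : measurable [set X : path_space | X n = i].
Proof. by apply: sub_sigma_algebra; exists n, i. Qed.

Lemma measurable_path_cylinder n x : measurable (path_cylinder n x).
Proof.
rewrite (_ : path_cylinder n x =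
  \bigcap_(m in [set m | (m <= n)%N]) [set X : path_space | X m = x m]).
  by apply: bigcap_measurable; [exists 0%N | move=> m _; exact: measurable_coordinate].
by apply/seteqP; split.
Qed.

Definition word n (u : (n.+1).-tuple int) (j : nat) : int := nth 0 u j.

(** Initial segments of a path form a countable type, so the codes of tuples cut [A] into countably
    many disjoint pieces. If [A] has horizon [n], each nonempty piece is a whole cylinder. An index
    that codes no tuple gives the empty piece. *)
Definition slice n (A : set path_space) (i : nat) : set path_space :=
  if (pickle_inv i : option ((n.+1).-tuple int)) is Some u
  then A `&` path_cylinder n (word u) else set0.

Lemma slice_cover n A : A = \bigcup_i slice n A i.
Proof.
apply/seteqP; split => [X AX|X [i _]]; last first.
  by rewrite /slice; case: pickle_inv => // u [].
exists (pickle [tuple X (nat_of_ord j) | j < n.+1]) => //.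
rewrite /slice pickleK_inv; split=> // m mn.
have mn' : (m < n.+1)%N by [].
by rewrite /word -(tnth_nth 0 _ (Ordinal mn')) tnth_mktuple.
Qed.

Lemma slice_trivIset n A : trivIset setT (slice n A).
Proof.
move=> i j _ _ [X []]; rewrite /slice.
have := @pickle_invK ((n.+1).-tuple int) i.
have := @pickle_invK ((n.+1).-tuple int) j.
case: pickle_inv => [v|//] /= jv; case: pickle_inv => [u|//] /= iu [_ Xu] [_ Xv].
rewrite -iu -jv; congr pickle.
apply: eq_from_tnth => l; rewrite !(tnth_nth 0) -!/(word _ _).
by rewrite -Xu ?Xv// -ltnS.
Qed.

Lemma slice_horizon n A i : finite_horizon n A -> slice n A i !=set0 ->
  exists x, A x /\ slice n A i = path_cylinder n x.
Proof.
move=> An [X]; rewrite /slice; case: pickle_inv => [u|//] [AX Xu].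
exists X; split=> //; apply/seteqP; split => Y.
  by move=> [_ Yu] m mn; rewrite Yu// Xu.
move=> YX; split; first by apply: (An X) => // m mn; rewrite YX.
by move=> m mn; rewrite YX// Xu.
Qed.

Lemma measurable_slice n A i : finite_horizon n A -> measurable (slice n A i).
Proof.
move=> An; have [/slice_horizon|/set0P/negP/negPn/eqP ->] := pselect (slice n A i !=set0).
  by move=> /(_ An)[x [_ ->]]; exact: measurable_path_cylinder.
exact: measurable0.
Qed.

Lemma measurable_finite_horizon n A : finite_horizon n A -> measurable A.
Proof.
move=> An; rewrite (slice_cover n A).
by apply: bigcupT_measurable => i; exact: measurable_slice.
Qed.

Definition bad_step n : set path_space :=
  [set X | ~ (X n.+1 = X n + 1 \/ X n.+1 = X n - 1)].

Lemma measurable_bad_step n : measurable (bad_step n).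
Proof.
apply: (@measurable_finite_horizon n.+1) => X Y XY.
by rewrite /bad_step/= !XY.
Qed.

Section FiniteHorizon.
Context (R : realType).
Local Open Scope ereal_scope.

Lemma measure_slices (m : {measure set path_space -> \bar R}) n A :
  finite_horizon n A -> m A = \sum_(i <oo) m (slice n A i).
Proof.
move=> An; rewrite {1}(slice_cover n A).
apply: measure_semi_bigcup; last by rewrite -slice_cover; exact: (measurable_finite_horizon An).
  by move=> i; exact: measurable_slice.
exact: slice_trivIset.
Qed.

(** The workhorse for Markov properties: both sides of an identity are read as measures of the past
    event [A], and the identity is then checked on cylinders only. *)
Lemma eq_measure_horizon (m1 m2 : {measure set path_space -> \bar R}) n A :
  finite_horizon n A -> (forall x, A x -> m1 (path_cylinder n x) = m2 (path_cylinder n x)) ->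
  m1 A = m2 A.
Proof.
move=> An m12; rewrite !(measure_slices _ An); apply: eq_eseriesr => i _.
have [/slice_horizon|/set0P/negP/negPn/eqP ->] := pselect (slice n A i !=set0).
  by move=> /(_ An)[x [Ax ->]]; exact: m12.
by rewrite !measure0.
Qed.

End FiniteHorizon.

Lemma probability_setU_le d (T : measurableType d) (R : realType)
  (P : probability T R) (A B : set T) : measurable A -> measurable B ->
  (P (A `|` B) <= P A + P B)%E.
Proof. by move=> mA mB; exact: measureU2. Qed.

Lemma probability_setI1 d (T : measurableType d) (R : realType)
  (P : probability T R) (A B : set T) : measurable A -> measurable B ->
  P A = 1%E -> (P (A `&` B) = P B)%E.
Proof.
move=> mA mB PA; have mAC := measurableC mA.
rewrite -[in RHS](setUIDK B A) setIC measureU0//.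
- exact: measurableI.
- exact: measurableD.
apply/eqP; rewrite eq_le measure_ge0 andbT.
apply: (@le_trans _ _ (P (~` A))).
  by apply: le_measure; rewrite ?inE//; exact: measurableD.
by rewrite probability_setC// PA subee.
Qed.

Lemma probability_bigsetU_le d (T : measurableType d) (R : realType)
  (P : probability T R) (A : nat -> set T) n : (forall i, measurable (A i)) ->
  (P (\big[setU/set0]_(i < n) A i) <= \sum_(i < n) P (A i))%E.
Proof.
move=> mA; elim: n => [|n IH]; first by rewrite !big_ord0 measure0.
rewrite !big_ord_recr/=; apply: le_trans (probability_setU_le _ _ _) _ => //.
  exact: bigsetU_measurable.
exact: leeD2r.
Qed.

Section Quenched.
Context (R : realType) (omega : int -> R) (Q : probability path_space R).
Hypothesis QP : quenched_law omega Q.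
Hypothesis omega01 : forall n, (0 < omega n < 1)%R.
Local Open Scope ereal_scope.

Lemma jump_ge0 i j : (0 <= jump omega i j)%R.
Proof.
rewrite /jump; case: ifP => _; first by case/andP: (omega01 i) => /ltW.
by case: ifP => // _; rewrite subr_ge0; case/andP: (omega01 i) => _ /ltW.
Qed.

(** In the variable [F] the left side is [Q] restricted to the next position being [y], and the
    right side is a multiple of [Q]. On a cylinder the two agree by the recursion that defines a
    quenched law. *)
Lemma markov_step n (F : set path_space) x y : finite_horizon n F ->
  (forall X, F X -> X n = x) ->
  Q (F `&` [set X | X n.+1 = y]) = Q F * (jump omega x y)%:E.
Proof.
move=> Fn Fx.
have mC := measurable_coordinate n.+1 y.
pose m1 := mrestr Q mC.
pose m2 := mscale (NngNum (jump_ge0 x y)) Q.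
rewrite -[LHS]/(m1 F) muleC -[RHS]/(m2 F).
apply: (@eq_measure_horizon _ m1 m2 n) => // u Fu.
rewrite /m1 /m2 /mrestr /mscale/=.
(* The recursion is applied to the path that follows [u] up to time [n] and then sits at [y]. *)
case: QP => _ /(_ n (fun m => if (m <= n)%N then u m else y)) /=.
rewrite leqnn ltnn (Fx _ Fu).
rewrite (_ : [set X | forall m, (m <= n)%N -> _] = path_cylinder n u); last first.
  by apply/seteqP; split => X /= H m mn; have := H m mn; rewrite ?mn.
rewrite -/(path_cylinder _ _) muleC => E; rewrite -[RHS]E; congr (Q _); apply/seteqP; split => X /=.
  + move=> [Xu Xy] m; rewrite leq_eqVlt ltnS => /orP[/eqP -> |mn].
      by rewrite ltnn.
    by rewrite mn Xu.
  + move=> H; split=> [m mn|]; last by rewrite H// ltnn.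
    by rewrite H ?mn// ltnW.
Qed.

Lemma step_up_down n (F : set path_space) x : finite_horizon n F ->
  (forall X, F X -> X n = x) ->
  Q F = Q (F `&` [set X | X n.+1 = (x + 1)%R]) + Q (F `&` [set X | X n.+1 = (x - 1)%R]).
Proof.
move=> Fn Fx; rewrite !(markov_step _ Fn Fx) /jump !eqxx.
have -> : (x - 1 == x + 1)%R = false by apply/eqP; lia.
by rewrite -ge0_muleDr ?lee_fin ?subr_ge0; [rewrite -EFinD addrC subrK mule1| |];
  case/andP: (omega01 x) => // /ltW ? /ltW.
Qed.

(** The recursion concerns one cylinder at a time. The two admissible continuations exhaust the mass
    of each cylinder, so removing [bad_step n] changes no cylinder probability and hence not the
    total mass. *)
Lemma nearest_neighbour_step n : Q (bad_step n) = 0.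
Proof.
have mS : measurable (~` bad_step n) by apply: measurableC; exact: measurable_bad_step.
rewrite -(setCK (bad_step n)) probability_setC// (_ : Q _ = 1) ?subee//.
rewrite -(probability_setT Q) -[LHS](congr1 Q (setTI _)).
pose m1 := mrestr Q mS.
rewrite -[LHS]/(m1 setT).
apply: (@eq_measure_horizon _ m1 Q n) => // u _.
rewrite /m1 /mrestr.
have Cn : finite_horizon n (path_cylinder n u).
  by move=> X Y XY Xu m mn; rewrite -XY// Xu.
have Cx X : path_cylinder n u X -> X n = u n by exact.
rewrite [RHS](step_up_down Cn Cx) -measureU//=; last 3 first.
- by apply: measurableI; [exact: measurable_path_cylinder|exact: measurable_coordinate].
- by apply: measurableI; [exact: measurable_path_cylinder|exact: measurable_coordinate].
- by apply/seteqP; split => X //= [[_ ->] [_]]; lia.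
congr (Q _); apply/seteqP; split => X /=.
  by move=> [Xu]; rewrite /bad_step/= notK (Cx _ Xu) => -[]; [left|right].
by move=> [] [Xu e]; split => //; rewrite /bad_step/= notK (Cx _ Xu) e; [left|right].
Qed.

Lemma path_start : Q [set X | X 0%N <> 0%R] = 0.
Proof.
have -> : [set X : path_space | X 0%N <> 0%R] = ~` [set X : path_space | X 0%N = 0%R] by [].
rewrite probability_setC//; last exact: measurable_coordinate.
by case: QP => -> _; rewrite subee.
Qed.

Lemma cylinder_start n x : x 0%N != 0%R -> Q (path_cylinder n x) = 0.
Proof.
move=> x0; apply/eqP; rewrite eq_le measure_ge0 andbT -path_start.
apply: le_measure; rewrite ?inE.
- exact: measurable_path_cylinder.
- rewrite (_ : [set X | _] = ~` [set X : path_space | X 0%N = 0%R])//.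
  by apply: measurableC; exact: measurable_coordinate.
- by move=> X /(_ 0%N isT) /= ->; exact/eqP.
Qed.

Definition hit_after (N t : nat) (y : int) : set path_space :=
  [set X | exists2 j, (j <= t)%N & X (N + j)%N = y].

Lemma finite_horizon_hit_after N t y : finite_horizon (N + t) (hit_after N t y).
Proof. by move=> X Y XY [j jt Xj]; exists j => //; rewrite -XY// leq_add2l. Qed.

(** * Hitting probabilities bounded by superharmonic functions *)

Section Superharmonic.
Context (h : int -> R) (y : int).
Hypothesis h_ge0 : forall x : int, (y <= x)%R -> (0 <= h x)%R.
Hypothesis hy : (1 <= h y)%R.
Hypothesis h_super : forall x : int, (y < x)%R ->
  (omega x * h (x + 1) + (1 - omega x) * h (x - 1) <= h x)%R.

(** Optional stopping in finite time, by induction on the remaining time [t]: above [y] one step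
    splits [F] according to the next position and superharmonicity recombines the two bounds; at [y]
    itself [h] is at least 1. *)
Lemma hit_le_superharmonic t N F (x : int) : (y <= x)%R -> finite_horizon N F ->
  (forall X, F X -> X N = x) -> Q (F `&` hit_after N t y) <= Q F * (h x)%:E.
Proof.
have leF N' t' F' : finite_horizon N' F' -> Q (F' `&` hit_after N' t' y) <= Q F'.
  move=> FN; have mF := measurable_finite_horizon FN.
  apply: le_measure; rewrite ?inE//.
  apply: measurableI => //.
  exact: (measurable_finite_horizon (@finite_horizon_hit_after _ _ _)).
elim: t N F x => [|t IH] N F x yx FN Fx.
  have [xy|/eqP xy] := eqVneq x y.
    apply: (@le_trans _ _ (Q F)); first exact: leF.
    by rewrite -[leLHS]mule1 xy lee_pmul// lee_fin.
  rewrite (_ : F `&` _ = set0) ?measure0 ?mule_ge0 ?lee_fin ?h_ge0//.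
  apply/seteqP; split => X //= [FX [j]]; rewrite leqn0 => /eqP ->.
  by rewrite addn0 (Fx _ FX).
have [xy|/eqP xy] := eqVneq x y.
  apply: (@le_trans _ _ (Q F)); first exact: leF.
  by rewrite -[leLHS]mule1 xy lee_pmul// lee_fin.
have {xy}yx' : (y < x)%R by lia.
have step z : finite_horizon N.+1 (F `&` [set X | X N.+1 = z]).
  move=> X Y XY [FX Xz]; split; last by rewrite /= -XY.
  by apply: (FN X) => // j jN; apply: XY; exact: ltnW.
have EX : F `&` hit_after N t.+1 y `<=`
    ((F `&` [set X | X N.+1 = (x + 1)%R]) `&` hit_after N.+1 t y) `|`
    ((F `&` [set X | X N.+1 = (x - 1)%R]) `&` hit_after N.+1 t y) `|`
    bad_step N.
  move=> X [FX [[|j] jt Xj]].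
    by move: Xj; rewrite addn0 (Fx _ FX) => e; move: yx'; rewrite e ltxx.
  have := Fx _ FX.
  have [XN Xx|nXN _] := pselect (X N.+1 = (X N + 1)%R \/ X N.+1 = (X N - 1)%R); last by right.
  left; case: XN; rewrite Xx => XN; [left|right]; split=> //; exists j => //;
    by rewrite addSnnS.
have mstep z : measurable ((F `&` [set X | X N.+1 = z]) `&` hit_after N.+1 t y).
  apply: measurableI; first exact: (measurable_finite_horizon (step z)).
  exact: (measurable_finite_horizon (@finite_horizon_hit_after _ _ _)).
have mNN := measurable_bad_step N.
apply: (@le_trans _ _ (Q _)).
  apply: le_measure EX; rewrite inE.
    apply: measurableI; first exact: (measurable_finite_horizon FN).
    exact: (measurable_finite_horizon (@finite_horizon_hit_after _ _ _)).
  by apply: measurableU => //; apply: measurableU.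
apply: (le_trans (probability_setU_le _ _ _)) => //; first exact: measurableU.
rewrite nearest_neighbour_step adde0.
apply: (le_trans (probability_setU_le _ _ _)) => //.
have yx1 : (y <= x + 1)%R by lia.
have yx2 : (y <= x - 1)%R by lia.
apply: (le_trans (leeD (IH _ _ _ yx1 (step _) _) (IH _ _ _ yx2 (step _) _))).
- by move=> X [].
- by move=> X [].
rewrite !(markov_step _ FN Fx) /jump !eqxx.
have -> : (x - 1 == x + 1)%R = false by apply/eqP; lia.
have [p0 q0] : ((0 <= omega x) /\ (0 <= 1 - omega x))%R.
  by rewrite subr_ge0; case/andP: (omega01 x) => /ltW ? /ltW.
rewrite -!muleA -!EFinM -ge0_muleDr; [|by rewrite lee_fin mulr_ge0// h_ge0..].
by apply: lee_pmul => //; rewrite -EFinD lee_fin ?h_super// addr_ge0// mulr_ge0// h_ge0.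
Qed.

(** The path is cut at its first visit to [b]. These first-visit events are disjoint, so their
    probabilities sum to at most 1 and the bound [h b] survives the summation, uniformly in [k]. *)
Lemma backtrack_le_superharmonic (b : int) k : (y <= b)%R ->
  Q [set X | exists i j, [/\ (i <= j)%N, (j <= k)%N, X i = b & X j = y]] <= (h b)%:E.
Proof.
move=> yb.
pose F i := [set X : path_space | X i = b /\ forall i', (i' < i)%N -> X i' <> b].
have FH i : finite_horizon i (F i).
  move=> X Y XY [Xi Xb]; split; first by rewrite -XY.
  by move=> j ji; rewrite -XY ?(ltnW ji)//; exact: Xb.
have mF i := measurable_finite_horizon (FH i).
have mH N t z := measurable_finite_horizon (@finite_horizon_hit_after N t z).
apply: (@le_trans _ _ (Q (\big[setU/set0]_(i < k.+1) (F i `&` hit_after i k y)))).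
  apply: le_measure; rewrite ?inE.
  - apply: (@measurable_finite_horizon k) => X Y XY /= [i [j [ij jk Xi Xj]]].
    by exists i, j; split => //; rewrite -XY// (leq_trans ij).
  - by apply: bigsetU_measurable => i _; exact: measurableI.
  move=> X [i [j [ij jk Xi Xj]]].
  have exi : exists i, X i == b by exists i; rewrite Xi.
  case: (ex_minnP exi) => i0 /eqP Xi0 i0min.
  have i0i : (i0 <= i)%N by apply: i0min; rewrite Xi.
  rewrite -(bigcup_mkord k.+1 (fun i => F i `&` hit_after i k y)); exists i0 => /=.
    by rewrite ltnS (leq_trans i0i)// (leq_trans ij).
  split.
    split=> // i' i'i0 e; move: i'i0; rewrite ltnNge => /negP; apply.
    by apply: i0min; rewrite e.
  exists (j - i0)%N; first by rewrite (leq_trans (leq_subr _ _)).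
  by rewrite subnKC// (leq_trans i0i).
apply: (le_trans (@probability_bigsetU_le _ _ _ Q (fun i => F i `&` hit_after i k y) k.+1 _)).
  by move=> i; exact: measurableI.
apply: (@le_trans _ _ (\sum_(i < k.+1) Q (F i) * (h b)%:E)).
  by apply: lee_sum => i _; apply: hit_le_superharmonic => // X [].
rewrite -ge0_sume_distrl// -[leRHS]mul1e lee_pmul ?sume_ge0 ?lee_fin ?h_ge0//.
rewrite -measure_bigsetU ?probability_le1//.
  by apply: bigsetU_measurable.
move=> i j _ _ [X [[Xi mi] [Xj mj]]].
by case: (ltngtP i j) => // ij; [case: (mj _ ij)|case: (mi _ ij)].
Qed.

End Superharmonic.
End Quenched.

(** * Markov property for shifted paths and restarting at a level *)

Definition path_shift (N : nat) (x : int) (X : path_space) : path_space :=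
  fun j => X (N + j)%N - x.

Lemma measurable_path_shift N x : measurable_fun setT (path_shift N x).
Proof.
apply: (@measurability _ _ _ _ _ (path_shift N x) cylinders) => //.
move=> _ [_ [n [i ->]] <-]; rewrite setTI.
rewrite (_ : _ @^-1` _ = [set X : path_space | X (N + n)%N = i + x]).
  exact: measurable_coordinate.
by apply/seteqP; split => X; rewrite /path_shift /=; lia.
Qed.

Section StrongMarkov.
Context (R : realType) (omega : int -> R) (Q Q' : probability path_space R) (x : int).
Hypothesis QP : quenched_law omega Q.
Hypothesis Q'P : quenched_law (fun n => omega (x + n)) Q'.
Hypothesis omega01 : forall n, (0 < omega n < 1)%R.
Local Open Scope ereal_scope.

Lemma finite_horizon_shift N F M A : finite_horizon N F -> finite_horizon M A ->
  finite_horizon (N + M) (F `&` path_shift N x @^-1` A).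
Proof.
move=> FN AM X Y XY [FX AX]; split.
  by apply: (FN X) => // m mN; apply: XY; rewrite (leq_trans mN)// leq_addr.
by apply: (AM (path_shift N x X)) => // m mM; rewrite /path_shift XY// leq_add2l.
Qed.

Lemma finite_horizon_cylinder M u : finite_horizon M (path_cylinder M u).
Proof. by move=> X Y XY Xu m mn; rewrite -XY// Xu. Qed.

(** Induction on the length of the cylinder, one [markov_step] at a time. At length 0 both sides
    vanish unless the cylinder starts at 0, where the shifted path starts. *)
Lemma strong_markov_cylinder N F M u : finite_horizon N F ->
  (forall X, F X -> X N = x) ->
  Q (F `&` path_shift N x @^-1` (path_cylinder M u)) = Q F * Q' (path_cylinder M u).
Proof.
move=> FN Fx; elim: M => [|M IH].
  have [u0|u0] := eqVneq (u 0%N) 0%R.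
    rewrite (_ : F `&` _ = F); last first.
      apply/seteqP; split => [X []//|X FX]; split => // m.
      by rewrite leqn0 => /eqP ->; rewrite /path_shift addn0 (Fx _ FX) subrr.
    rewrite (_ : path_cylinder 0 u = [set X | X 0%N = 0%R]) ?Q'P.1 ?mule1//.
    apply/seteqP; split => [X /(_ 0%N)|X /= X0 m]; first by rewrite u0; exact.
    by rewrite leqn0 => /eqP ->; rewrite u0.
  rewrite (_ : F `&` _ = set0).
    by rewrite (cylinder_start Q'P)// mule0 measure0.
  apply/seteqP; split => X //= [FX /(_ 0%N (leqnn _))].
  by rewrite /path_shift addn0 (Fx _ FX) subrr => /esym/eqP; rewrite (negbTE u0).
have -> : F `&` path_shift N x @^-1` path_cylinder M.+1 u =
    (F `&` path_shift N x @^-1` path_cylinder M u) `&`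
      [set X | X (N + M).+1 = (x + u M.+1)%R].
  apply/seteqP; split => X /=.
    move=> [FX Xu]; split.
      by split=> // m mM; apply: Xu; rewrite ltnW.
    by have := Xu M.+1 (leqnn _); rewrite /path_shift addnS; lia.
  move=> [[FX Xu] XM]; split => // m; rewrite leq_eqVlt ltnS => /orP[/eqP ->|].
    by rewrite /path_shift addnS; lia.
  exact: Xu.
rewrite (@markov_step _ _ _ QP omega01 _ _ (x + u M)%R); last first.
- by move=> X [_ /(_ M (leqnn _))]; rewrite /path_shift; lia.
- exact: (finite_horizon_shift FN (@finite_horizon_cylinder _ _)).
rewrite IH -muleA; congr (_ * _).
rewrite [RHS]Q'P.2; congr (_ * _).
congr EFin; rewrite /jump.
have -> : (x + u M.+1 == x + u M + 1)%R = (u M.+1 == u M + 1)%R by apply/eqP/eqP; lia.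
by have -> : (x + u M.+1 == x + u M - 1)%R = (u M.+1 == u M - 1)%R by apply/eqP/eqP; lia.
Qed.

(** The time [N] is deterministic and [F] fixes the position there. First hitting times are treated
    afterwards by summing over [first_hit x i]. *)
Lemma strong_markov N F M A : finite_horizon N F -> (forall X, F X -> X N = x) ->
  finite_horizon M A ->
  Q (F `&` path_shift N x @^-1` A) = Q F * Q' A.
Proof.
move=> FN Fx AM.
have mF := measurable_finite_horizon FN.
pose m1 : {measure set path_space -> \bar R} :=
  measure_function_pushforward__canonical__measure_function_Measure
    (mrestr Q mF) (measurable_path_shift N x).
have fQ : (0 <= fine (Q F))%R by exact: fine_ge0.
pose m2 := mscale (NngNum fQ) Q'.
have -> : Q F * Q' A = m2 A by rewrite /m2 /mscale/= fineK// fin_num_measure.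
rewrite setIC -[LHS]/(m1 A); apply: (@eq_measure_horizon _ m1 m2 M) => // u Au.
rewrite -[LHS]/(Q (path_shift N x @^-1` path_cylinder M u `&` F)).
rewrite -[RHS]/((fine (Q F))%:E * Q' (path_cylinder M u)).
by rewrite fineK ?fin_num_measure// setIC strong_markov_cylinder.
Qed.

End StrongMarkov.

Definition hit (n : int) (t : nat) : set path_space := [set X | exists2 j, (j <= t)%N & X j = n].

Lemma finite_horizon_hit n t : finite_horizon t (hit n t).
Proof. by move=> X Y XY [j jt Xj]; exists j => //; rewrite -XY. Qed.

Lemma measurable_hit n t : measurable (hit n t).
Proof. exact: (measurable_finite_horizon (@finite_horizon_hit n t)). Qed.

Definition backtrack (n b : int) (k : nat) : set path_space :=
  [set X | exists i j, [/\ (i <= j)%N, (j <= k)%N, X i = b & X j = n]].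

Lemma finite_horizon_backtrack n b k : finite_horizon k (backtrack n b k).
Proof.
move=> X Y XY [i [j [ij jk Xi Xj]]].
by exists i, j; split => //; rewrite -XY// (leq_trans ij).
Qed.

Definition nearest_neighbour : set path_space :=
  [set X | X 0%N = 0 /\ forall n, X n.+1 = X n + 1 \/ X n.+1 = X n - 1].

Lemma measurable_nearest_neighbour : measurable nearest_neighbour.
Proof.
rewrite (_ : nearest_neighbour =
  [set X : path_space | X 0%N = 0] `&` \bigcap_n ~` bad_step n).
  apply: measurableI; first exact: measurable_coordinate.
  by apply: bigcapT_measurable => n; apply: measurableC; exact: measurable_bad_step.
apply/seteqP; split => X [X0 Xn]; split => // n; first by move=> _ /=; apply; exact: Xn.
by have := Xn n I; rewrite /bad_step/= notK.
Qed.

Lemma quenched_nearest_neighbour (R : realType) (omega : int -> R)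
    (Q : probability path_space R) : quenched_law omega Q ->
  (forall n, 0 < omega n < 1) -> Q nearest_neighbour = 1%E.
Proof.
move=> QP omega01.
rewrite -(setCK nearest_neighbour) probability_setC; last first.
  by apply: measurableC; exact: measurable_nearest_neighbour.
rewrite (_ : Q _ = 0%E) ?sube0//; apply/eqP; rewrite eq_le measure_ge0 andbT.
apply: (@le_trans _ _ (Q ([set X | X 0%N <> 0] `|` \bigcup_n bad_step n))).
  apply: le_measure; rewrite ?inE.
  - by apply: measurableC; exact: measurable_nearest_neighbour.
  - apply: measurableU; last by apply: bigcupT_measurable => n; exact: measurable_bad_step.
    by apply: (measurableC (measurable_coordinate 0 0)).
  - move=> X; have [X0 nX|] := pselect (X 0%N = 0); last by left.
    right; apply: contrapT => nb; apply: nX; split => // n.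
    by apply: contrapT => ?; apply: nb; exists n.
rewrite le_eqVlt; apply/orP; left; apply/eqP.
have m0 : measurable [set X : path_space | X 0%N <> 0].
  by apply: (measurableC (measurable_coordinate 0 0)).
have mb : measurable (\bigcup_n bad_step n).
  by apply: bigcupT_measurable => n; exact: measurable_bad_step.
have b0 : Q (\bigcup_n bad_step n) = 0%E.
  apply/eqP; rewrite -measure_le0.
  apply: (le_trans (measure_sigma_subadditive _ _ _ (@subset_refl _ _))) => //.
    by move=> n; exact: measurable_bad_step.
  by rewrite eseries0// => n _ _; apply: (nearest_neighbour_step QP).
rewrite measureU0//; exact: (path_start QP).
Qed.

Lemma nearest_neighbour_hit X (k n : nat) : nearest_neighbour X ->
  n%:Z <= X k -> hit n k X.
Proof.
move=> [X0 XS]; elim: k => [|k IH] nX.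
  by exists 0%N => //; move: nX; rewrite X0; lia.
have [/IH[j jk Xj]|Xk] := lerP n%:Z (X k); first by exists j => //; exact: ltnW.
by exists k.+1 => //; case: (XS k) nX => ->; lia.
Qed.

Lemma nearest_neighbour_cross X (i k : nat) (n : int) : nearest_neighbour X ->
  (i <= k)%N -> n <= X i -> X k < n -> exists2 j, (i <= j <= k)%N & X j = n.
Proof.
move=> [X0 XS]; elim: k => [|k IH] ik nX Xk.
  by move: ik nX; rewrite leqn0 => /eqP ->; rewrite leNgt Xk.
move: ik; rewrite leq_eqVlt => /orP[/eqP e|]; first by move: nX; rewrite e leNgt Xk.
rewrite ltnS => ik.
have [nk|nk] := ltP (X k) n.
  by have [j /andP[ij jk] Xj] := IH ik nX nk; exists j => //; rewrite ij ltnW.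
exists k; first by rewrite ik leqnSn.
by case: (XS k) Xk => ->; lia.
Qed.

(** A path that has reached [n + m] and is below [n] at time [k] must, moving by unit steps, visit
    [n] in between. *)
Lemma hit_subset_backtrack (n m k : nat) :
  nearest_neighbour `&` hit (n + m)%N k `<=`
  [set X | n%:Z <= X k] `|` backtrack n (n + m)%N k.
Proof.
move=> X [XN [i ik Xi]].
have [|Xk] := lerP n%:Z (X k); [by left|right].
have nXi : n%:Z <= X i by rewrite Xi; lia.
have [j /andP[ij jk] Xj] := nearest_neighbour_cross XN ik nXi Xk.
by exists i, j.
Qed.

Lemma hit_mono (n m : nat) t : (n <= m)%N -> nearest_neighbour `&` hit m t `<=` hit n t.
Proof.
move=> nm X [XN [j jt Xj]].
have : n%:Z <= X j by rewrite Xj; lia.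
by move=> /(nearest_neighbour_hit XN)[i ij Xi]; exists i => //; exact: leq_trans jt.
Qed.

Definition first_hit (x : int) (i : nat) : set path_space :=
  [set X | X i = x /\ forall j, (j < i)%N -> X j <> x].

Lemma finite_horizon_first_hit x i : finite_horizon i (first_hit x i).
Proof.
move=> X Y XY [Xi Xb]; split; first by rewrite -XY.
by move=> j ji; rewrite -XY ?(ltnW ji)//; exact: Xb.
Qed.

Lemma measurable_first_hit x i : measurable (first_hit x i).
Proof. exact: (measurable_finite_horizon (@finite_horizon_first_hit x i)). Qed.

Lemma hit_first_hit x t X : hit x t X -> exists2 i, (i <= t)%N & first_hit x i X.
Proof.
move=> [j jt Xj]; have exi : exists i, X i == x by exists j; rewrite Xj.
case: (ex_minnP exi) => i /eqP Xi imin; exists i.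
  by rewrite (leq_trans _ jt)// imin// Xj.
split=> // i' i'i e; move: i'i; rewrite ltnNge => /negP; apply.
by rewrite imin// e.
Qed.

Section RestartAtFirstHit.
Context (R : realType) (omega : int -> R) (Q Q' : probability path_space R) (x : int).
Hypothesis QP : quenched_law omega Q.
Hypothesis Q'P : quenched_law (fun n => omega (x + n)) Q'.
Hypothesis omega01 : forall n, (0 < omega n < 1)%R.
Local Open Scope ereal_scope.

Lemma measurable_restart M A i : finite_horizon M A ->
  measurable (first_hit x i `&` path_shift i x @^-1` A).
Proof.
move=> AM; apply: (@measurable_finite_horizon (i + M)).
by apply: finite_horizon_shift => //; exact: finite_horizon_first_hit.
Qed.

(** The events [first_hit x i] are disjoint, so the weights in front of [Q' A] add up to at most
    1. *)
Lemma restart_le M A t : finite_horizon M A ->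
  Q (\big[setU/set0]_(i < t) (first_hit x i `&` path_shift i x @^-1` A)) <= Q' A.
Proof.
move=> AM.
have mS i := measurable_restart i AM.
apply: (le_trans (@probability_bigsetU_le _ _ _ Q _ t mS)).
rewrite (eq_bigr (fun i : 'I_t => Q (first_hit x i) * Q' A)); last first.
  move=> i _; apply: (strong_markov QP Q'P) => //; last exact: AM.
    exact: finite_horizon_first_hit.
  by move=> X [].
rewrite -ge0_sume_distrl// -[leRHS]mul1e lee_pmul ?sume_ge0//.
rewrite -measure_bigsetU ?probability_le1//.
- by apply: bigsetU_measurable => i _; exact: measurable_first_hit.
- by move=> i; exact: measurable_first_hit.
- move=> i j _ _ [X [[Xi mi] [Xj mj]]].
  by case: (ltngtP i j) => // ij; [case: (mj _ ij)|case: (mi _ ij)].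
Qed.

Lemma finite_horizonC n A : finite_horizon n A -> finite_horizon n (~` A).
Proof. by move=> An X Y XY nAX AY; apply/nAX/(An Y) => // m /XY. Qed.

(** If [x] is reached by time [t1] and the restarted walk climbs [n] more levels within [t2], then
    [x + n] is reached by [t1 + t2]; the bound is the union bound for the complement. *)
Lemma not_hit_le (n t1 t2 : nat) :
  Q (~` hit (x + n%:Z) (t1 + t2)%N) <= Q (~` hit x t1) + Q' (~` hit n t2).
Proof.
have mH n' t' : measurable (~` hit n' t') by apply: measurableC; exact: measurable_hit.
have Hn := finite_horizonC (@finite_horizon_hit n t2).
have mS i := measurable_restart i Hn.
apply: le_trans (leeD2l _ (@restart_le t2 _ t1.+1 Hn)).
have mU : measurable (\big[setU/set0]_(i < t1.+1)
   (first_hit x i `&` path_shift i x @^-1` (~` hit n t2))).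
  by apply: bigsetU_measurable.
apply: le_trans (probability_setU_le _ _ _) => //.
apply: le_measure; rewrite ?inE//; first exact: measurableU.
move=> X nX; have [/hit_first_hit[i it1 Xi]|] := pselect (hit x t1 X); last by left.
right; rewrite -(bigcup_mkord t1.+1 (fun i => first_hit x i `&` path_shift i x @^-1` (~` hit n t2))).
exists i => //; split => // -[j jt2 Xj]; apply: nX; exists (i + j)%N; first exact: leq_add.
by move: Xj; rewrite /path_shift; lia.
Qed.

(** The walk starts at 0 and [x] is nonnegative, so it passes [x] before [x + n]. If that passage
    comes after [t1], fewer than [t2] steps are left for the rest. *)
Lemma hit_le (n t1 t2 : nat) : (0 <= x)%R ->
  Q (hit (x + n%:Z) (t1 + t2)%N) <= Q (hit x t1) + Q' (hit n t2).
Proof.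
move=> x0.
have mH n' t' := measurable_hit n' t'.
have mN := measurable_nearest_neighbour.
have Hn := @finite_horizon_hit n t2.
have mS i := measurable_restart i Hn.
(* The first visit to [x] may happen at any time up to [t1 + t2], hence this range of the union. *)
apply: le_trans (leeD2l _ (@restart_le t2 _ (t1 + t2).+1 Hn)).
have mU : measurable (\big[setU/set0]_(i < (t1 + t2).+1)
   (first_hit x i `&` path_shift i x @^-1` (hit n t2))).
  by apply: bigsetU_measurable.
apply: le_trans (probability_setU_le _ _ _) => //.
have -> : Q (hit (x + n%:Z) (t1 + t2)%N) = Q (nearest_neighbour `&` hit (x + n%:Z) (t1 + t2)%N).
  by rewrite probability_setI1//; exact: (quenched_nearest_neighbour QP).
apply: le_measure; rewrite ?inE//; [exact: measurableI|exact: measurableU|].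
move=> X [XN [j jt Xj]].
have xXj : (`|x|%N%:Z <= X j)%R by rewrite Xj; lia.
have /hit_first_hit[i ij [Xi iX]] := nearest_neighbour_hit XN xXj.
have xx : (`|x|%N%:Z = x)%R by lia.
rewrite xx in Xi iX.
have [it1|it1] := leqP i t1; [by left; exists i|right].
rewrite -(bigcup_mkord (t1 + t2).+1 (fun i => first_hit x i `&` path_shift i x @^-1` (hit n t2))).
exists i; first by rewrite /= ltnS (leq_trans ij).
split=> //; exists (j - i)%N; first by lia.
by rewrite /path_shift subnKC// Xj; lia.
Qed.

End RestartAtFirstHit.

(** * Environment and potential *)

(* zify also rewrites inside the arguments of uninterpreted functions, so that
   the values of S_ and xi have to be generalized first. *)
Ltac slia :=
  repeat match goal with
  | H : context [S_ _ _] |- _ => revert H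
  | H : is_true (leq 1 (?f _)) |- _ => revert H
  end;
  repeat match goal with |- context [S_ ?a ?b] =>
    let s := fresh "s" in move: (S_ a b) => s end;
  repeat match goal with |- context [Posz (?f ?b)] =>
    is_var f; let s := fresh "s" in move: (f b) => s end;
  lia.

Section PartialSums.
Context (xi : int -> nat).

Lemma S_0 : S_ xi 0 = 0.
Proof. by rewrite /S_/= big_geq. Qed.

Lemma S_succ n : S_ xi (n + 1) = S_ xi n + (xi (n + 1))%:Z.
Proof.
case: n => [m|[|m]].
- have -> : Posz m + 1 = Posz m.+1 by lia.
  by rewrite /S_ big_nat_recr.
- have -> : Negz 0 + 1 = 0 by lia.
  by rewrite S_0 /S_ big_nat1 (_ : - 0%:Z = 0)// addNr.
- have -> : Negz m.+1 + 1 = Negz m by lia.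
  rewrite /S_ [in RHS]big_nat_recr//= opprD.
  have -> : Negz m = - (m.+1)%:Z by lia.
  by rewrite -addrA addNr addr0.
Qed.

Lemma S_pred n : S_ xi (n - 1) = S_ xi n - (xi n)%:Z.
Proof. by have := S_succ (n - 1); rewrite subrK => ->; rewrite addrK. Qed.

Lemma S_nat m : S_ xi m%:Z = \sum_(k < m) (xi k.+1%:Z)%:Z.
Proof. by rewrite /S_ big_add1/= big_mkord. Qed.

Hypothesis xi_gt0 : forall i, (0 < xi i)%N.

Lemma S_addn_ge k (m : nat) : S_ xi k + m%:Z <= S_ xi (k + m%:Z).
Proof.
elim: m => [|m IH]; first by rewrite !addr0.
have -> : k + m.+1%:Z = (k + m%:Z) + 1 by lia.
by rewrite S_succ; have := xi_gt0 (k + m%:Z + 1); slia.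
Qed.

Lemma S_mono k l : k <= l -> S_ xi k <= S_ xi l.
Proof.
move=> kl; have -> : l = k + (`|l - k|%N)%:Z by lia.
by apply: le_trans (S_addn_ge _ _); slia.
Qed.

Lemma S_strict k l : k < l -> S_ xi k < S_ xi l.
Proof.
move=> kl; have -> : l = k + (`|l - k|%N)%:Z by lia.
have := S_addn_ge k `|l - k|; have : (0 < `|l - k|)%N by lia.
slia.
Qed.

Lemma S_inj : injective (S_ xi).
Proof. by move=> k l; case: (ltgtP k l) => // /S_strict; lia. Qed.

Lemma S_first_ge (n : nat) : exists k : nat, S_ xi (k%:Z - 1) < n%:Z <= S_ xi k%:Z.
Proof.
have exk : exists k : nat, n%:Z <= S_ xi k%:Z.
  by exists n; have := S_addn_ge 0 n; rewrite S_0 !add0r.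
case: (ex_minnP exk) => k nk kmin; exists k; rewrite nk andbT.
case: k kmin nk => [|k] kmin nk.
  by have := @S_strict (0%:Z - 1) 0 isT; rewrite S_0; slia.
rewrite (_ : k.+1%:Z - 1 = k%:Z); last by lia.
by rewrite ltNge; apply/negP => /kmin; rewrite ltnn.
Qed.

End PartialSums.

Lemma S_shift (xi : int -> nat) (k n : int) :
  S_ (fun i => xi (k + i)) n = S_ xi (k + n) - S_ xi k.
Proof.
elim/int_ind: n => [|n IH|n IH]; first by rewrite addr0 S_0 subrr.
- have -> : n.+1%:Z = n%:Z + 1 by lia.
  by rewrite S_succ IH addrA S_succ; slia.
- have -> : - n.+1%:Z = - n%:Z - 1 by lia.
  by rewrite S_pred IH addrA S_pred; slia.
Qed.

Section Environment.
Context (R : realType) (xi : int -> nat) (lam : int -> R).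
Hypothesis xi_gt0 : forall i, (0 < xi i)%N.

Lemma environment_S k : environment xi lam (S_ xi k) = lam (k + 1).
Proof.
rewrite /environment; case: pselect => [h|[]]; last by exists k.
by case: cid => l /= /(S_inj xi_gt0) ->.
Qed.

Lemma environment_notS n : (forall k, S_ xi k <> n) -> environment xi lam n = 2^-1.
Proof. by rewrite /environment => nS; case: pselect => // -[k e]; case: (nS k). Qed.

Lemma environment_between k n : S_ xi k < n < S_ xi (k + 1) ->
  environment xi lam n = 2^-1.
Proof.
move=> /andP[kn nk]; apply: environment_notS => l e.
have [lk|kl] := lerP l k; first by have := S_mono xi_gt0 lk; slia.
have : k + 1 <= l by lia.
by move=> /(S_mono xi_gt0); slia.
Qed.

Lemma environment01 : (forall i, 0 < lam i < 1) -> forall n, 0 < environment xi lam n < 1.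
Proof.
move=> lam01 n; have [[l <-]|nS] := pselect (exists l, S_ xi l = n).
  by rewrite environment_S.
rewrite environment_notS; last by move=> l e; apply: nS; exists l.
by lra.
Qed.

End Environment.

(** Relabelling the sites by [k] amounts to viewing the environment from the marked site [S_k].
    Together with stationarity of the labels this gives the environment ahead of [S_k] the original
    law. *)
Lemma environment_shift (R : realType) (xi : int -> nat) (lam : int -> R) (k n : int) :
  (forall i, (0 < xi i)%N) ->
  environment (fun i => xi (k + i)) (fun i => lam (k + i)) n =
  environment xi lam (S_ xi k + n).
Proof.
move=> xi_gt0; have xik i : (0 < xi (k + i)%R)%N by [].
have [[l e]|nS] := pselect (exists l, S_ xi l = S_ xi k + n).
  rewrite -e (environment_S _ xi_gt0).
  have <- : S_ (fun i => xi (k + i)) (l - k) = n by rewrite S_shift [k + _]addrC subrK e addrC addKr.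
  rewrite /environment; case: pselect => [h|[]]; last by exists (l - k).
  case: cid => j /=; rewrite !S_shift => /eqP.
  rewrite (inj_eq (addIr _)) => /eqP /(S_inj xi_gt0) jl; congr lam.
  by move: jl; lia.
have nS1 l : S_ xi l <> S_ xi k + n by move=> e; apply: nS; exists l.
rewrite [RHS](environment_notS _ nS1).
apply: environment_notS => l; rewrite S_shift => e; apply: nS.
by exists (k + l); rewrite -e [RHS]addrC subrK.
Qed.

Section Potential.
Context (R : realType) (omega : int -> R).

Definition odds (j : int) : R := (1 - omega j) / omega j.

Definition odds_prod (b : int) (j : nat) : R := \prod_(i < j) odds (b + i.+1%:Z).

(** The sum from [m] is the unnormalized harmonic function of the walk above [b], read at distance
    [m]. Dividing it by the full sum would give a hitting probability; that sum is at least 1, its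
    first term being an empty product. The truncation keeps the bound integrable over
    environments. *)
Definition escape_bound (b : int) (m : nat) : \bar R :=
  Order.min 1%E (\sum_(m <= l <oo) (odds_prod b l)%:E)%E.

Hypothesis omega01 : forall n, 0 < omega n < 1.

Lemma odds_gt0 j : 0 < odds j.
Proof. by rewrite divr_gt0 ?subr_gt0; case/andP: (omega01 j). Qed.

Lemma odds_prod_gt0 b j : 0 < odds_prod b j.
Proof. by apply: prodr_gt0 => i _; exact: odds_gt0. Qed.

Lemma odds_prodS b j : odds_prod b j.+1 = odds_prod b j * odds (b + j.+1%:Z).
Proof. by rewrite /odds_prod big_ord_recr. Qed.

Lemma odds_prodD b i j : odds_prod b (i + j) = odds_prod b i * odds_prod (b + i%:Z) j.
Proof.
elim: j => [|j IH]; first by rewrite addn0 /odds_prod big_ord0 mulr1.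
rewrite addnS !odds_prodS IH mulrA; congr (_ * odds _); lia.
Qed.

Lemma escape_bound_ge0 b m : (0 <= escape_bound b m)%E.
Proof.
rewrite le_min lee01/=; apply: nneseries_ge0 => l _ _.
by rewrite lee_fin ltW// odds_prod_gt0.
Qed.

Lemma escape_bound_le1 b m : (escape_bound b m <= 1)%E.
Proof. by rewrite ge_min lexx. Qed.

(** The tail sum of odds products, as a function of the distance to [b], is harmonic above [b] and
    at least 1 at [b]. An infinite tail leaves only the trivial bound 1. *)
Lemma backtrack_escape_bound (Q : probability path_space R) (b : int) m k :
  quenched_law omega Q -> (Q (backtrack b (b + m%:Z) k) <= escape_bound b m)%E.
Proof.
move=> QP; rewrite le_min; apply/andP; split.
  apply: probability_le1.
  exact: (measurable_finite_horizon (@finite_horizon_backtrack b (b + m%:Z) k)).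
set s := (\sum_(m <= l <oo) _)%E.
have [->|sfin] := eqVneq s +oo%E; first by rewrite leey.
pose t j := (\sum_(j <= l <oo) (odds_prod b l)%:E)%E.
have ge0 l : (0 <= (odds_prod b l)%:E)%E by rewrite lee_fin ltW// odds_prod_gt0.
have t0 j : (0 <= t j)%E by apply: nneseries_ge0.
have tS j : t j = ((odds_prod b j)%:E + t j.+1)%E.
  by rewrite /t (@nneseries_split _ _ j 1)// addn1 big_nat1.
(* Tails differ by finitely many finite terms, so finiteness of the tail at [m] gives it for every
   tail, including the full sum used at [b]. *)
have tfin j : t j \is a fin_num.
  have t0m : t 0%N \is a fin_num.
    rewrite ge0_fin_numE// /t (@nneseries_split _ _ 0 m)// add0n lte_add_pinfty//.
      by rewrite sumEFin ltry.
    by rewrite ltey; exact: sfin.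
  elim: j => // j; rewrite tS fin_numD => /andP[_]; exact.
pose h x : R := fine (t `|x - b|%N).
have hS j : fine (t j) = odds_prod b j + fine (t j.+1).
  by rewrite tS fineD.
rewrite -[s]/(t m) -[leRHS](fineK (tfin m)) (_ : fine (t m) = h (b + m%:Z)); last first.
  by rewrite /h; congr (fine (t _)); lia.
apply: (@backtrack_le_superharmonic _ omega) => //.
- by move=> x _; exact: fine_ge0.
- rewrite /h subrr absz0 hS {1}/odds_prod big_ord0 lerDl.
  exact: fine_ge0.
(* The three values are consecutive tails, with differences [odds_prod b j] and [odds_prod b j.+1].
   These have ratio (1 - omega x)/omega x, which is exactly harmonicity at [x]. *)
- move=> x bx; pose j := `|x - b|.-1%N.
  have -> : h (x + 1) = fine (t j.+2) by rewrite /h; congr (fine (t _)); rewrite /j; lia.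
  have -> : h (x - 1) = fine (t j) by rewrite /h; congr (fine (t _)); rewrite /j; lia.
  have -> : h x = fine (t j.+1) by rewrite /h; congr (fine (t _)); rewrite /j; lia.
  rewrite (hS j) (hS j.+1) odds_prodS.
  have -> : b + j.+1%:Z = x by rewrite /j; lia.
  have /andP[x0 x1] := omega01 x.
  rewrite -subr_ge0 le_eqVlt; apply/orP; left; rewrite eq_sym; apply/eqP.
  by rewrite /odds; field; rewrite gt_eqF.
- by lia.
Qed.

End Potential.

(** * The space of environments *)

(** Finite-dimensional rectangles: a pi-system generating the product sigma-algebra on two-sided
    sequences. *)
Definition rectangles (T : Type) (M : set (set T)) : set (set (int -> T)) :=
  [set A | exists (J : seq int) (B : int -> set T), (forall i, M (B i)) /\
    A = [set y | forall i, i \in J -> B i (y i)]].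

Notation sequence_space T := (g_sigma_algebraType (rectangles (@measurable _ T))).

Lemma measurable_nth d (T : measurableType d) (i : int) :
  measurable_fun setT (fun y : sequence_space T => y i).
Proof.
move=> _ B mB; rewrite setTI; apply: sub_sigma_algebra.
exists [:: i], (fun=> B); split => //; apply/seteqP; split => y /=.
  by move=> By j; rewrite inE => /eqP ->.
by apply; rewrite mem_head.
Qed.

Lemma rectangles_setI_closed d (T : measurableType d) :
  setI_closed (rectangles (@measurable _ T)).
Proof.
move=> _ _ [J1 [B1 [m1 ->]]] [J2 [B2 [m2 ->]]].
exists (J1 ++ J2), (fun i => (if i \in J1 then B1 i else setT) `&`
  (if i \in J2 then B2 i else setT)); split.
  by move=> i; apply: measurableI; case: ifP.
apply/seteqP; split => y /=.
  by move=> [y1 y2] i _; split; case: ifP => // /[dup] ?; [exact: y1|exact: y2].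
move=> H; split => i iJ; have := H i; rewrite mem_cat iJ ?orbT => /(_ isT)[//].
Qed.

Lemma rectanglesT d (T : measurableType d) : rectangles (@measurable _ T) setT.
Proof. by exists [::], (fun=> setT); split=> //; apply/seteqP; split. Qed.

Section SequenceLaw.
Context d (Omega : measurableType d) d' (T : measurableType d') (R : realType)
  (P : probability Omega R).

Lemma measurable_sequence (Y : Omega -> sequence_space T) :
  (forall i, measurable_fun setT (fun w => Y w i)) -> measurable_fun setT Y.
Proof.
move=> mY; apply: (@measurability _ _ _ _ _ Y (rectangles (@measurable _ T))) => //.
move=> _ [_ [J [B [mB ->]]] <-]; rewrite setTI.
rewrite (_ : _ @^-1` _ = \bigcap_(i in [set` J]) ((fun w => Y w i) @^-1` B i)).
  by apply: fin_bigcap_measurable => // i _; rewrite -[X in measurable X]setTI; exact: mY.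
by apply/seteqP; split.
Qed.

Lemma sequence_law_unique (Y Z : Omega -> sequence_space T)
    (mY : measurable_fun setT Y) (mZ : measurable_fun setT Z) :
  (forall (J : seq int) (B : int -> set T), uniq J -> (forall i, measurable (B i)) ->
    P (\bigcap_(i in [set` J]) ((fun w => Y w i) @^-1` B i)) =
    P (\bigcap_(i in [set` J]) ((fun w => Z w i) @^-1` B i))) ->
  forall A, measurable A -> P (Y @^-1` A) = P (Z @^-1` A).
Proof.
move=> YZ A mA.
pose m1 : {measure set (sequence_space T) -> \bar R} :=
  measure_function_pushforward__canonical__measure_function_Measure P mY.
pose m2 : {measure set (sequence_space T) -> \bar R} :=
  measure_function_pushforward__canonical__measure_function_Measure P mZ.
rewrite -[LHS]/(m1 A) -[RHS]/(m2 A).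
have H := @measure_unique _ R (sequence_space T) (rectangles (@measurable _ T)) (fun=> setT) erefl (@rectangles_setI_closed _ T) (fun=> @rectanglesT _ T).
have H2 := H _ m1 m2.
apply: H2 => //.
- by rewrite bigcup_const//; exists 0%N.
- move=> _ [J [B [mB ->]]].
  have := YZ (undup J) B (undup_uniq J) mB.
  rewrite -[X in _ -> X]/(P (Y @^-1` _) = P (Z @^-1` _)).
  rewrite (_ : [set` undup J] = [set` J]); last first.
    by apply/seteqP; split => i /=; rewrite mem_undup.
  rewrite (_ : \bigcap_(i in _) _ = Y @^-1` [set y | forall i, i \in J -> B i (y i)])//.
- move=> _; rewrite -[m1 _]/(P (Y @^-1` setT)) preimage_setT.
  by rewrite probability_setT ltry.
Qed.

Lemma integral_sequence_law (Y Z : Omega -> sequence_space T)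
    (mY : measurable_fun setT Y) (mZ : measurable_fun setT Z)
    (f : sequence_space T -> \bar R) :
  (forall A, measurable A -> P (Y @^-1` A) = P (Z @^-1` A)) ->
  measurable_fun setT f -> (forall y, 0 <= f y)%E ->
  (\int[P]_w f (Y w) = \int[P]_w f (Z w))%E.
Proof.
move=> YZ mf f0.
have := @ge0_integral_pushforward _ _ _ _ R Y mY P setT f measurableT mf (fun y _ => f0 y).
have := @ge0_integral_pushforward _ _ _ _ R Z mZ P setT f measurableT mf (fun y _ => f0 y).
rewrite !preimage_setT => eZ eY; rewrite -[LHS]eY -[RHS]eZ.
apply: eq_measure_integral => A mA _; exact: YZ.
Qed.

End SequenceLaw.

Section IID.
Context d (Omega : measurableType d) d' (T : measurableType d') (R : realType)
  (P : probability Omega R) (Y0 : Omega -> T) (Y : int -> Omega -> T).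
Hypothesis mY : forall i, measurable_fun setT (Y i).
Hypothesis iidY : iid_copies P Y0 Y.

Definition sequence_of (w : Omega) : sequence_space T := fun i => Y i w.
Definition shift_seq (k : int) (y : sequence_space T) : sequence_space T :=
  fun i => y (k + i).

Lemma measurable_sequence_of : measurable_fun setT sequence_of.
Proof. by apply: measurable_sequence => i; exact: mY. Qed.

Lemma measurable_shift_seq k : measurable_fun setT (shift_seq k).
Proof. by apply: measurable_sequence => i; exact: measurable_nth. Qed.

(** Stationarity of an i.i.d. family: on a rectangle, independence turns both laws into the same
    product of marginals, and rectangles determine the law. *)
Lemma integral_shift k (f : sequence_space T -> \bar R) :
  measurable_fun setT f -> (forall y, 0 <= f y)%E ->
  (\int[P]_w f (shift_seq k (sequence_of w)) = \int[P]_w f (sequence_of w))%E.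
Proof.
move=> mf f0.
have mS := measurable_sequence_of.
have mkS : measurable_fun setT (shift_seq k \o sequence_of).
  by apply: measurableT_comp => //; exact: measurable_shift_seq.
apply: (@integral_sequence_law _ _ _ _ _ _ _ _ mkS mS) => //.
apply: sequence_law_unique => // J B uJ mB.
have [sY indY] := iidY.
rewrite [RHS](indY J B uJ mB).
have uJ' : uniq [seq k + i | i <- J] by rewrite map_inj_uniq//; exact: addrI.
have := indY _ (fun j => B (j - k)) uJ' (fun j => mB (j - k)).
rewrite big_map => e; transitivity (\prod_(j <- J) P (Y (k + j)%R @^-1` B (k + j - k)%R))%E.
  rewrite -e; congr (P _); apply/seteqP; split => w /= H i.
    by move=> /mapP[j jJ ->]; rewrite /= [k + j]addrC addrK addrC; exact: H.
  move=> iJ; have /= := H (k + i) (map_f _ iJ).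
  by rewrite [X in B X]addrC addKr.
apply: eq_bigr => i _; rewrite [k + i - k]addrC addKr.
by rewrite !sY.
Qed.

End IID.

Section EnvironmentSpace.
Context (R : realType).
Implicit Types y : sequence_space (nat * R)%type.

Definition gaps y (i : int) : nat := (y i).1.
Definition env y : int -> R := environment (gaps y) (fun i => (y i).2).

Definition good : set (sequence_space (nat * R)%type) :=
  [set y | forall i, (0 < (y i).1)%N /\ 0 < (y i).2 < 1].

Lemma good_gaps y : good y -> forall i, (0 < gaps y i)%N.
Proof. by move=> gy i; case: (gy i). Qed.

Lemma good_shift k y : good y -> good (shift_seq k y).
Proof. by move=> gy i; exact: gy. Qed.

Lemma env01 y : good y -> forall n, 0 < env y n < 1.
Proof.
move=> gy; apply: environment01; first exact: good_gaps.
by move=> i; case: (gy i).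
Qed.

Lemma env_shift k y : good y ->
  env (shift_seq k y) = fun n => env y (S_ (gaps y) k + n).
Proof.
move=> gy; apply/funext => n.
exact: (environment_shift (fun i => (y i).2) k n (good_gaps gy)).
Qed.

Lemma gaps_shift k y : gaps (shift_seq k y) = fun i => gaps y (k + i).
Proof. by []. Qed.

Lemma measurable_good : measurable good.
Proof.
rewrite (_ : good = \bigcap_n (if (unpickle n : option int) is Some i then
    (fun y => y i) @^-1` ([set a | (0 < a)%N] `*` `]0, 1[) else setT)).
  apply: bigcapT_measurable => n; case: unpickle => [i|]; last exact: measurableT.
  rewrite -[X in measurable X]setTI; apply: measurable_nth => //.
  by apply: measurableX => //; exact: measurable_itv.
apply/seteqP; split => y gy.
  move=> n _; case: unpickle => [i|//]; split => /=; first by case: (gy i).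
  by rewrite in_itv /=; case: (gy i).
move=> i; have := gy (pickle i) I; rewrite pickleK => -[/=].
by rewrite in_itv.
Qed.

Lemma measurable_gaps i (A : set nat) : measurable [set y | A (gaps y i)].
Proof.
rewrite (_ : [set y | _] = (fun y => y i) @^-1` (A `*` setT)); last first.
  by apply/seteqP; split => y //= -[].
by rewrite -[X in measurable X]setTI; apply: measurable_nth => //; exact: measurableX.
Qed.

Lemma measurable_S k (n : int) : measurable [set y | S_ (gaps y) k = n].
Proof.
elim/int_ind: k n => [|k IH|k IH] n.
- have [->|n0] := eqVneq n 0.
    by rewrite (_ : [set y | _] = setT)//; apply/seteqP; split => // y _; exact: S_0.
  rewrite (_ : [set y | _] = set0)//; apply/seteqP; split => // y.
  by move=> /(etrans (esym (S_0 _))) e; move: n0; rewrite -e eqxx.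
- rewrite (_ : [set y | _] = \bigcup_a ([set y | S_ (gaps y) k%:Z = n - a%:Z] `&`
      [set y | [set a] (gaps y (k%:Z + 1))])).
    by apply: bigcupT_measurable => a; apply: measurableI => //; exact: measurable_gaps.
  have -> : k.+1%:Z = k%:Z + 1 by lia.
  have E y : S_ (gaps y) (k%:Z + 1) = _ := S_succ (gaps y) _.
  apply/seteqP; split => [y e|y [a _ [e1 e2]]].
    have {}e : S_ (gaps y) (k%:Z + 1) = n := e.
    exists (gaps y (k%:Z + 1)) => //; split; last by [].
    by rewrite /mkset -e [in RHS]E addrK.
  by rewrite /mkset E (e1 : S_ _ _ = _) (e2 : _ = _) subrK.
- rewrite (_ : [set y | _] = \bigcup_a ([set y | S_ (gaps y) (- k%:Z) = n + a%:Z] `&`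
      [set y | [set a] (gaps y (- k%:Z))])).
    by apply: bigcupT_measurable => a; apply: measurableI => //; exact: measurable_gaps.
  have -> : - k.+1%:Z = - k%:Z - 1 by lia.
  have E y : S_ (gaps y) (- k%:Z - 1) = _ := S_pred (gaps y) _.
  apply/seteqP; split => [y e|y [a _ [e1 e2]]].
    have {}e : S_ (gaps y) (- k%:Z - 1) = n := e.
    exists (gaps y (- k%:Z)) => //; split; last by [].
    by rewrite /mkset -e [in RHS]E subrK.
  by rewrite /mkset E (e1 : S_ _ _ = _) (e2 : _ = _) addrK.
Qed.

(** Among good sequences either some unique [k] has [S_k = n] and the value is the parameter with
    index [k + 1], or [n] is unmarked and the value is 1/2. This writes the preimage with countably
    many measurable events. *)
Lemma measurable_env n : measurable_fun good (fun y => env y n).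
Proof.
move=> _ B mB.
pose E k := [set y | S_ (gaps y) k = n].
pose F (j : nat) : set (sequence_space (nat * R)%type) :=
  if (unpickle j : option int) is Some k then
    E k `&` (fun y => y (k + 1)) @^-1` (setT `*` B) else set0.
pose G (j : nat) : set (sequence_space (nat * R)%type) :=
  if (unpickle j : option int) is Some k then ~` E k else setT.
rewrite (_ : _ `&` _ = good `&` ((\bigcup_j F j) `|`
   ((\bigcap_j G j) `&` [set y | B 2^-1]))); last first.
  apply/seteqP; split => y [gy].
    move=> /= By; split => //; have [[k Sk]|nS] := pselect (exists k, S_ (gaps y) k = n).
      left; exists (pickle k) => //; rewrite /F pickleK; split => //; split => //=.
      by rewrite -(environment_S (fun i => (y i).2) (good_gaps gy)) Sk.
    have nS1 k : S_ (gaps y) k <> n by move=> e; apply: nS; exists k.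
    right; split; last by rewrite /= -(environment_notS (fun i => (y i).2) nS1).
    by move=> j _; rewrite /G; case: unpickle => // k; exact: nS1.
  move=> [[j _ Fj]|[yG /= B2]]; split => //=.
    move: Fj; rewrite /F; case: unpickle => // k [Sk [_ /=]].
    by rewrite -(environment_S (fun i => (y i).2) (good_gaps gy)) Sk.
  rewrite /env environment_notS// => k e.
  by have := yG (pickle k) I; rewrite /G pickleK.
apply: measurableI; first exact: measurable_good.
apply: measurableU.
  apply: bigcupT_measurable => j; rewrite /F; case: unpickle => // k.
  apply: measurableI; first exact: measurable_S.
  by rewrite -[X in measurable X]setTI; apply: measurable_nth => //; exact: measurableX.
apply: measurableI.
  apply: bigcapT_measurable => j; rewrite /G; case: unpickle => // k.
  by apply: measurableC; exact: measurable_S.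
have [B2|nB2] := pselect (B 2^-1).
  by rewrite (_ : [set y | _] = setT)//; apply/seteqP; split.
by rewrite (_ : [set y | _] = set0)//; apply/seteqP; split.
Qed.

End EnvironmentSpace.

(** * Annealed probabilities *)

Lemma nneseries_single_le (R : realType) (f : nat -> \bar R) (a : \bar R) :
  (forall k, 0 <= f k)%E -> (forall k, f k <= a)%E -> (0 <= a)%E ->
  (forall k l, f k != 0%E -> f l != 0%E -> k = l) ->
  (\sum_(k <oo) f k <= a)%E.
Proof.
move=> f0 fa a0 fkl.
have [[k fk]|nf] := pselect (exists k, f k != 0%E).
  rewrite (@nneseriesD1 _ _ k xpredT)// eseries0 ?adde0// => l _ /andP[_ lk].
  by apply/eqP; apply: contraNT lk => fl; rewrite (fkl _ _ fl fk).
rewrite eseries0// => l _ _; apply: contrapT => fl; apply: nf.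
by exists l; apply/eqP.
Qed.

Lemma nneseries_term_le (R : realType) (f : nat -> \bar R) k :
  (forall k, 0 <= f k)%E -> (f k <= \sum_(k <oo) f k)%E.
Proof.
move=> f0; rewrite (@nneseriesD1 _ _ k xpredT)// leeDl//.
exact: nneseries_ge0.
Qed.

Section Annealed.
Context (R : realType) d (Omega : measurableType d) (P : probability Omega R)
  (Y0 : Omega -> (nat * R)%type) (Y : int -> Omega -> (nat * R)%type)
  (Pq : (int -> R) -> probability path_space R) (PP : probability path_space R).
Hypothesis mY : forall i, measurable_fun setT (Y i).
Hypothesis mY0 : measurable_fun setT Y0.
Hypothesis iidY : iid_copies P Y0 Y.
Hypothesis range0 : {ae P, forall w, (0 < (Y0 w).1)%N /\ 0 < (Y0 w).2 < 1}.
Hypothesis quenched : forall omega : int -> R, (forall n, 0 < omega n < 1) ->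
                quenched_law omega (Pq omega).
Hypothesis annealed : annealed_law P (fun w => env (sequence_of Y w)) Pq PP.

Let seqw := sequence_of Y.

Lemma ae_good : {ae P, forall w, good (seqw w)}.
Proof.
pose G : set (nat * R)%type := [set a | (0 < a)%N] `*` `]0, 1[.
have mG : measurable G by apply: measurableX => //; exact: measurable_itv.
have GE a : G a <-> (0 < a.1)%N /\ 0 < a.2 < 1 by rewrite /G/= in_itv /=.
have g i : {ae P, forall w, G (Y i w)}.
  have G0 : P (Y0 @^-1` (~` G)) = 0%E.
    have [N [mN N0 GN]] := range0.
    have mYG : measurable (Y0 @^-1` (~` G)).
      by rewrite -[X in measurable X]setTI; apply: mY0 => //; exact: measurableC.
    apply/eqP; rewrite eq_le measure_ge0 andbT -N0; apply: le_measure; rewrite ?inE//.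
  exists (Y i @^-1` (~` G)); split => //.
    by rewrite -[X in measurable X]setTI; apply: mY => //; exact: measurableC.
  by rewrite (iidY.1 i _ (measurableC mG)).
have : {ae P, forall w, forall n : nat, if (unpickle n : option int) is Some i
    then G (Y i w) else True}.
  apply: ae_foralln => n; case: unpickle => [i|]; first exact: g.
  by apply: aeW.
apply: filterS => w H i; apply/GE.
by have := H (pickle i); rewrite pickleK.
Qed.

Lemma quenched_cylinder omega n x : (forall n, 0 < omega n < 1) ->
  Pq omega (path_cylinder n x) =
    (if x 0%N == 0 then \prod_(i < n) jump omega (x i) (x i.+1) else 0)%:E.
Proof.
move=> omega01; have QP := quenched omega01.
elim: n => [|n IH].
  rewrite big_ord0; case: ifPn => [/eqP x0|x0].
    rewrite (_ : path_cylinder 0 x = [set X | X 0%N = 0%R]) ?QP.1//.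
    apply/seteqP; split => [X /(_ 0%N)|X /= X0 m]; first by rewrite x0; exact.
    by rewrite leqn0 => /eqP ->; rewrite x0.
  exact: (cylinder_start QP).
rewrite [LHS]QP.2 [X in (X * _)%E]IH -EFinM big_ord_recr/=.
by case: ifP => //; rewrite mul0r.
Qed.

(** On good environments the probability of a cylinder is a finite product of jump probabilities,
    measurable in the site data, and a finite-horizon event is a countable sum of cylinders. *)
Lemma measurable_quenched n A : finite_horizon n A ->
  measurable_fun (good (R:=R)) (fun y => Pq (env y) A).
Proof.
move=> An; apply: (eq_measurable_fun (fun y => \sum_(i <oo) Pq (env y) (slice n A i))%E).
  by move=> y _; rewrite (measure_slices _ An).
apply: ge0_emeasurable_sum => // i _.
have [/slice_horizon|/set0P/negP/negPn/eqP ->] := pselect (slice n A i !=set0); last first.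
  by apply: (eq_measurable_fun (cst 0%E)) => [y _|]; [rewrite measure0|exact: measurable_cst].
move=> /(_ An)[x [Ax ->]].
pose g (y : sequence_space (nat * R)%type) := if x 0%N == 0 then
  \prod_(i < n) jump (env y) (x i) (x i.+1) else 0.
apply: (eq_measurable_fun (EFin \o g)).
  by move=> y; rewrite inE => gy; rewrite quenched_cylinder//; exact: env01.
apply/measurable_EFinP; rewrite /g; case: (x 0%N == 0); last exact: measurable_cst.
apply: measurable_prod => j _; rewrite /jump.
case: (x j.+1 == x j + 1); first exact: measurable_env.
case: (x j.+1 == x j - 1); last exact: measurable_cst.
by apply: measurable_funB; [exact: measurable_cst|exact: measurable_env].
Qed.

(** Set to 0 off the almost sure set [good], so as to be measurable on the whole sequence space,
    where the shift acts. *)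
Definition qprob (A : set path_space) : sequence_space (nat * R)%type -> \bar R :=
  (fun y => Pq (env y) A) \_ (good (R:=R)).

Lemma qprob_good A y : good y -> qprob A y = Pq (env y) A.
Proof. by move=> gy; rewrite /qprob patchE mem_set. Qed.

Lemma qprob_ge0 A y : (0 <= qprob A y)%E.
Proof. by rewrite /qprob patchE; case: ifP. Qed.

Lemma measurable_qprob n A : finite_horizon n A -> measurable_fun setT (qprob A).
Proof.
move=> An; apply/(measurable_restrictT _ (@measurable_good R)).
exact: measurable_quenched An.
Qed.

Lemma annealed_le (A : set path_space) (f : sequence_space (nat * R)%type -> \bar R) :
  measurable A -> measurable_fun setT f -> (forall y, 0 <= f y)%E ->
  (forall y, good y -> Pq (env y) A <= f y)%E ->
  (PP A <= \int[P]_w f (seqw w))%E.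
Proof.
move=> mA mf f0 H; have [mPq ->] := annealed mA.
apply: ae_ge0_le_integral => //.
- by apply: (measurableT_comp mf); exact: measurable_sequence_of.
- by apply: filterS ae_good => w gw _; exact: H.
Qed.

Lemma annealed_qprob n A : finite_horizon n A -> PP A = (\int[P]_w qprob A (seqw w))%E.
Proof.
move=> An; have [mPq ->] := annealed (measurable_finite_horizon An).
apply: ae_eq_integral => //.
- by apply: (measurableT_comp (measurable_qprob An)); exact: measurable_sequence_of.
- by apply: filterS ae_good => w gw _; rewrite qprob_good.
Qed.

(** Averaging the quenched probability over the environment seen from [S_k] gives back the annealed
    probability. *)
Lemma annealed_qprob_shift k n A : finite_horizon n A ->
  PP A = (\int[P]_w qprob A (shift_seq k (seqw w)))%E.
Proof.
move=> An; rewrite (integral_shift mY iidY)//; first exact: annealed_qprob An.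
- exact: measurable_qprob An.
- exact: qprob_ge0.
Qed.

Lemma annealed_nearest_neighbour : PP nearest_neighbour = 1%E.
Proof.
have [mPq ->] := annealed measurable_nearest_neighbour.
rewrite (ae_eq_integral (cst 1%E)) ?integral_cst//.
  by rewrite mul1e; exact: probability_setT.
apply: filterS ae_good => w gw _; have e01 := env01 gw.
exact: quenched_nearest_neighbour (quenched e01) e01.
Qed.

Lemma measurable_escape_bound b m :
  measurable_fun (good (R:=R)) (fun y => escape_bound (env y) b m).
Proof.
apply: measurable_mine; first exact: measurable_cst.
have mo j : measurable_fun (good (R:=R)) (fun y => odds (env y) j).
  have mo1 : measurable_fun (good (R:=R)) (fun y => 1 - env y j).
    by apply: measurable_funB; [exact: measurable_cst|exact: measurable_env].
  apply: (eq_measurable_fun (fun y => (1 - env y j) * expR (- ln (env y j)))).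
    move=> y; rewrite inE => gy; rewrite /odds -lnV ?lnK//.
      by rewrite posrE invr_gt0; case/andP: (env01 gy j).
    by rewrite posrE; case/andP: (env01 gy j).
  apply: measurable_funM => //; apply: measurableT_comp => //.
  by apply: measurableT_comp => //; apply: measurableT_comp => //; exact: measurable_env.
apply: (eq_measurable_fun (fun y => \sum_(l <oo) (odds_prod (env y) b (l + m))%:E)%E).
  move=> y; rewrite inE => gy; rewrite (nneseries_addn (f := fun l => (odds_prod (env y) b l)%:E)) => //.
  by move=> l; rewrite lee_fin ltW// odds_prod_gt0//; exact: env01.
apply: ge0_emeasurable_sum => [l y gy _|l _].
  by rewrite lee_fin ltW// odds_prod_gt0//; exact: env01.
by apply/measurable_EFinP; apply: measurable_prod => j _; exact: mo.
Qed.

(** The gap with index 0 ends at the marked site 0, because [S_(-1)] is minus that gap. The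
    restriction therefore says that the level [- r] lies in this gap, strictly above the preceding
    marked site. *)
Definition escape_term (r m : nat) : sequence_space (nat * R)%type -> \bar R :=
  (fun y => escape_bound (env y) (- r%:Z) m) \_ (good (R:=R) `&` [set y | (r < gaps y 0)%N]).

Lemma escape_term_ge0 r m y : (0 <= escape_term r m y)%E.
Proof.
rewrite /escape_term patchE; case: ifP => //; rewrite inE => -[gy _].
by apply: escape_bound_ge0; exact: env01.
Qed.

Lemma measurable_escape_term r m : measurable_fun setT (escape_term r m).
Proof.
have mg : measurable (good (R:=R) `&` [set y | (r < gaps y 0)%N]).
  by apply: measurableI; [exact: measurable_good|exact: (@measurable_gaps R 0 [set a | (r < a)%N])].
apply/(measurable_restrictT _ mg).
apply: measurable_funS (measurable_escape_bound _ _) => //; exact: measurable_good.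
Qed.

(* Seen from the first marked site S_k >= n, the level n is -r with
   0 <= r < gap before the site; after shifting by k, the values of k that
   produce a given r satisfy S_(-k) = - n - r, hence there is at most one. *)
Lemma annealed_backtrack_le (n m k : nat) :
  (PP (backtrack n (n + m)%N k) <=
     \sum_(r <oo) \int[P]_w escape_term r m (seqw w))%E.
Proof.
pose D (r j : nat) := [set y : sequence_space (nat * R)%type |
  S_ (gaps y) (- j%:Z) = - n%:Z - r%:Z].
have mD r j : measurable (D r j) by exact: measurable_S.
pose H r j : sequence_space (nat * R)%type -> \bar R := escape_term r m \_ (D r j).
have mH r j : measurable_fun setT (H r j).
  by apply/(measurable_restrictT _ (mD r j)); apply: measurable_funTS; exact: measurable_escape_term.
have H0 r j y : (0 <= H r j y)%E.
  by rewrite /H patchE; case: ifP => // _; exact: escape_term_ge0.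
have mHs r j : measurable_fun setT (H r j \o shift_seq j).
  by apply: measurableT_comp => //; exact: measurable_shift_seq.
have mS := measurable_sequence_of mY.
apply: (@le_trans _ _ (\int[P]_w \sum_(r <oo) \sum_(j <oo) H r j (shift_seq j (seqw w)))%E).
  apply: (annealed_le (f := fun y => \sum_(r <oo) \sum_(j <oo) H r j (shift_seq j y))%E).
  - exact: (measurable_finite_horizon (@finite_horizon_backtrack n (n + m)%N k)).
  - apply: ge0_emeasurable_sum => [r y _ _|r _]; first exact: nneseries_ge0.
    by apply: ge0_emeasurable_sum => // j _; exact: mHs.
  - by move=> y; apply: nneseries_ge0 => r _ _; exact: nneseries_ge0.
  move=> y gy.
  have [j /andP[jn nj]] := S_first_ge (good_gaps gy) n.
  pose r := `|S_ (gaps y) j%:Z - n%:Z|%N.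
  have rE : r%:Z = S_ (gaps y) j%:Z - n%:Z.
    by rewrite /r; move: nj; move: (S_ _ _) => s; lia.
  have e01 := env01 gy.
  apply: le_trans (nneseries_term_le r _); last by move=> ?; exact: nneseries_ge0.
  apply: le_trans (nneseries_term_le j _); last by move=> ?.
  rewrite /H patchE mem_set; last first.
    rewrite /D /mkset gaps_shift S_shift addrN S_0 rE sub0r opprB.
    by rewrite addKr.
  rewrite /escape_term patchE mem_set; last first.
    split; first exact: good_shift.
    rewrite /mkset gaps_shift addr0.
    have := S_pred (gaps y) j%:Z.
    move: jn rE; move: (S_ _ j%:Z) (S_ _ (j%:Z - 1)) (gaps y j%:Z) => s s' g.
    by lia.
  apply: le_trans (backtrack_escape_bound e01 n%:Z m k (quenched e01)) _.
  rewrite env_shift// /escape_bound /odds_prod /odds.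
  rewrite le_eqVlt; apply/orP; left; apply/eqP; congr (Order.min _ _).
  apply: eq_eseriesr => l _; congr EFin; apply: eq_bigr => i _.
  have -> : S_ (gaps y) j%:Z + (- r%:Z + i.+1%:Z) = n%:Z + i.+1%:Z; last by [].
  by rewrite rE; move: (S_ _ _) => s; lia.
rewrite integral_nneseries//; last 2 first.
- move=> r; apply: ge0_emeasurable_sum => // j _.
  exact: (measurableT_comp (mHs r j)).
- by move=> r w _; exact: nneseries_ge0.
apply: lee_nneseries => [r _ _|r _].
  by apply: integral_ge0 => w _; exact: nneseries_ge0.
rewrite integral_nneseries//; last first.
  by move=> j; apply: (measurableT_comp (mHs r j)).
rewrite (eq_eseriesr (g := fun j => \int[P]_w H r j (seqw w))%E); last first.
  by move=> j _; exact: (integral_shift mY iidY).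
rewrite -integral_nneseries//; last by move=> j; apply: (measurableT_comp (mH r j)).
apply: ge0_le_integral => //.
- by move=> w _; exact: nneseries_ge0.
- apply: ge0_emeasurable_sum => // j _.
  exact: (measurableT_comp (mH r j)).
- by apply: measurableT_comp => //; exact: measurable_escape_term.
move=> w _; apply: nneseries_single_le => //.
- by move=> j; rewrite /H patchE; case: ifP => // _; exact: escape_term_ge0.
- exact: escape_term_ge0.
move=> j l; rewrite /H !patchE; case: ifPn => //; rewrite ?eqxx// inE => Dj.
case: ifPn; rewrite ?eqxx// inE => Dl; rewrite /escape_term patchE.
case: ifPn; rewrite ?eqxx// inE => -[gw _] _ _.
have /(S_inj (good_gaps gw)) : S_ (gaps (seqw w)) (- j%:Z) = S_ (gaps (seqw w)) (- l%:Z).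
  by rewrite [LHS]Dj [RHS]Dl.
by lia.
Qed.

End Annealed.

(** * Transience *)

Section IndependentIntegral.
Context d (Omega : measurableType d) (R : realType) (P : probability Omega R)
  d1 (T1 : measurableType d1) d2 (T2 : measurableType d2)
  (X : {RV P >-> T1}) (Z : {RV P >-> T2}).
Hypothesis XZ : forall A B, measurable A -> measurable B ->
  (P (X @^-1` A `&` Z @^-1` B) = P (X @^-1` A) * P (Z @^-1` B))%E.
Local Open Scope ereal_scope.

(** Independence identifies the joint law of [(X, Z)] with the product of the marginal laws, and
    Tonelli's theorem splits the integral. *)
Lemma integral_indepM (f : T1 -> \bar R) (g : T2 -> \bar R) :
  measurable_fun setT f -> measurable_fun setT g ->
  (forall x, 0 <= f x) -> (forall z, 0 <= g z) ->
  \int[P]_w (f (X w) * g (Z w)) = \int[P]_w f (X w) * \int[P]_w g (Z w).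
Proof.
move=> mf mg f0 g0.
pose h (p : T1 * T2) := f p.1 * g p.2.
have mh : measurable_fun setT h.
  by apply: emeasurable_funM; apply: measurableT_comp.
have mXZ : measurable_fun setT (fun w => (X w, Z w)).
  by apply: measurable_fun_pair.
pose m : {measure set (T1 * T2) -> \bar R} :=
  measure_function_pushforward__canonical__measure_function_Measure P mXZ.
have mE A : measurable A -> (distribution P X \x distribution P Z)%E A = m A.
  apply: product_measure_unique => A1 A2 mA1 mA2.
  rewrite -[LHS]/(P ((fun w => (X w, Z w)) @^-1` (A1 `*` A2))).
  by rewrite -XZ.
have := @ge0_integral_pushforward _ _ _ _ R _ mXZ P setT h measurableT mh
  (fun p _ => mule_ge0 (f0 p.1) (g0 p.2)).
rewrite preimage_setT => <-.
rewrite -[LHS]/(\int[m]_p h p).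
rewrite (eq_measure_integral (distribution P X \x distribution P Z)%E); last first.
  by move=> A mA _; exact/esym/mE.
rewrite fubini_tonelli1//; last by move=> p; exact: mule_ge0.
rewrite /fubini_F /h/=.
under eq_integral do rewrite ge0_integralZl//.
have cE : \int[distribution P Z]_z g z = \int[P]_w g (Z w).
  by rewrite ge0_integral_distribution.
rewrite cE ge0_integralZr//; last exact: integral_ge0.
by rewrite ge0_integral_distribution.
Qed.

End IndependentIntegral.

Section IndependentProduct.
Context d (Omega : measurableType d) (R : realType) (P : probability Omega R)
  d' (T : measurableType d') (Y : int -> Omega -> T).
Hypothesis mY : forall i, measurable_fun setT (Y i).
Hypothesis indY : mutually_independent P Y.
Local Open Scope ereal_scope.

Lemma indep_pair i j : i != j -> forall A B, measurable A -> measurable B ->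
  P (Y i @^-1` A `&` Y j @^-1` B) = P (Y i @^-1` A) * P (Y j @^-1` B).
Proof.
move=> ij A B mA mB.
have u : uniq [:: i; j] by rewrite /= inE ij.
have := indY u (B := fun k => if k == i then A else B).
rewrite big_cons big_seq1 eqxx eq_sym (negbTE ij) => <-; last by move=> k; case: ifP.
congr (P _); apply/seteqP; split => w /=.
  by move=> [wA wB] k /=; rewrite !inE => /orP[]/eqP ->; rewrite ?eqxx// eq_sym (negbTE ij).
move=> H; have := H i; have := H j.
by rewrite /= !inE !eqxx orbT eq_sym (negbTE ij) => /(_ isT) wB /(_ isT).
Qed.

(** Freezing the coordinates outside [J] gives one sequence-valued variable carrying exactly the
    information of [J], so that independence of one coordinate from finitely many others becomes
    independence of two variables. *)
Definition restrict_seq (J : seq int) (w : Omega) : sequence_space T :=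
  fun j => if j \in J then Y j w else point.

Lemma measurable_restrict_seq J : measurable_fun setT (restrict_seq J).
Proof.
apply: measurable_sequence => i; rewrite /restrict_seq.
by case: (i \in J); [exact: mY|exact: measurable_cst].
Qed.

Lemma indep_restrict i J : uniq (i :: J) -> forall B A, measurable B -> measurable A ->
  P (Y i @^-1` B `&` restrict_seq J @^-1` A) = P (Y i @^-1` B) * P (restrict_seq J @^-1` A).
Proof.
move=> /= /andP[iJ uJ] B A mB mA.
have mYB : measurable (Y i @^-1` B) by rewrite -[X in measurable X]setTI; exact: mY.
have mJ := measurable_restrict_seq J.
pose m1 : {measure set (sequence_space T) -> \bar R} :=
  measure_function_pushforward__canonical__measure_function_Measure (mrestr P mYB) mJ.
have p0 : (0 <= fine (P (Y i @^-1` B)))%R by exact: fine_ge0.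
pose m2 : {measure set (sequence_space T) -> \bar R} := mscale (NngNum p0)
  (measure_function_pushforward__canonical__measure_function_Measure P mJ).
have m2E C : m2 C = P (Y i @^-1` B) * P (restrict_seq J @^-1` C).
  rewrite -[LHS]/((fine (P (Y i @^-1` B)))%:E * P (restrict_seq J @^-1` C)).
  by rewrite fineK// fin_num_measure.
have m1E C : m1 C = P (Y i @^-1` B `&` restrict_seq J @^-1` C).
  by rewrite setIC.
rewrite -m1E -m2E.
have H := @measure_unique _ R (sequence_space T) (rectangles (@measurable _ T))
  (fun=> setT) erefl (@rectangles_setI_closed _ T) (fun=> @rectanglesT _ T).
apply: (H _ m1 m2) => //.
- by rewrite bigcup_const//; exists 0%N.
- move=> _ [K [C [mC ->]]]; rewrite m1E m2E.
  pose D j := if j \in K then C j else setT.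
  have mD j : measurable (D j) by rewrite /D; case: ifP.
  (* A frozen coordinate either always meets its constraint, which can then be dropped, or never
     does, and the event is empty. *)
  have [Kpt|Kpt] := pselect (forall j, j \in K -> j \notin J -> C j point); last first.
    rewrite (_ : restrict_seq J @^-1` _ = set0) ?setI0 ?measure0 ?mule0//.
    apply/seteqP; split => w //= H'; apply: Kpt => j jK jJ.
    by have := H' j jK; rewrite /restrict_seq (negbTE jJ).
  have -> : restrict_seq J @^-1` [set y | forall j, j \in K -> C j (y j)] =
      \bigcap_(j in [set` J]) (Y j @^-1` D j).
    apply/seteqP; split => w /= H' j.
      move=> jJ; rewrite /D; case: ifP => // jK.
      by have := H' j jK; rewrite /restrict_seq jJ.
    move=> jK; rewrite /restrict_seq; case: ifP => jJ; last by apply: Kpt => //; rewrite jJ.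
    by have := H' j jJ; rewrite /= /D jK.
  rewrite indY//.
  have uiJ : uniq (i :: J) by rewrite /= iJ.
  have := indY uiJ (B := fun k => if k == i then B else D k).
  rewrite big_cons eqxx [X in _ * X](eq_big_seq (fun j => P (Y j @^-1` D j))); last first.
    by move=> j jJ; case: eqP => // e; move: iJ; rewrite -e jJ.
  move=> <-; last by move=> k; case: ifP.
  congr (P _); apply/seteqP; split => w /=.
    move=> [wB H'] j /=; rewrite inE => /orP[/eqP ->|jJ]; first by rewrite eqxx.
    by case: eqP => [->//|_]; exact: H'.
  move=> H'; split; first by have := H' i; rewrite /= mem_head eqxx => /(_ isT).
  move=> j jJ; have := H' j; rewrite /= inE jJ orbT => /(_ isT).
  by case: eqP => // e; move: iJ; rewrite -e jJ.
- move=> _; rewrite m1E preimage_setT setIT.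
  by rewrite (le_lt_trans (probability_le1 _ _))// ltry.
Qed.

Lemma integral_indep_prod (J : seq int) (f : int -> T -> \bar R) : uniq J ->
  (forall i, measurable_fun setT (f i)) -> (forall i x, 0%E <= f i x) ->
  \int[P]_w (\prod_(i <- J) f i (Y i w)) = \prod_(i <- J) \int[P]_w f i (Y i w).
Proof.
elim: J => [|i J IH] uJ mf f0.
  by rewrite big_nil; under eq_integral do rewrite big_nil; rewrite integral_cst// mul1e; exact: probability_setT.
rewrite big_cons -IH//; last by case/andP: uJ.
pose g (y : sequence_space T) := \prod_(j <- J) f j (y j).
pose X : {RV P >-> T} := HB.pack (Y i) (isMeasurableFun.Build _ _ _ _ _ (mY i)).
pose Z : {RV P >-> sequence_space T} :=
  HB.pack (restrict_seq J) (isMeasurableFun.Build _ _ _ _ _ (measurable_restrict_seq J)).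
have gE w : g (restrict_seq J w) = \prod_(j <- J) f j (Y j w).
  by apply: eq_big_seq => j jJ; rewrite /restrict_seq jJ.
under eq_integral do rewrite big_cons -gE.
under [X in _ = _ * X]eq_integral do rewrite -gE.
apply: (@integral_indepM _ _ _ P _ _ _ _ X Z) => //.
- exact: indep_restrict.
- have mg K : measurable_fun setT (fun y : sequence_space T => \prod_(j <- K) f j (y j)).
    elim: K => [|k K IHK]; last first.
      apply: (eq_measurable_fun (fun y : sequence_space T => f k (y k) * \prod_(j <- K) f j (y j))).
        by move=> y _; rewrite big_cons.
      apply: emeasurable_funM => //; apply: measurableT_comp => //; exact: measurable_nth.
    apply: (eq_measurable_fun (cst 1)) => [y _|]; last exact: measurable_cst.
    by rewrite big_nil.
  exact: mg.
- by move=> y; apply: prode_ge0.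
Qed.

End IndependentProduct.

(** * Sums of odds products, grouped by the gaps between marked sites *)

Section Blocks.
Context (R : realType).
Implicit Types y : sequence_space (nat * R)%type.

Definition site_odds (a : nat * R) : R := (1 - a.2) / a.2.

(** Contribution of the levels from [S_n] to [S_(n+1) - 1] to the sum of odds products started at 0.
    The product is constant there, as unmarked sites have odds 1. The site [S_l] carries the label
    [l + 1], so the marked sites [S_1] to [S_n] contribute the labels 2 to n + 1. *)
Definition block_weight y (n : nat) : R :=
  (gaps y n.+1%:Z)%:R * \prod_(l < n) site_odds (y l.+2%:Z).

Let Sn y (k : nat) : nat := `|S_ (gaps y) k%:Z|%N.

Lemma S_nat_abs y k : S_ (gaps y) k%:Z = (Sn y k)%:Z.
Proof.
rewrite /Sn S_nat; have : (0%Z <= \sum_(k0 < k) (gaps y k0.+1)%:Z)%R by apply: sumr_ge0.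
by move: (\sum_(k0 < k) _) => s; lia.
Qed.

Lemma S_nat_succ y k : Sn y k.+1 = (Sn y k + gaps y k.+1%:Z)%N.
Proof.
have := S_succ (gaps y) k%:Z; have -> : k%:Z + 1 = k.+1%:Z by lia.
by rewrite !S_nat_abs; move: (Sn _ _) (Sn _ _) (gaps _ _) => a b c; lia.
Qed.

Lemma odds_prod_block y k t : good y -> (t < gaps y k.+1%:Z)%N ->
  odds_prod (env y) 0 (Sn y k + t) = \prod_(l < k) site_odds (y l.+2%:Z).
Proof.
move=> gy; elim: k t => [|k IHk] t.
  elim: t => [|t IHt] tg.
    by rewrite /Sn S_0/= addn0 /odds_prod !big_ord0.
  rewrite addnS odds_prodS IHt ?(ltnW tg)// big_ord0 mul1r.
  rewrite /odds /env (@environment_between _ _ _ (good_gaps gy) 0); first by field.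
  rewrite S_0 add0r (_ : 0 + 1 = 1%:Z)//.
  have := S_nat_succ y 0; rewrite S_nat_abs /Sn S_0/=.
  by move: tg; move: (gaps _ _) => g; lia.
elim: t => [|t IHt] tg.
  rewrite addn0 S_nat_succ; have := good_gaps gy k.+1%:Z.
  case E : (gaps y k.+1%:Z) => [//|g] _.
  rewrite addnS odds_prodS IHk ?E// big_ord_recr/=; congr (_ * _).
  rewrite add0r -addnS -E -S_nat_succ -S_nat_abs /odds /env.
  rewrite (environment_S _ (good_gaps gy)) (_ : k.+1%:Z + 1 = k.+2%:Z)//.
  by lia.
rewrite addnS odds_prodS IHt ?(ltnW tg)// -[RHS]mulr1; congr (_ * _).
rewrite /odds /env (@environment_between _ _ _ (good_gaps gy) k.+1%:Z); first by field.
rewrite add0r (_ : k.+1%:Z + 1 = k.+2%:Z); last by lia.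
rewrite !S_nat_abs (S_nat_succ y k.+1); move: tg; move: (gaps _ _) (Sn _ _) => g s.
by lia.
Qed.

Lemma odds_prod_sum_blocks y n : good y ->
  \sum_(0 <= j < Sn y n) odds_prod (env y) 0 j = \sum_(k < n) block_weight y k.
Proof.
move=> gy; elim: n => [|n IH]; first by rewrite /Sn S_0/= big_nil big_ord0.
rewrite big_ord_recr -IH/= S_nat_succ (big_cat_nat (n := Sn y n)) ?leq_addr//=.
congr (_ + _); rewrite -{1}[Sn y n]add0n big_addn addKn.
rewrite (eq_big_nat _ _ (F2 := fun=> \prod_(l < n) site_odds (y l.+2%:Z))); last first.
  by move=> t tg; rewrite addnC odds_prod_block.
by rewrite sumr_const_nat subn0 /block_weight mulr_natl.
Qed.

Lemma block_weight_ge0 y n : good y -> 0 <= block_weight y n.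
Proof.
move=> gy; rewrite mulr_ge0// prodr_ge0// => l _.
by rewrite divr_ge0 ?subr_ge0//; case: (gy l.+2) => _ /andP[/ltW ? /ltW].
Qed.

Lemma odds_prod_summable y : good y ->
  (\sum_(n <oo) (block_weight y n)%:E < +oo)%E ->
  (\sum_(l <oo) (odds_prod (env y) 0 l)%:E < +oo)%E.
Proof.
move=> gy; apply: le_lt_trans.
have o0 l : (0 <= (odds_prod (env y) 0 l)%:E)%E.
  by rewrite lee_fin ltW// odds_prod_gt0//; exact: env01.
apply: lime_le; first by apply: is_cvg_nneseries => l _ _; exact: o0.
apply: nearW => n.
(* Gaps are at least 1, so the first [n] terms are among those of the first [n] blocks. *)
have nS : (n <= Sn y n)%N.
  have := S_addn_ge (good_gaps gy) 0 n; rewrite S_0 !add0r S_nat_abs.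
  by move: (Sn _ _) => s; lia.
apply: (@le_trans _ _ (\sum_(0 <= l < Sn y n) (odds_prod (env y) 0 l)%:E)%E).
  rewrite (big_cat_nat (n := n) (p := Sn y n))//= leeDl//.
  by apply: sume_ge0 => l _; exact: o0.
rewrite sumEFin odds_prod_sum_blocks// -sumEFin.
rewrite -(big_mkord xpredT (fun k => (block_weight y k)%:E)).
by apply: nneseries_lim_ge => k _ _; rewrite lee_fin block_weight_ge0.
Qed.

(** Starting at [- r] instead of 0 adds [r] finite terms and multiplies the remaining series by a
    constant, so the series still converges and its tails vanish. *)
Lemma escape_bound_cvg0 y r : good y ->
  (\sum_(n <oo) (block_weight y n)%:E < +oo)%E ->
  escape_bound (env y) (- r%:Z) m @[m --> \oo] --> 0%E.
Proof.
move=> gy /(odds_prod_summable gy) fin0.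
have e01 := env01 gy.
have o0 b l : (0 <= (odds_prod (env y) b l)%:E)%E by rewrite lee_fin ltW// odds_prod_gt0.
have finr : (\sum_(l <oo) (odds_prod (env y) (- r%:Z) l)%:E < +oo)%E.
  rewrite (@nneseries_split _ _ 0 r)//= add0n sumEFin lte_add_pinfty ?ltry//.
  rewrite -nneseries_addn//.
  rewrite (eq_eseriesr (g := fun l => ((odds_prod (env y) (- r%:Z) r)%:E *
      (odds_prod (env y) 0 l)%:E)%E)); last first.
    by move=> l _; rewrite -EFinM addnC odds_prodD addNr.
  rewrite nneseriesZl//.
  by rewrite lte_mul_pinfty// ?lee_fin ?ltW// odds_prod_gt0.
have := nneseries_tail_cvg finr (fun l _ => o0 _ l).
move=> t0; apply: (squeeze_cvge _ (@cvg_cst _ 0%E _ _ _) t0).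
by apply: nearW => m; rewrite escape_bound_ge0//= ge_min lexx orbT.
Qed.

(** A convergent series of powers has bounded terms, and for an exponent [beta] at most 1 this gives
    t <= C t^beta, where C is the bound raised to (1 - beta)/beta. *)
Lemma summable_of_powR (t : nat -> R) (beta : R) : 0 < beta <= 1 ->
  (forall n, 0 <= t n) -> (\sum_(n <oo) (t n `^ beta)%:E < +oo)%E ->
  (\sum_(n <oo) (t n)%:E < +oo)%E.
Proof.
move=> /andP[b0 b1] t0 fin.
have p0 n : (0 <= (t n `^ beta)%:E)%E by rewrite lee_fin powR_ge0.
set s := (\sum_(n <oo) _)%E in fin.
have s0 : (0 <= s)%E by apply: nneseries_ge0.
have sfin : s \is a fin_num by rewrite ge0_fin_numE.
have tns n : t n `^ beta <= fine s.
  by rewrite -lee_fin fineK//; apply: nneseries_term_le.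
pose C := fine s `^ ((1 - beta) / beta).
apply: (@le_lt_trans _ _ (\sum_(n <oo) C%:E * (t n `^ beta)%:E)%E).
  apply: lee_nneseries => [n _ _|n _]; first by rewrite lee_fin.
  rewrite -EFinM lee_fin.
  have [->|tn0] := eqVneq (t n) 0; first by rewrite mulr_ge0// powR_ge0.
  have E : t n = (t n `^ beta) `^ ((1 - beta) / beta) * t n `^ beta.
    rewrite -powRrM -powRD; last by rewrite tn0 implybT.
    by rewrite mulrCA divff ?gt_eqF// mulr1 subrK powRr1.
  rewrite [leLHS]E ler_wpM2r ?powR_ge0// ge0_ler_powR// ?nnegrE ?powR_ge0//.
  - by rewrite divr_ge0 ?subr_ge0// ltW.
  - exact: fine_ge0.
rewrite nneseriesZl// -/s lte_mul_pinfty ?lee_fin ?powR_ge0//.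
Qed.

End Blocks.

Lemma integral_same_law d (Omega : measurableType d) (R : realType)
    (P : probability Omega R) d' (T : measurableType d') (X Z : Omega -> T)
    (f : T -> \bar R) : measurable_fun setT X -> measurable_fun setT Z ->
  same_law P X Z -> measurable_fun setT f -> (forall x, 0 <= f x)%E ->
  (\int[P]_w f (X w) = \int[P]_w f (Z w))%E.
Proof.
move=> mX mZ XZ mf f0.
have := @ge0_integral_pushforward _ _ _ _ R X mX P setT f measurableT mf (fun y _ => f0 y).
have := @ge0_integral_pushforward _ _ _ _ R Z mZ P setT f measurableT mf (fun y _ => f0 y).
rewrite !preimage_setT => eZ eX; rewrite -[LHS]eX -[RHS]eZ.
by apply: eq_measure_integral => A mA _; exact: XZ.
Qed.

Lemma powR_prod (R : realType) n (f : nat -> R) (b : R) : (forall i, 0 <= f i) ->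
  (\prod_(i < n) f i) `^ b = \prod_(i < n) (f i `^ b).
Proof.
move=> f0; elim: n => [|n IH]; first by rewrite !big_ord0 powR1.
by rewrite !big_ord_recr/= powRM ?IH// prodr_ge0.
Qed.

Lemma nneseries_geometric_lty (R : realType) (k q : \bar R) :
  (0 <= k -> k < +oo -> 0 <= q -> q < 1 -> \sum_(p <oo) (k * q ^+ p) < +oo)%E.
Proof.
move: k q => [k| |] [q| |]//.
rewrite !lee_fin lte_fin => k0 _ q0 q1.
have E p : (k%:E * q%:E ^+ p = (k * q ^+ p)%:E)%E by rewrite EFinM EFin_expe.
apply: (@le_lt_trans _ _ (k * (1 - q)^-1)%:E); last exact: ltry.
apply: lime_le.
  by apply: is_cvg_nneseries => p _ _; rewrite E lee_fin mulr_ge0// exprn_ge0.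
apply: nearW => n; under eq_bigr do rewrite E.
rewrite sumEFin lee_fin -mulr_sumr ler_wpM2l//.
have := subrX1 q n; rewrite -(big_mkord xpredT (fun i => q ^+ i)).
set s := \sum_(_ <= _ < _) _ => sE.
rewrite -[leRHS]mul1r ler_pdivlMr ?subr_gt0//.
have -> : s * (1 - q) = 1 - q ^+ n by rewrite mulrC -opprB mulNr -sE opprB.
by rewrite gerBl exprn_ge0.
Qed.

Lemma measurable_inv (R : realType) : measurable_fun setT (@GRing.inv R).
Proof.
rewrite -(setUv [set 0 : R]); apply/measurable_funU => //.
  exact: measurableC.
split; first exact: measurable_fun_set1.
apply: open_continuous_measurable_fun.
  apply: closed_openC; exact: closed_eq.
by move=> x; rewrite inE /= => /eqP x0; exact: inv_continuous.
Qed.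

Lemma measurable_site_odds (R : realType) : measurable_fun setT (@site_odds R).
Proof.
have m2 : measurable_fun setT (fun a : nat * R => a.2) by exact: measurable_snd.
apply: measurable_funM; first by apply: measurable_funB.
exact: (measurableT_comp (@measurable_inv R)).
Qed.

Section Transience.
Context (R : realType) d (Omega : measurableType d) (P : probability Omega R)
  (Y0 : Omega -> (nat * R)%type) (Y : int -> Omega -> (nat * R)%type)
  (Pq : (int -> R) -> probability path_space R) (PP : probability path_space R)
  (beta : R).
Hypothesis mY : forall i, measurable_fun setT (Y i).
Hypothesis mY0 : measurable_fun setT Y0.
Hypothesis iidY : iid_copies P Y0 Y.
Hypothesis range0 : {ae P, forall w, (0 < (Y0 w).1)%N /\ 0 < (Y0 w).2 < 1}.
Hypothesis quenched : forall omega : int -> R, (forall n, 0 < omega n < 1) ->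
                quenched_law omega (Pq omega).
Hypothesis annealed : annealed_law P (fun w => env (sequence_of Y w)) Pq PP.
Hypothesis beta01 : 0 < beta <= 1.
Let seqw := sequence_of Y.
Let f1 (a : nat * R) : \bar R := (site_odds a `^ beta)%:E.
Let f2 (a : nat * R) : \bar R := ((site_odds a * a.1%:R) `^ beta)%:E.
Hypothesis f1_lt1 : (\int[P]_w f1 (Y0 w) < 1)%E.
Hypothesis f2_lty : (\int[P]_w f2 (Y0 w) < +oo)%E.
Hypothesis gap_lty : (\int[P]_w ((Y0 w).1%:R%:E) < +oo)%E.

Let mf1 : measurable_fun setT f1.
Proof.
apply/measurable_EFinP; apply: (measurableT_comp (measurable_powR _)) => //.
exact: measurable_site_odds.
Qed.

Let mnat : measurable_fun setT (fun a : nat * R => a.1%:R : R).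
Proof. by apply: measurableT_comp => //; exact: measurable_fst. Qed.

Let mf2 : measurable_fun setT f2.
Proof.
apply/measurable_EFinP; apply: (measurableT_comp (measurable_powR _)) => //.
by apply: measurable_funM => //; exact: measurable_site_odds.
Qed.

(** The weight of block [p + 1] contains the gap and the odds of the same label [p + 2], which may
    be dependent. They are kept together as one factor rho xi; the labels 2 to p + 1 contribute
    independent factors rho. *)
Let f (p : nat) (i : int) := if i == p.+2%:Z then f2 else f1.
Let J (p : nat) : seq int := p.+2%:Z :: [seq l.+2%:Z | l <- iota 0 p].

Lemma powR_block_weight y p : good y ->
  ((block_weight y p.+1 `^ beta)%:E = \prod_(i <- J p) f p i (y i))%E.
Proof.
move=> gy; have o0 i : 0 <= site_odds (y i).
  by rewrite divr_ge0 ?subr_ge0//; case: (gy i) => _ /andP[/ltW ? /ltW].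
have -> : block_weight y p.+1 = (site_odds (y p.+2%:Z) * (gaps y p.+2%:Z)%:R) *
    \prod_(l < p) site_odds (y l.+2%:Z).
  by rewrite /block_weight big_ord_recr/=; ring.
rewrite powRM; [|exact: mulr_ge0|exact: prodr_ge0].
rewrite (powR_prod p beta (f := fun l => site_odds (y l.+2%:Z)))// /J big_cons /f eqxx EFinM [X in (f2 _ * X)%E]big_map.
congr (_ * _)%E.
rewrite -(big_mkord xpredT (fun l => site_odds (y l.+2%:Z) `^ beta)) /index_iota subn0.
rewrite -prodEFin; apply: eq_big_seq => l; rewrite mem_iota => lp.
by rewrite ifN//; apply/eqP; lia.
Qed.

Lemma integral_block p : (\int[P]_w \prod_(i <- J p) f p i (Y i w) =
  \int[P]_w f2 (Y0 w) * (\int[P]_w f1 (Y0 w)) ^+ p)%E.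
Proof.
have uJ : uniq (J p).
  rewrite /J /= map_inj_uniq ?iota_uniq ?andbT//; last by move=> i j []; lia.
  by apply/mapP => -[l]; rewrite mem_iota => lp; lia.
have mfp i : measurable_fun setT (f p i) by rewrite /f; case: ifP.
have fp0 i x : (0 <= f p i x)%E by rewrite /f; case: ifP => _; rewrite lee_fin powR_ge0.
rewrite (integral_indep_prod mY iidY.2 uJ mfp fp0).
rewrite /J big_cons big_map; congr (_ * _)%E.
  rewrite (integral_same_law (mY _) mY0 (iidY.1 _) (mfp _))//.
  by rewrite /f eqxx.
rewrite (eq_big_seq (fun=> \int[P]_w f1 (Y0 w))%E); last first.
  move=> l; rewrite mem_iota => lp.
  rewrite (integral_same_law (mY _) mY0 (iidY.1 _) (mfp _))//.
  by rewrite /f ifN//; apply/eqP; lia.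
by rewrite big_const_seq count_predT size_iota -Monoid.iteropE.
Qed.

(** The expected powers of the block weights decay geometrically, with ratio the moment [f1_lt1].
    Hence the series of powers is almost surely finite, and so is the series of weights. *)
Lemma ae_block_summable :
  {ae P, forall w, (\sum_(n <oo) (block_weight (seqw w) n)%:E < +oo)%E}.
Proof.
pose g p (w : Omega) := (\prod_(i <- J p) f p i (Y i w))%E.
have mg p : measurable_fun setT (g p).
  have mK K : measurable_fun setT (fun w => \prod_(i <- K) f p i (Y i w))%E.
    elim: K => [|k K IHK].
      apply: (eq_measurable_fun (cst 1%E)) => [w _|]; last exact: measurable_cst.
      by rewrite big_nil.
    apply: (eq_measurable_fun (fun w => f p k (Y k w) * \prod_(j <- K) f p j (Y j w))%E).
      by move=> w _; rewrite big_cons.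
    apply: emeasurable_funM => //; apply: measurableT_comp => //.
    by rewrite /f; case: ifP.
  exact: mK.
have g0 p w : (0 <= g p w)%E.
  by apply: prode_ge0 => i _; rewrite /f; case: ifP => _; rewrite lee_fin powR_ge0.
have mG : measurable_fun setT (fun w => \sum_(p <oo) g p w)%E.
  by apply: ge0_emeasurable_sum.
have intG : (\int[P]_w (\sum_(p <oo) g p w) < +oo)%E.
  rewrite integral_nneseries//.
  under eq_eseriesr do rewrite /g integral_block.
  apply: nneseries_geometric_lty => //.
  - by apply: integral_ge0 => w _; rewrite lee_fin powR_ge0.
  - by apply: integral_ge0 => w _; rewrite lee_fin powR_ge0.
have iG : P.-integrable setT (fun w => \sum_(p <oo) g p w)%E.
  apply/integrableP; split => //.
  under eq_integral do rewrite gee0_abs ?nneseries_ge0//.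
  exact: intG.
have Gfin := integrable_ae measurableT iG.
have gd := ae_good mY mY0 iidY range0.
apply: filterS2 gd Gfin => w gw /(_ I) Gw.
have B0 n := block_weight_ge0 n gw.
(* Block 0 is a gap with no odds factor and does not fit the product formula, so it is split off. *)
rewrite (@nneseries_split _ _ 0 1)//; last by move=> n _; rewrite lee_fin; exact: B0.
rewrite add0n sumEFin lte_add_pinfty ?ltry// -nneseries_addn; last first.
  by move=> n; rewrite lee_fin; exact: B0.
apply: (summable_of_powR (t := fun n => block_weight (seqw w) (n + 1)) beta01) => //.
under eq_eseriesr do rewrite addn1 (powR_block_weight _ gw).
by move: Gw; rewrite fin_numElt => /andP[].
Qed.

(** The bound of [annealed_backtrack_le] depends neither on [n] nor on [k]. Exchanging sum and
    integral makes it the mean of a sum of terms at most 1 over the positions in one gap. That sum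
    is dominated by the gap length and tends to 0 almost surely, so dominated convergence
    applies. *)
Lemma backtrack_vanish (eps : R) : 0 < eps ->
  exists m : nat, forall n k : nat, (PP (backtrack n (n + m)%N k) <= eps%:E)%E.
Proof.
move=> eps0.
pose F m w := (\sum_(r <oo) escape_term r m (seqw w))%E.
have mesc r m : measurable_fun setT (fun w => escape_term r m (seqw w)).
  by apply: (measurableT_comp (measurable_escape_term r m)); exact: measurable_sequence_of.
have esc0 r m w : (0 <= escape_term r m (seqw w))%E by exact: escape_term_ge0.
have mF m : measurable_fun setT (F m) by apply: ge0_emeasurable_sum.
have gd := ae_good mY mY0 iidY range0.
pose G w : \bar R := ((gaps (seqw w) 0)%:R)%:E.
have FE m w : F m w = (\sum_(r < gaps (seqw w) 0) escape_term r m (seqw w))%E.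
  rewrite /F (@nneseries_split _ _ 0 (gaps (seqw w) 0))// add0n big_mkord.
  rewrite [X in (_ + X)%E]eseries0 ?adde0// => r gr _.
  rewrite /escape_term patchE ifN//; apply/negP; rewrite inE => -[_ /=].
  by rewrite ltnNge gr.
have cF : {ae P, forall w, setT w -> F m w @[m --> \oo] --> 0%E}.
  apply: filterS2 gd ae_block_summable => w gw bw _.
  rewrite (_ : F^~ w = fun m => \sum_(r < gaps (seqw w) 0) escape_term r m (seqw w))%E; last first.
    by apply/funext => m; exact: FE.
  rewrite [X in _ --> X](_ : 0%E = \sum_(r < gaps (seqw w) 0) 0%E)%E; last by rewrite big1.
  apply: cvg_nnesum => [r _|r _]; first by near=> m; exact: esc0.
  rewrite (_ : (fun m => _) = (fun m => escape_bound (env (seqw w)) (- r%:Z) m)).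
    exact: escape_bound_cvg0.
  apply/funext => m; rewrite /escape_term patchE mem_set//.
  by split => //=; exact: ltn_ord.
have iG : P.-integrable setT G.
  apply/integrableP; split.
    apply/measurable_EFinP; apply: measurableT_comp => //.
    by apply: (measurableT_comp (@measurable_fst _ _ _ _)); exact: mY.
  under eq_integral do rewrite gee0_abs ?lee_fin//.
  rewrite (integral_same_law (f := fun a => (a.1%:R)%:E) (mY 0) mY0 (iidY.1 0))//.
    exact/measurable_EFinP.
have FG : {ae P, forall w, forall m, setT w -> (`|F m w| <= G w)%E}.
  apply: aeW => w m _; rewrite gee0_abs ?nneseries_ge0// FE.
  apply: (@le_trans _ _ (\sum_(r < gaps (seqw w) 0) 1%E)%E).
    apply: lee_sum => r _; rewrite /escape_term patchE; case: ifP => // _.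
    exact: escape_bound_le1.
  by rewrite /G sumEFin lee_fin sumr_const card_ord.
have [_ _ /= c] := dominated_convergence measurableT mF (measurable_cst 0%E) cF iG FG.
rewrite integral0 in c.
have : \forall m \near \oo, (\int[P]_w F m w <= eps%:E)%E.
  have e0 : (0 < eps%:E)%E by rewrite lte_fin.
  have H : \forall m \near \oo, (\int[P]_w F m w < eps%:E)%E := c _ (open_ereal_lt' e0).
  by apply: filterS H => m /ltW.
move=> [m _ /(_ m (leqnn m)) Hm]; exists m => n k.
apply: le_trans Hm.
rewrite integral_nneseries//.
exact: (annealed_backtrack_le mY mY0 iidY range0 quenched annealed).
Unshelve. all: by end_near. Qed.

End Transience.

(** * Moments of the environment *)

Lemma ler_1Dsqr (F : realFieldType) (v : F) : v <= 1 + v ^+ 2.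
Proof. by have := sqr_ge0 (v - 2^-1); nra. Qed.

Lemma powR_exprn (R : realType) (x a : R) n : 0 <= x -> (x `^ a) ^+ n = (x ^+ n) `^ a.
Proof.
move=> x0; rewrite -powR_mulrn ?powR_ge0// -powRrM mulrC powRrM.
by rewrite powR_mulrn.
Qed.

Section Moments.
Context (R : realType) d (Omega : measurableType d) (P : probability Omega R)
  (xi : {RV P >-> nat}) (lam : {RV P >-> R}).
Hypothesis range : {ae P, forall w, (0 < xi w)%N /\ 0 < lam w < 1}.

Let rho (w : Omega) : R := (1 - lam w) / lam w.
Let xiR (w : Omega) : R := (xi w)%:R.

Lemma expectationE (X : Omega -> R) : ('E_P[X] = \int[P]_w (X w)%:E)%E.
Proof. by rewrite unlock. Qed.

Lemma measurable_rho : measurable_fun setT rho.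
Proof.
apply: measurable_funM; first exact: measurable_funB.
exact: (measurableT_comp (@measurable_inv R)).
Qed.

Lemma measurable_xiR : measurable_fun setT xiR.
Proof. exact: measurableT_comp. Qed.

Let mpow (X : Omega -> R) b : measurable_fun setT X ->
  measurable_fun setT (fun w => (X w `^ b)%:E).
Proof.
by move=> mX; apply/measurable_EFinP; apply: (measurableT_comp (measurable_powR b)).
Qed.

(** With u = rho^(alpha/2), E u^2 = 1 gives 2 E u + E (u - 1)^2 = 2. If E u were at least 1, then u
    = 1 almost surely, so log rho would vanish almost surely and be arithmetic. *)
Lemma integral_odds_sqrt_lt1 alpha : 0 < alpha ->
  ('E_P[fun w => (rho w `^ alpha)%R] = 1)%E ->
  ~ Defs.arithmetic P (fun w => ln (rho w)) ->
  (\int[P]_w (rho w `^ (alpha / 2))%:E < 1)%E.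
Proof.
move=> a0; rewrite expectationE => E1 nar.
pose u w := rho w `^ (alpha / 2).
have uu w : 0 < lam w < 1 -> u w ^+ 2 = rho w `^ alpha.
  move=> /andP[l0 l1].
  have r0 : 0 < rho w by rewrite divr_gt0 ?subr_gt0.
  by rewrite expr2 /u -powRD ?gt_eqF ?implybT// -splitr.
have u0 w : 0 <= u w by exact: powR_ge0.
have mu : measurable_fun setT u.
  by apply: (measurableT_comp (measurable_powR _)); exact: measurable_rho.
have meq f g : (forall w, 0 < lam w < 1 -> f w = g w) ->
    measurable_fun setT f -> measurable_fun setT g ->
    (\int[P]_w (f w)%:E = \int[P]_w (g w)%:E)%E.
  move=> fg mf mg; apply: ae_eq_integral => //; [exact/measurable_EFinP|exact/measurable_EFinP|].
  by apply: filterS range => w [_ /fg ->].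
pose v w := (u w - 1) ^+ 2.
have mv : measurable_fun setT v.
  by apply: measurable_funX; apply: measurable_funB.
have v0 w : 0 <= v w by exact: sqr_ge0.
have eq2 : (\int[P]_w (u w + u w)%:E + \int[P]_w (v w)%:E = 2%:E)%E.
  rewrite -ge0_integralD//; last 4 first.
  - by move=> w _; rewrite lee_fin addr_ge0.
  - by apply/measurable_EFinP; exact: measurable_funD.
  - by move=> w _; rewrite lee_fin.
  - exact/measurable_EFinP.
  under eq_integral do rewrite -EFinD.
  rewrite (meq _ (fun w => rho w `^ alpha + 1)).
  - under eq_integral do rewrite EFinD.
    rewrite ge0_integralD//; last 2 first.
    + by move=> w _; rewrite lee_fin powR_ge0.
    + exact: mpow measurable_rho.
    have -> : (\int[P]_w 1 = 1)%E by rewrite integral_cst// mul1e; exact: probability_setT.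
    by rewrite E1.
  - by move=> w /uu <-; rewrite /v; ring.
  - by apply: measurable_funD => //; exact: measurable_funD.
  - apply: measurable_funD => //.
    by apply: (measurableT_comp (measurable_powR _)); exact: measurable_rho.
have Iu0 : (0 <= \int[P]_w (u w)%:E)%E by apply: integral_ge0 => w _; rewrite lee_fin.
have Iv0 : (0 <= \int[P]_w (v w)%:E)%E by apply: integral_ge0 => w _; rewrite lee_fin.
have eq3 : (\int[P]_w (u w)%:E *+ 2 + \int[P]_w (v w)%:E = 2%:E)%E.
  rewrite -eq2; congr (_ + _)%E.
  under [RHS]eq_integral do rewrite EFinD.
  rewrite ge0_integralD//; last 2 first.
  - by move=> w _; rewrite lee_fin.
  - exact/measurable_EFinP.
  - by move=> w _; rewrite lee_fin.
  - exact/measurable_EFinP.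
rewrite ltNge; apply/negP => Iu1; apply: nar.
have Iv : (\int[P]_w (v w)%:E = 0)%E.
  move: eq3 Iu1 Iv0; case: (\int[P]_w (u w)%:E)%E Iu0 => [a| |]//; case: (\int[P]_w (v w)%:E)%E => [b| |]//.
  by rewrite !lee_fin -EFin_natmul -EFinD => _ [] E a1 b0; congr EFin; lra.
(* A variable that vanishes almost surely lies in every lattice; span 1 and multiple 0 serve
   here. *)
exists 1; first by [].
have mvE : measurable_fun setT (EFin \o v) by exact/measurable_EFinP.
have := (ae_eq_integral_abs P measurableT mvE).1.
under eq_integral do rewrite gee0_abs ?lee_fin//.
move=> /(_ Iv) vae.
apply: filterS2 range vae => w [_ l01] /(_ I) /= [] /eqP.
rewrite sqrf_eq0 subr_eq0 => /eqP u1; exists 0; rewrite mul0r.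
have r0 : 0 < rho w by case/andP: l01 => l0 l1; rewrite divr_gt0 ?subr_gt0.
have : ln (u w) = 0 by rewrite u1 ln1.
rewrite /u ln_powR => /eqP; rewrite mulf_eq0 => /orP[|/eqP//].
by rewrite mulf_eq0 invr_eq0 pnatr_eq0 orbF gt_eqF.
Qed.

(** The power alpha is the square of the power alpha/2, and v <= 1 + v^2. *)
Lemma integral_powR_half_lty (X : Omega -> R) alpha : measurable_fun setT X ->
  ('E_P[fun w => (X w `^ alpha)%R] < +oo)%E ->
  (\int[P]_w (X w `^ (alpha / 2))%:E < +oo)%E.
Proof.
move=> mX; rewrite expectationE => fin.
apply: (@le_lt_trans _ _ (\int[P]_w (1%:E + (X w `^ alpha)%:E))%E).
  apply: ge0_le_integral => //.
  - by move=> w _; rewrite lee_fin powR_ge0.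
  - exact: mpow.
  - by apply: emeasurable_funD => //; exact: mpow.
  move=> w _; rewrite -EFinD lee_fin.
  have -> : X w `^ alpha = (X w `^ (alpha / 2)) ^+ 2.
    by rewrite -powR_mulrn ?powR_ge0// -powRrM; congr (_ `^ _); field.
  exact: ler_1Dsqr.
rewrite ge0_integralD//; last 2 first.
- by move=> w _; rewrite lee_fin powR_ge0.
- exact: mpow.
rewrite integral_cst// mul1e lte_add_pinfty//.
by rewrite (le_lt_trans (probability_le1 _ _))// ltry.
Qed.

Lemma integral_gap_lty_moment p : 1 <= p ->
  ('E_P[fun w => (xiR w `^ p)%R] < +oo)%E -> (\int[P]_w (xiR w)%:E < +oo)%E.
Proof.
move=> p1; rewrite expectationE; apply: le_lt_trans.
apply: ge0_le_integral => //.
- by move=> w _; rewrite lee_fin.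
- by apply/measurable_EFinP; exact: measurable_xiR.
- exact: mpow measurable_xiR.
move=> w _; rewrite lee_fin /xiR; case: (xi w) => [|k]; first exact: powR_ge0.
by rewrite -[leLHS]powRr1// ler_powR// ler1n.
Qed.

(** Dyadic form of the tail formula for the mean: integrated, it bounds E xi by the sum of 2^i P(xi
    > 2^i). *)
Lemma dyadic_le (k : nat) :
  (k%:R%:E <= 1 + \sum_(i <oo) (2 ^+ i * ((2 ^ i < k)%N)%:R)%:E :> \bar R)%E.
Proof.
pose j := trunc_log 2 k.
case: k @j => [|k] j; first by rewrite adde_ge0 ?lee_fin// nneseries_ge0// => i _ _; rewrite lee_fin mulr_ge0// exprn_ge0.
have kj : (2 ^ j <= k.+1)%N by exact: trunc_logP.
have jk : (k.+1 < 2 ^ j.+1)%N by exact: trunc_log_ltn.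
have H : (k.+1%:R <= 1 + \sum_(0 <= i < j.+1) (2 ^+ i * ((2 ^ i < k.+1)%N)%:R) :> R).
  (* Because the tail inequality is strict, a power of two [k] does not count its own index: then
     the sum is exactly [k - 1]. Otherwise index [j] counts and the sum is 2^(j+1) - 1, at least
     [k]. *)
  have [e|ne] := eqVneq (2 ^ j)%N k.+1.
    have -> : \sum_(0 <= i < j.+1) (2 ^+ i * ((2 ^ i < k.+1)%N)%:R) = 2 ^+ j - 1 :> R.
      rewrite big_nat_recr//= e ltnn mulr0 addr0.
      rewrite (eq_big_nat _ _ (F2 := fun i => 2 ^+ i)); last first.
        by move=> i ij; rewrite -e ltn_exp2l// (_ : (i < j)%N) ?mulr1//.
      by rewrite subrX1 big_mkord (_ : 2 - 1 = 1) ?mul1r//; lra.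
    by rewrite -e natrX; lra.
  rewrite (eq_big_nat _ _ (F2 := fun i => 2 ^+ i)); last first.
    move=> i ij; rewrite (_ : (_ < _)%N = true) ?mulr1//.
    apply: (@leq_ltn_trans (2 ^ j)); first by rewrite leq_exp2l//.
    by rewrite ltn_neqAle ne.
  have := subrX1 (2 : R) j.+1; rewrite big_mkord (_ : 2 - 1 = 1) ?mul1r; last by lra.
  move=> <-; rewrite addrCA subrr addr0 -natrX ler_nat; exact: ltnW.
apply: (@le_trans _ _ (1 + (\sum_(0 <= i < j.+1) (2 ^+ i * ((2 ^ i < k.+1)%N)%:R))%:E)%E).
  by rewrite -EFinD lee_fin.
rewrite leeD2l// -sumEFin; apply: nneseries_lim_ge => i _ _.
by rewrite lee_fin mulr_ge0// exprn_ge0.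
Qed.

(** A convergent [ell] is bounded near infinity, so the tail is at most C t^(-2 alpha) there and the
    dyadic series is eventually dominated by a geometric one. The limit [c] is 0 or positive
    according to the set of assumptions. *)
Lemma integral_gap_lty_tail (alpha : R) (ell : R -> R) (c : R) : 2^-1 < alpha ->
  slowly_varying ell -> tail_xi P xi alpha ell -> ell t @[t --> +oo] --> c ->
  (\int[P]_w (xiR w)%:E < +oo)%E.
Proof.
move=> a1 [[t0 [_ ell0]] _] tl ellc.
(* The factor 2 absorbs the asymptotic equivalence, and |c| + 1 eventually bounds [ell]. *)
pose C := 2 * (`|c| + 1).
have C0 : 0 < C by rewrite /C; have := normr_ge0 c; lra.
have tailC : \forall t \near +oo, fine (P [set w | t < xiR w]) <= C * t `^ (- (2 * alpha)).
  have e1 : \forall t \near +oo, fine (P [set w | t < xiR w]) / (t `^ (- (2 * alpha)) * ell t) < 2.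
    by apply: (cvgr_lt 1 tl); lra.
  have e2 : \forall t \near +oo, ell t < `|c| + 1.
    by apply: (cvgr_lt c ellc); have := ler_norm c; lra.
  near=> t.
  have t1 : 0 < t by near: t; exact: nbhs_pinfty_gt.
  have l0 : 0 < ell t by apply: ell0; near: t; apply: nbhs_pinfty_ge; exact: num_real.
  have p0 : 0 < t `^ (- (2 * alpha)) by rewrite powR_gt0.
  have /ltW : fine (P [set w | t < xiR w]) / (t `^ (- (2 * alpha)) * ell t) < 2 by near: t.
  rewrite ler_pdivrMr ?mulr_gt0// => /le_trans; apply.
  have /ltW lc : ell t < `|c| + 1 by near: t.
  by have := ler_wpM2l (ltW p0) lc; rewrite /C; move: (ell t) (`|c|) (t `^ _) => l c' p; lra.
have [i0 _ Hi0] : \forall i \near \oo, fine (P [set w | (2:R) ^+ i < xiR w]) <=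
    C * ((2:R) ^+ i) `^ (- (2 * alpha)).
  have c2 : (2:R) ^+ i @[i --> \oo] --> +oo.
    apply/cvgryPge => M; near=> i; apply: (@le_trans _ _ i%:R).
      by near: i; exact: nbhs_infty_ger.
    by rewrite -natrX ler_nat ltnW// ltn_expl.
  exact: c2 tailC.
pose b i (w : Omega) : \bar R := (2 ^+ i * ((2 ^ i < xi w)%N)%:R)%:E.
have b0 i w : (0 <= b i w)%E by rewrite lee_fin mulr_ge0// exprn_ge0.
have mA i : measurable [set w | (2 ^ i < xi w)%N].
  rewrite (_ : [set w | _] = xi @^-1` [set k | (2 ^ i < k)%N])//.
  exact: measurable_funPTI.
have bE i : b i = fun w => ((2 ^+ i)%:E * (\1_[set w | (2 ^ i < xi w)%N] w)%:E)%E.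
  apply/funext => w; rewrite /b -EFinM indicE; congr (_ * _%:R)%:E.
  by congr nat_of_bool; apply/idP/idP; rewrite inE.
have mb i : measurable_fun setT (b i).
  rewrite bE; apply: emeasurable_funM => //.
  by apply/measurable_EFinP; exact: measurable_indic.
have mB i : measurable [set w | ((2:R) ^+ i < xiR w)%R].
  by rewrite (_ : [set w | _] = [set w | (2 ^ i < xi w)%N])//;
    apply/seteqP; split => w /=; rewrite /xiR -natrX ltr_nat.
have Ib i : (\int[P]_w b i w = (2 ^+ i)%:E * P [set w | ((2:R) ^+ i < xiR w)%R])%E.
  rewrite bE ge0_integralZl//; last first.
    by apply/measurable_EFinP; exact: measurable_indic.
  rewrite integral_indic// setIT; congr (_ * P _)%E.
  by apply/seteqP; split => w /=; rewrite /xiR -natrX ltr_nat.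
apply: (@le_lt_trans _ _ (\int[P]_w (1 + \sum_(i <oo) b i w))%E).
  apply: ge0_le_integral => //.
  - by move=> w _; rewrite lee_fin.
  - by apply/measurable_EFinP; exact: measurable_xiR.
  - by apply: emeasurable_funD => //; exact: ge0_emeasurable_sum.
  by move=> w _; exact: dyadic_le.
rewrite ge0_integralD//; last 2 first.
- by move=> w _; rewrite nneseries_ge0.
- exact: ge0_emeasurable_sum.
rewrite integral_cst// mul1e lte_add_pinfty//.
  by rewrite (le_lt_trans (probability_le1 _ _))// ltry.
rewrite integral_nneseries//.
have Ib0 i : (0 <= \int[P]_w b i w)%E by apply: integral_ge0.
rewrite (@nneseries_split _ _ 0 i0)//= add0n lte_add_pinfty//.
  apply: lte_sum_pinfty => i _; rewrite Ib lte_mul_pinfty ?lee_fin ?exprn_ge0//.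
  by rewrite -ge0_fin_numE// fin_num_measure.
rewrite -nneseries_addn//.
(* Ratio of the geometric series: 2^i from the dyadic weights times 2^(-2 alpha i) from the tail. It
   is below 1 because alpha > 1/2. *)
pose q : R := 2 `^ (1 - 2 * alpha).
have q1 : q < 1.
  rewrite /q /powR pnatr_eq0/= -[ltRHS]expR0 ltr_expR.
  by rewrite pmulr_llt0 ?ln_gt0 ?ltr1n//; lra.
apply: le_lt_trans (nneseries_geometric_lty (k := (C * q ^+ i0)%:E) (q := q%:E) _ _ _ _); last 4 first.
- by rewrite lee_fin mulr_ge0 ?exprn_ge0 ?powR_ge0 ?ltW.
- exact: ltry.
- by rewrite lee_fin powR_ge0.
- by rewrite lte_fin.
apply: lee_nneseries => [//|i _].
rewrite Ib -EFin_expe -EFinM -(@fineK _ (P _)) ?fin_num_measure// -EFinM lee_fin.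
have qE : q ^+ (i + i0) = 2 ^+ (i + i0) * (2 ^+ (i + i0)) `^ (- (2 * alpha)).
  rewrite /q powRD ?pnatr_eq0 ?implybT// powRr1// exprMn; congr (_ * _).
  exact: powR_exprn.
rewrite -mulrA -exprD [(i0 + i)%N]addnC qE mulrCA ler_wpM2l ?exprn_ge0//.
by apply: Hi0 => /=; rewrite leq_addl.
Unshelve. all: by end_near. Qed.

End Moments.

(** * Law of large numbers for the marked sites *)

Lemma le_integral_EFin d (T : measurableType d) (R : realType)
    (P : probability T R) (f g : T -> R) : measurable_fun setT f -> measurable_fun setT g ->
  (forall x, 0 <= f x) -> (forall x, f x <= g x) ->
  (\int[P]_x (f x)%:E <= \int[P]_x (g x)%:E)%E.
Proof.
move=> mf mg f0 fg; apply: ge0_le_integral; rewrite ?lee_fin//.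
- by move=> x _; rewrite lee_fin.
- exact/measurable_EFinP.
- exact/measurable_EFinP.
- by move=> x _; rewrite lee_fin.
Qed.

Lemma markov_ge0 d (T : measurableType d) (R : realType) (P : probability T R)
    (f : T -> R) (c : R) : measurable_fun setT f -> (forall x, 0 <= f x) -> 0 <= c ->
  (c%:E * P [set x | (c <= f x)%R] <= \int[P]_x (f x)%:E)%E.
Proof.
move=> mf f0 c0.
have mA : measurable [set x | (c <= f x)%R].
  rewrite (_ : [set x | _] = setT `&` f @^-1` `[c, +oo[).
    by apply: mf => //; exact: measurable_itv.
  by rewrite setTI; apply/seteqP; split => x /=; rewrite in_itv/= andbT.
rewrite -(@integral_cst _ _ _ P _ mA c%:E).
rewrite integral_mkcond/=; apply: ge0_le_integral => //.
- by move=> x _; rewrite patchE; case: ifP => // _; rewrite lee_fin.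
- by apply/(measurable_restrictT _ mA); exact: measurable_cst.
- exact/measurable_EFinP.
move=> x _; rewrite patchE; case: ifPn => [|_]; last by rewrite lee_fin.
by rewrite inE /= lee_fin.
Qed.

Section LawOfLargeNumbers.
Context (R : realType) d (Omega : measurableType d) (P : probability Omega R)
  (X : nat -> Omega -> R).
Hypothesis mX : forall i, measurable_fun setT (X i).
Hypothesis X0 : forall i w, 0 <= X i w.

(** The variance bound for pairwise uncorrelated variables, from the diagonal and off-diagonal terms
    of the square. *)
Lemma second_moment_sum (m s : R) (k : nat) : 0 <= m ->
  (forall i, \int[P]_w (X i w)%:E = m%:E)%E ->
  (forall i, \int[P]_w (X i w ^+ 2)%:E <= s%:E)%E ->
  (forall i j, i != j -> \int[P]_w (X i w * X j w)%:E = (m ^+ 2)%:E)%E ->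
  (\int[P]_w ((\sum_(i < k) X i w - k%:R * m) ^+ 2)%:E <= (k%:R * s)%:E)%E.
Proof.
move=> m0 X1 X2 X12.
pose S w := \sum_(i < k) X i w.
have mS : measurable_fun setT S by apply: measurable_sum.
have S0 w : 0 <= S w by apply: sumr_ge0.
have IS : (\int[P]_w (S w)%:E = (k%:R * m)%:E)%E.
  under eq_integral do rewrite -sumEFin.
  rewrite ge0_integral_sum//; last first.
  - by move=> i w _; rewrite lee_fin.
  - by move=> i; exact/measurable_EFinP.
  under eq_bigr do rewrite X1.
  by rewrite sumEFin sumr_const card_ord mulr_natl.
have s0 : 0 <= s.
  rewrite -lee_fin; apply: le_trans (X2 0%N).
  by apply: integral_ge0 => w _; rewrite lee_fin sqr_ge0.
have IS2 : (\int[P]_w (S w ^+ 2)%:E <= (k%:R * s + (k%:R * k%:R - k%:R) * m ^+ 2)%:E)%E.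
  have E w : (S w ^+ 2)%:E = (\sum_(i < k) \sum_(j < k) (X i w * X j w)%:E)%E.
    rewrite expr2 /S mulr_suml -sumEFin; apply: eq_bigr => i _.
    by rewrite mulr_sumr sumEFin.
  under eq_integral do rewrite E.
  have mXX i j : measurable_fun setT (fun w => (X i w * X j w)%:E).
    by apply/measurable_EFinP; exact: measurable_funM.
  rewrite ge0_integral_sum//; last first.
  - by move=> i w _; apply: sume_ge0 => j _; rewrite lee_fin mulr_ge0.
  - by move=> i; exact: emeasurable_sum.
  apply: (@le_trans _ _ (\sum_(i < k) (s + (k%:R - 1) * m ^+ 2)%:E)%E).
    apply: lee_sum => i _.
    rewrite ge0_integral_sum//; last by move=> j w _; rewrite lee_fin mulr_ge0.
    rewrite (bigD1 i)//= EFinD leeD//.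
      by under eq_integral do rewrite -expr2; exact: X2.
    rewrite (eq_bigr (fun=> (m ^+ 2)%:E)); last first.
      by move=> j ji; rewrite X12// eq_sym.
    rewrite sumEFin lee_fin sumr_const cardC1 card_ord -[leLHS]mulr_natl ler_wpM2r ?sqr_ge0//.
    by case: k i {S mS S0 IS E mXX} => [[]//|k' _]; rewrite -natr1 addrK.
  by rewrite sumEFin lee_fin sumr_const card_ord -[leLHS]mulr_natl; lra.
pose c := k%:R * m.
have c0 : 0 <= c by rewrite mulr_ge0.
(* The expansion of the square is arranged without differences, so that only additivity of integrals
   of nonnegative functions is needed. *)
have eqI : (\int[P]_w ((S w - c) ^+ 2)%:E + (2 * c * c)%:E =
    \int[P]_w (S w ^+ 2)%:E + (c ^+ 2)%:E)%E.
  have -> : ((2 * c * c)%:E = \int[P]_w (2 * c * S w)%:E)%E.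
    under [RHS]eq_integral do rewrite EFinM.
    rewrite ge0_integralZl ?IS//; first exact/measurable_EFinP.
      by move=> w _; rewrite lee_fin.
    by rewrite lee_fin mulr_ge0.
  have -> : ((c ^+ 2)%:E = \int[P]_w (c ^+ 2)%:E)%E.
    rewrite integral_cst// -[LHS]mule1; congr (_ * _)%E.
    by apply/esym; exact: probability_setT.
  rewrite -!ge0_integralD//.
  - by apply: eq_integral => w _; rewrite -!EFinD; congr EFin; ring.
  - by move=> w _; rewrite lee_fin sqr_ge0.
  - by apply/measurable_EFinP; exact: measurable_funX.
  - by move=> w _; rewrite lee_fin sqr_ge0.
  - by move=> w _; rewrite lee_fin sqr_ge0.
  - by apply/measurable_EFinP; apply: measurable_funX; exact: measurable_funB.
  - by move=> w _; rewrite lee_fin mulr_ge0// mulr_ge0.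
  - by apply/measurable_EFinP; exact: measurable_funM.
have : (\int[P]_w ((S w - c) ^+ 2)%:E + (2 * c * c)%:E <=
   (k%:R * s + (k%:R * k%:R - k%:R) * m ^+ 2)%:E + (c ^+ 2)%:E)%E.
  by rewrite eqI leeD2r.
case: (\int[P]_w ((S w - c) ^+ 2)%:E)%E => [v| |]//; last by move=> _; rewrite leNye.
rewrite -!EFinD !lee_fin => H.
have k0 : (0 : R) <= k%:R by [].
have m2 : 0 <= m ^+ 2 by exact: sqr_ge0.
by move: H; rewrite /c; nra.
Qed.

End LawOfLargeNumbers.

Section GapsLLN.
Context (R : realType) d (Omega : measurableType d) (P : probability Omega R)
  (Y0 : Omega -> (nat * R)%type) (Y : int -> Omega -> (nat * R)%type).
Hypothesis mY : forall i, measurable_fun setT (Y i).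
Hypothesis mY0 : measurable_fun setT Y0.
Hypothesis iidY : iid_copies P Y0 Y.
Hypothesis gap_lty : (\int[P]_w ((Y0 w).1%:R%:E) < +oo)%E.
Let seqw := sequence_of Y.

Definition mean_gap : R := fine (\int[P]_w ((Y0 w).1%:R%:E)).

Let mnat : measurable_fun setT (fun a : nat * R => a.1%:R : R).
Proof. by apply: measurableT_comp => //; exact: measurable_fst. Qed.

Let mean_gapE : (\int[P]_w ((Y0 w).1%:R%:E) = mean_gap%:E)%E.
Proof.
by rewrite fineK// ge0_fin_numE//; apply: integral_ge0 => w _; rewrite lee_fin.
Qed.

(** Only the mean of a gap is known to be finite. The gaps are therefore truncated at [M]: the
    truncated sum is controlled by Chebyshev's inequality, and the rest, of small mean, by
    Markov's. *)
Let tr (M : nat) (a : nat * R) : R := (minn a.1 M)%:R.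

Let mtr M : measurable_fun setT (tr M).
Proof. by apply: (measurableT_comp (f := fun k : nat => (minn k M)%:R : R)) => //; exact: measurable_fst. Qed.

Let mean_tr M : R := fine (\int[P]_w (tr M (Y0 w))%:E).

Let tr_le M a : tr M a <= a.1%:R.
Proof. by rewrite ler_nat geq_minl. Qed.

Let mean_trE M : (\int[P]_w (tr M (Y0 w))%:E = (mean_tr M)%:E)%E.
Proof.
rewrite fineK// ge0_fin_numE; last by apply: integral_ge0 => w _; rewrite lee_fin.
by apply: le_lt_trans gap_lty; apply: le_integral_EFin => //;
  [exact: (measurableT_comp (mtr M))|exact: (measurableT_comp mnat)].
Qed.

Let mean_tr_ge0 M : 0 <= mean_tr M.
Proof. by rewrite -lee_fin -mean_trE; apply: integral_ge0 => w _; rewrite lee_fin. Qed.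

Lemma truncated_mean_cvg : mean_tr M @[M --> \oo] --> mean_gap.
Proof.
have c : (\int[P]_w (tr M (Y0 w))%:E @[M --> \oo] --> \int[P]_w ((Y0 w).1%:R%:E))%E.
  apply: (@dominated_cvg _ _ _ _ _ _ _ _ (fun w => ((Y0 w).1%:R)%:E)) => //.
  - by move=> M; apply/measurable_EFinP; exact: (measurableT_comp (mtr M)).
  - move=> w _; apply: cvg_near_cst; exists (Y0 w).1 => // M /= YM.
    by rewrite /tr (minn_idPl YM).
  - apply/integrableP; split; first by apply/measurable_EFinP; exact: (measurableT_comp mnat).
    by under eq_integral do rewrite gee0_abs ?lee_fin//.
  - by move=> M w _; rewrite gee0_abs ?lee_fin//.
rewrite mean_gapE in c.
by move/fine_cvgP : c => -[].
Qed.

Let X M i w := tr M (Y i.+1%:Z w).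
Let Z M i w := (Y i.+1%:Z w).1%:R - tr M (Y i.+1%:Z w).

Let mX M i : measurable_fun setT (X M i).
Proof. exact: measurableT_comp. Qed.

Let mZ0 M : measurable_fun setT (fun a : nat * R => a.1%:R - tr M a).
Proof. exact: measurable_funB. Qed.

Let mZ M i : measurable_fun setT (Z M i).
Proof. exact: (measurableT_comp (mZ0 M)). Qed.

Let Z_ge0 M i w : 0 <= Z M i w. Proof. by rewrite subr_ge0. Qed.

Lemma integral_sum_rest M k :
  (\int[P]_w (\sum_(i < k) Z M i w)%:E = (k%:R * (mean_gap - mean_tr M))%:E)%E.
Proof.
under eq_integral do rewrite -sumEFin.
rewrite ge0_integral_sum//; last first.
- by move=> i w _; rewrite lee_fin.
- by move=> i; exact/measurable_EFinP.
rewrite (eq_bigr (fun=> (mean_gap - mean_tr M)%:E)).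
  by rewrite sumEFin sumr_const card_ord mulr_natl.
move=> i _; rewrite (integral_same_law (f := fun a => (a.1%:R - tr M a)%:E) (mY _) mY0 (iidY.1 _)); last 2 first.
- exact/measurable_EFinP.
- by move=> a; rewrite lee_fin subr_ge0.
have : (\int[P]_w ((Y0 w).1%:R - tr M (Y0 w))%:E + \int[P]_w (tr M (Y0 w))%:E = mean_gap%:E)%E.
  rewrite -mean_gapE -ge0_integralD//.
  - by apply: eq_integral => w _; rewrite -EFinD subrK.
  - by move=> w _; rewrite lee_fin subr_ge0.
  - by apply/measurable_EFinP; exact: (measurableT_comp (mZ0 M)).
  - by move=> w _; rewrite lee_fin.
  - by apply/measurable_EFinP; exact: measurableT_comp.
rewrite mean_trE; case: (\int[P]_w ((Y0 w).1%:R - tr M (Y0 w))%:E)%E => [v| |]//.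
by rewrite -EFinD => -[<-]; rewrite addrK.
Qed.

Lemma truncated_second_moment M k :
  (\int[P]_w ((\sum_(i < k) X M i w - k%:R * mean_tr M) ^+ 2)%:E <=
    (k%:R * M%:R ^+ 2)%:E)%E.
Proof.
have law f : measurable_fun setT f -> (forall a, 0 <= f a)%E ->
    forall i, (\int[P]_w f (Y i w) = \int[P]_w f (Y0 w))%E.
  by move=> mf f0 i; apply: (integral_same_law (mY _) mY0 (iidY.1 _)).
have X1 i : (\int[P]_w (X M i w)%:E = (mean_tr M)%:E)%E.
  rewrite (law (fun a => (tr M a)%:E)) ?mean_trE//; first exact/measurable_EFinP.
  by move=> a; rewrite lee_fin.
apply: second_moment_sum => //.
- move=> i; rewrite -[leRHS]mule1 -(probability_setT P) -integral_cst//.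
  apply: le_integral_EFin => //; first exact: measurable_funX.
  + by move=> w; exact: sqr_ge0.
  + by move=> w; rewrite lerXn2r ?nnegrE// /X /tr ler_nat geq_minr.
- move=> i j ij.
  have ij' : i.+1%:Z != j.+1%:Z by apply: contra ij => /eqP [->].
  pose RY i : {RV P >-> (nat * R)%type} := HB.pack (Y i) (isMeasurableFun.Build _ _ _ _ _ (mY i)).
  under eq_integral do rewrite EFinM.
  rewrite (@integral_indepM _ _ _ P _ _ _ _ (RY i.+1%:Z) (RY j.+1%:Z) _
     (fun a => (tr M a)%:E) (fun a => (tr M a)%:E)).
  + by rewrite [X in (X * _)%E]X1 [X in (_ * X)%E]X1 -EFinM expr2.
  + exact: (indep_pair iidY.2 ij').
  + exact/measurable_EFinP.
  + exact/measurable_EFinP.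
  + by move=> a; rewrite lee_fin.
  + by move=> a; rewrite lee_fin.
Qed.

Lemma S_concentrated (delta eps : R) : 0 < delta -> 0 < eps ->
  exists K : nat, forall k, (K <= k)%N ->
  (P [set w | ~ (k%:R * (mean_gap - delta) <= (S_ (gaps (seqw w)) k%:Z)%:~R <=
                 k%:R * (mean_gap + delta))%R] <= eps%:E)%E.
Proof.
move=> d0 e0.
(* The deviation [delta k] is split into thirds. The first bound keeps the bias from truncation
   within one third; the second makes Markov's estimate 3 eta / delta at most eps/2. *)
pose eta := Num.min (delta / 3) (delta * eps / 6).
have eta0 : 0 < eta by rewrite lt_min !divr_gt0 ?mulr_gt0.
have [M _ /(_ M (leqnn M)) HM] : \forall M \near \oo, `|mean_gap - mean_tr M| < eta.
  by move/cvgrPdist_lt : truncated_mean_cvg; exact.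
have gM : mean_gap - mean_tr M <= eta by move: HM => /ltr_normlW/ltW.
have eta1 : eta <= delta / 3 by rewrite /eta ge_min lexx.
have eta2 : eta <= delta * eps / 6 by rewrite /eta ge_min lexx orbT.
have gM0 : 0 <= mean_gap - mean_tr M.
  have := integral_sum_rest M 1; rewrite mul1r => E; rewrite -lee_fin -E.
  by apply: integral_ge0 => w _; rewrite lee_fin sumr_ge0.
(* Chebyshev's estimate k M^2 / (delta k / 3)^2 is at most eps/2 from this [k] on. *)
pose K := (Num.truncn (18 * M%:R ^+ 2 / (delta ^+ 2 * eps))).+1.
exists K => k Kk.
have k0 : (0 : R) < k%:R by rewrite ltr0n; apply: leq_trans Kk.
have kK : 18 * M%:R ^+ 2 / (delta ^+ 2 * eps) <= k%:R.
  by apply/ltW/(lt_le_trans (truncnS_gt _)); rewrite ler_nat.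
pose a := delta * k%:R / 3.
have a0 : 0 < a by rewrite /a divr_gt0 ?mulr_gt0.
pose V w := (\sum_(i < k) X M i w - k%:R * mean_tr M) ^+ 2.
pose W w := \sum_(i < k) Z M i w.
have mV : measurable_fun setT V.
  apply: measurable_funX; apply: measurable_funB => //; exact: measurable_sum.
have mW : measurable_fun setT W by exact: measurable_sum.
have W0 w : 0 <= W w by exact: sumr_ge0.
have V0 w : 0 <= V w by exact: sqr_ge0.
have mge (f : Omega -> R) c : measurable_fun setT f -> measurable [set w : Omega | (c <= f w)%R].
  move=> mf; rewrite (_ : [set w | _] = setT `&` f @^-1` `[c, +oo[).
    by apply: mf => //; exact: measurable_itv.
  by rewrite setTI; apply/seteqP; split => x /=; rewrite in_itv/= andbT.
have PV : (P [set w | (a ^+ 2 <= V w)%R] <= (eps / 2)%:E)%E.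
  have := markov_ge0 P mV V0 (sqr_ge0 a) => /le_trans /(_ (truncated_second_moment M k)).
  rewrite -(@fineK _ (P _)); last by rewrite fin_num_measure//; exact: mge.
  rewrite -EFinM !lee_fin => H.
  rewrite -(ler_pM2l (exprn_gt0 2 a0)); apply: (le_trans H).
  rewrite /a; move: kK; rewrite ler_pdivrMr ?mulr_gt0 ?exprn_gt0// => kK.
  by have := ler_wpM2l (ltW k0) kK; lra.
have PW : (P [set w | (a <= W w)%R] <= (eps / 2)%:E)%E.
  have := markov_ge0 P mW W0 (ltW a0); rewrite integral_sum_rest.
  rewrite -(@fineK _ (P _)); last by rewrite fin_num_measure//; exact: mge.
  rewrite -EFinM !lee_fin => H.
  rewrite -(ler_pM2l a0); apply: (le_trans H).
  rewrite /a; have := ler_wpM2l (ltW k0) (le_trans gM eta2); lra.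
rewrite [eps]splitr EFinD; apply: le_trans (leeD PV PW).
apply: le_trans (probability_setU_le _ _ _); [|exact: mge|exact: mge].
have mSk : measurable [set w | ~ (k%:R * (mean_gap - delta) <= (S_ (gaps (seqw w)) k%:Z)%:~R <=
                 k%:R * (mean_gap + delta))%R].
  have -> : [set w | ~ (k%:R * (mean_gap - delta) <= (S_ (gaps (seqw w)) k%:Z)%:~R <=
                 k%:R * (mean_gap + delta))%R] = ~` (seqw @^-1` \bigcup_(n in
    [set n : nat | (k%:R * (mean_gap - delta) <= n%:R <= k%:R * (mean_gap + delta))%R])
     [set y | S_ (gaps y) k%:Z = n%:Z]).
    apply/seteqP; split => w H Hn; apply: H.
      by case: Hn => n Dn Sn; rewrite [S_ _ _]Sn.
    exists `|S_ (gaps (seqw w)) k%:Z|%N; last exact: S_nat_abs.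
    by move: Hn; rewrite S_nat_abs.
  apply: measurableC; rewrite -[X in measurable X]setTI.
  apply: measurable_sequence_of => //.
  by apply: bigcup_measurable => n _; exact: measurable_S.
apply: le_measure; rewrite ?inE//; first by apply: measurableU; exact: mge.
move=> w /= H; apply: contrapT => nVW; apply: H.
have VWa : V w < a ^+ 2 /\ W w < a.
  by split; rewrite ltNge; apply/negP => h; apply: nVW; [left|right].
have [Va Wa] := VWa.
have SE : (S_ (gaps (seqw w)) k%:Z)%:~R = \sum_(i < k) X M i w + W w :> R.
  rewrite S_nat rmorph_sum/= /W -big_split/=; apply: eq_bigr => i _.
  by rewrite /X /Z addrC subrK.
rewrite SE; move: Va (W0 w) Wa; rewrite /V; move: (\sum_(i < k) X M i w) (W w) => sx ww.
set c := k%:R * mean_tr M => Va w0 Wa.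
have /andP[c1 c2] : - a < sx - c < a.
  by apply/andP; split; rewrite ltNge; apply/negP => h; move: Va; rewrite ltNge => /negP; apply; nra.
have := ler_wpM2l (ltW k0) gM0; have := ler_wpM2l (ltW k0) (le_trans gM eta1).
rewrite mulr0 mulrBr -/c; move: c1 c2 Wa w0; rewrite /a => c1 c2 Wa w0 H1 H2.
by apply/andP; split; lra.
Qed.

End GapsLLN.

(** * Restarting at a marked site *)

Lemma probability_le_on1 d (T : measurableType d) (R : realType)
    (P : probability T R) (N A B : set T) : measurable N -> measurable A -> measurable B ->
  P N = 1%E -> N `&` A `<=` B -> (P A <= P B)%E.
Proof.
move=> mN mA mB PN NAB; rewrite -(probability_setI1 mN mA PN).
by apply: le_measure; rewrite ?inE//; exact: measurableI.
Qed.

Section AnnealedIncrements.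
Context (R : realType) d (Omega : measurableType d) (P : probability Omega R)
  (Y0 : Omega -> (nat * R)%type) (Y : int -> Omega -> (nat * R)%type)
  (Pq : (int -> R) -> probability path_space R) (PP : probability path_space R).
Hypothesis mY : forall i, measurable_fun setT (Y i).
Hypothesis mY0 : measurable_fun setT Y0.
Hypothesis iidY : iid_copies P Y0 Y.
Hypothesis range0 : {ae P, forall w, (0 < (Y0 w).1)%N /\ 0 < (Y0 w).2 < 1}.
Hypothesis quenched : forall omega : int -> R, (forall n, 0 < omega n < 1) ->
                quenched_law omega (Pq omega).
Hypothesis annealed : annealed_law P (fun w => env (sequence_of Y w)) Pq PP.
Let seqw := sequence_of Y.

Definition outside (k u v : nat) : set (sequence_space (nat * R)%type) :=
  [set y | ~ (u%:Z <= S_ (gaps y) k%:Z <= v%:Z)].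

Lemma measurable_outside k u v : measurable (outside k u v).
Proof.
rewrite (_ : outside k u v = ~` \bigcup_(n in [set n : nat | (u <= n <= v)%N])
     [set y | S_ (gaps y) k%:Z = n%:Z]).
  by apply: measurableC; apply: bigcup_measurable => n _; exact: measurable_S.
apply/seteqP; split => y H Hn; apply: H.
  by case: Hn => n Dn Sn; rewrite [S_ _ _]Sn.
exists `|S_ (gaps y) k%:Z|%N; last exact: S_nat_abs.
by move: Hn; rewrite S_nat_abs.
Qed.

(** The quenched inequality is additive in the two passages, so averaging involves the environment
    shifted to [S_k] on its own, and stationarity identifies its mean with [PP C]. On the bad event
    the probability is bounded by 1. *)
Lemma annealed_increment_le (A : set path_space) nA B nB C nC k u v :
  finite_horizon nA A -> finite_horizon nB B -> finite_horizon nC C ->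
  (forall y, good y -> ~ outside k u v y ->
    Pq (env y) A <= Pq (env y) B + Pq (env (shift_seq k%:Z y)) C)%E ->
  (PP A <= PP B + PP C + P (seqw @^-1` outside k u v))%E.
Proof.
move=> hA hB hC H.
have mS := measurable_sequence_of mY.
have mO := measurable_outside k u v.
have mqB := measurable_qprob quenched hB.
have mqC := measurable_qprob quenched hC.
have mqCs : measurable_fun setT (fun y => qprob Pq C (shift_seq k%:Z y)).
  by apply: measurableT_comp mqC _; exact: measurable_shift_seq.
have mI : measurable_fun setT (fun y => (\1_(outside k u v) y : R)%:E).
  by apply/measurable_EFinP; exact: measurable_indic.
pose f y := (qprob Pq B y + qprob Pq C (shift_seq k%:Z y) + (\1_(outside k u v) y : R)%:E)%E.
have I0 y : (0 <= (\1_(outside k u v) y : R)%:E)%E by rewrite lee_fin indicE.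
apply: (@le_trans _ _ (\int[P]_w f (seqw w))%E).
  apply: (annealed_le mY mY0 iidY range0 annealed).
  - exact: (measurable_finite_horizon hA).
  - by apply: emeasurable_funD => //; exact: emeasurable_funD.
  - by move=> y; rewrite /f !adde_ge0// qprob_ge0.
  move=> y gy; rewrite /f qprob_good// qprob_good; last exact: good_shift.
  have [Oy|Oy] := pselect (outside k u v y); last first.
    rewrite indicE memNset//= adde0; exact: H.
  rewrite indicE mem_set//=; apply: (@le_trans _ _ 1%E).
    by apply: probability_le1; exact: (measurable_finite_horizon hA).
  by rewrite leeDr// adde_ge0.
rewrite /f ge0_integralD//; last 3 first.
- by move=> w _; rewrite adde_ge0// qprob_ge0.
- by apply: emeasurable_funD; [exact: (measurableT_comp mqB)|exact: (measurableT_comp mqCs)].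
- exact: (measurableT_comp mI).
rewrite ge0_integralD//; last 4 first.
- by move=> w _; exact: qprob_ge0.
- exact: (measurableT_comp mqB).
- by move=> w _; exact: qprob_ge0.
- exact: (measurableT_comp mqCs).
rewrite -(annealed_qprob mY mY0 iidY range0 quenched annealed hB).
rewrite -(annealed_qprob_shift mY mY0 iidY range0 quenched annealed k%:Z hC).
rewrite leeD2l// (_ : (fun w => (\1_(outside k u v) (seqw w))%:E) =
  (fun w => (\1_(seqw @^-1` outside k u v) w : R)%:E))//.
rewrite integral_indic ?setIT//.
by rewrite -[X in measurable X]setTI; exact: mS.
Qed.


Lemma env_shift_law y k : good y -> quenched_law (fun n => env y (S_ (gaps y) k + n))
  (Pq (env (shift_seq k y))).
Proof.
move=> gy; rewrite -env_shift//; apply: quenched.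
by apply: env01; exact: good_shift.
Qed.

(** When u <= S_k <= v, monotonicity of passage times lets [u] replace [S_k] in the target and [v]
    replace it in the first leg; [annealed_hit_le] uses the opposite replacements. *)
Lemma annealed_not_hit_le (n t1 t2 k u v : nat) :
  (PP (~` hit (n + u)%N (t1 + t2)%N) <=
     PP (~` hit v t1) + PP (~` hit n t2) + P (seqw @^-1` outside k u v))%E.
Proof.
have := (@annealed_increment_le _ _ _ _ _ _ k u v (finite_horizonC (@finite_horizon_hit (n + u)%N (t1 + t2)%N))
  (finite_horizonC (@finite_horizon_hit v t1)) (finite_horizonC (@finite_horizon_hit n t2))) ; apply=> y gy; move=> /contrapT uxv.
have e01 := env01 gy; have QP := quenched e01.
have QN := quenched_nearest_neighbour QP e01.
have mC n' t' : measurable (~` hit n' t') by apply: measurableC; exact: measurable_hit.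
have [x Sx] : exists x : nat, S_ (gaps y) k%:Z = x%:Z.
  by exists `|S_ (gaps y) k%:Z|%N; exact: S_nat_abs.
rewrite Sx in uxv; have /andP[ux xv] : (u <= x <= v)%N by [].
have Q'P := env_shift_law k%:Z gy; rewrite Sx in Q'P.
apply: (@le_trans _ _ (Pq (env y) (~` hit (x%:Z + n%:Z) (t1 + t2)%N))).
  apply: (probability_le_on1 measurable_nearest_neighbour) => //.
  move=> X [XN nX] hX; apply: nX; apply: (@hit_mono _ (x + n)%N); first lia.
  by split => //; move: hX; rewrite /hit/= PoszD.
apply: le_trans (not_hit_le QP Q'P e01 n t1 t2) _.
rewrite leeD2r//; apply: (probability_le_on1 measurable_nearest_neighbour) => //.
by move=> X [XN nX] hX; apply: nX; exact: (hit_mono xv).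
Qed.

Lemma annealed_hit_le (n t1 t2 k u v : nat) :
  (PP (hit (n + v)%N (t1 + t2)%N) <=
     PP (hit u t1) + PP (hit n t2) + P (seqw @^-1` outside k u v))%E.
Proof.
have := (@annealed_increment_le _ _ _ _ _ _ k u v (@finite_horizon_hit (n + v)%N (t1 + t2)%N) (@finite_horizon_hit u t1)
  (@finite_horizon_hit n t2)) ; apply=> y gy; move=> /contrapT uxv.
have e01 := env01 gy; have QP := quenched e01.
have QN := quenched_nearest_neighbour QP e01.
have [x Sx] : exists x : nat, S_ (gaps y) k%:Z = x%:Z.
  by exists `|S_ (gaps y) k%:Z|%N; exact: S_nat_abs.
rewrite Sx in uxv; have /andP[ux xv] : (u <= x <= v)%N by [].
have Q'P := env_shift_law k%:Z gy; rewrite Sx in Q'P.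
apply: (@le_trans _ _ (Pq (env y) (hit (x%:Z + n%:Z) (t1 + t2)%N))).
  apply: (probability_le_on1 measurable_nearest_neighbour) => //;
    try exact: measurable_hit.
  move=> X [XN hX]; have := @hit_mono (x + n)%N (n + v)%N (t1 + t2)%N _ X.
  by rewrite PoszD; apply => //; lia.
apply: le_trans (hit_le QP Q'P e01 n t1 t2 _) _ => //.
rewrite leeD2r//; apply: (probability_le_on1 measurable_nearest_neighbour) => //;
    try exact: measurable_hit.
exact: hit_mono.
Qed.

End AnnealedIncrements.

(** * Convergence of distribution functions *)

Section DistributionFunctions.
Context (R : realType).

Lemma nondecreasing_continuity_point (F : R -> R) (a b : R) :
  {homo F : x y / x <= y} -> a < b -> exists2 s, a < s < b & {for s, continuous F}.
Proof.
move=> ndF ab; pose D := [set x | x \in (`]a, b[) /\ discontinuity F x].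
have ndFab : {in `[a, b] &, nondecreasing_fun F} by move=> x y _ _; exact: ndF.
have cD : countable D by apply: discontinuity_countable.
have [s [sab nDs]] : exists s, s \in (`]a, b[) /\ ~ D s.
  apply/not_existsP => H; have abD : [set` `]a, b[] `<=` D.
    by move=> x xab; apply: contrapT => nDx; exact: (H x).
  have := countable_lebesgue_measure0 (sub_countable (subset_card_le abD) cD).
  rewrite lebesgue_measure_itv/= lte_fin ab -EFinD => /eqP; rewrite eqe subr_eq0.
  by rewrite gt_eqF.
exists s; first by move: sab; rewrite in_itv.
have cl : cvg (F x @[x --> s^'-]).
  apply: nondecreasing_at_left_is_cvgr; near=> x; first by move=> y z _ _; exact: ndF.
  by exists (F s) => _ /= [y + <-]; rewrite in_itv/= => /andP[_ /ltW]; exact: ndF.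
have cr : cvg (F x @[x --> s^'+]).
  apply: nondecreasing_at_right_is_cvgr; near=> x; first by move=> y z _ _; exact: ndF.
  by exists (F s) => _ /= [y + <-]; rewrite in_itv/= => /andP[/ltW + _]; exact: ndF.
have elr : lim (F x @[x --> s^'-]) = lim (F x @[x --> s^'+]).
  by apply: contrapT => lr; apply: nDs; split => //; split => //; exact/eqP.
have lF : lim (F x @[x --> s^'-]) <= F s.
  by apply: limr_le => //; near=> x; apply: ndF; near: x; exact: nbhs_left_le.
have rF : F s <= lim (F x @[x --> s^'+]).
  by apply: limr_ge => //; near=> x; apply: ndF; near: x; exact: nbhs_right_ge.
have Fl : lim (F x @[x --> s^'-]) = F s by apply/eqP; rewrite eq_le lF/= elr rF.
by apply/left_right_continuousP; split; [rewrite -Fl|rewrite -Fl elr].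
Unshelve. all: by end_near. Qed.

Lemma nondecreasing_increase_point (F : R -> R) (e : R) :
  {homo F : x y / x <= y} -> F x @[x --> -oo] --> 0 -> F x @[x --> +oo] --> (1 : R) ->
  0 < e -> exists s s', [/\ s' < s < s' + e, F s' < F s, {for s, continuous F}
    & {for s', continuous F}].
Proof.
move=> ndF F0 F1 e0.
have /choice[c Hc] : forall i : int, exists x : R,
    i%:~R * (e / 2) < x < (i + 1)%:~R * (e / 2) /\ {for x, continuous F}.
  move=> i; have [|s sI sc] := @nondecreasing_continuity_point F (i%:~R * (e / 2))
      ((i + 1)%:~R * (e / 2)) ndF.
    by rewrite ltr_pM2r ?divr_gt0// ltr_int ltrDl.
  by exists s.
have cS i : c i < c (i + 1) < c i + e.
  have [/andP[h1 h2] _] := Hc i; have [/andP[h3 h4] _] := Hc (i + 1).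
  rewrite (lt_trans h2 h3)/=; apply: (lt_le_trans h4).
  by move: h1; rewrite !intrD => h1; lra.
apply: contrapT => H.
have Fc i : F (c (i + 1)) = F (c i).
  have /andP[/ltW ci _] := cS i; apply/eqP; rewrite eq_le (ndF _ _ ci) andbT.
  rewrite leNgt; apply/negP => Fl; apply: H; exists (c (i + 1)), (c i).
  by split=> //; [exact: (Hc _).2|exact: (Hc _).2].
have Fp (n : nat) : F (c n%:Z) = F (c 0).
  by elim: n => // n IH; rewrite -IH -(Fc n%:Z); congr (F (c _)); rewrite -addn1 PoszD.
have Fn (n : nat) : F (c (- n%:Z)) = F (c 0).
  elim: n => [|n IH]; first by rewrite oppr0.
  by rewrite -IH -(Fc (- n.+1%:Z)); congr (F (c _)); rewrite -addn1 PoszD opprD -addrA addNr addr0.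
have c_lt (M : R) : exists i : nat, c (- i%:Z) <= M.
  exists (Num.truncn (`|M| / (e / 2))).+2; set i := Num.truncn _.
  have [/andP[_ h] _] := Hc (- (i.+2)%:Z); apply/ltW/(lt_le_trans h).
  have : `|M| < i.+1%:R * (e / 2) by rewrite -ltr_pdivrMr ?divr_gt0// truncnS_gt.
  rewrite -[i.+2]addn1 PoszD opprD -addrA addNr addr0 mulrNz mulNr.
  by move=> hM; have := lerNnormlW (lexx `|M|); lra.
have c_gt (M : R) : exists i : nat, M <= c i%:Z.
  exists (Num.truncn (`|M| / (e / 2))).+1; set i := Num.truncn _.
  have [/andP[h _] _] := Hc i.+1; apply/ltW/(le_lt_trans _ h).
  have : `|M| < i.+1%:R * (e / 2) by rewrite -ltr_pdivrMr ?divr_gt0// truncnS_gt.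
  by move=> /ltW hM; apply: (le_trans (ler_norm _)).
have lo : F (c 0) <= 0.
  apply/ler_addgt0Pl => x x0; rewrite addr0.
  have /cvgrPdist_lt/(_ _ x0)[M [_ HM]] := F0.
  have [i ci] := c_lt (M - 1); rewrite -(Fn i).
  have /HM : c (- i%:Z) < M by lra.
  by rewrite sub0r normrN => /(le_lt_trans (ler_norm _))/ltW.
have hi : 1 <= F (c 0).
  apply/ler_addgt0Pl => x x0.
  have /cvgrPdist_lt/(_ _ x0)[M [_ HM]] := F1.
  have [i ci] := c_gt (M + 1); rewrite -(Fp i).
  have /HM : M < c i%:Z by lra.
  by move=> /(le_lt_trans (ler_norm _)); lra.
lra.
Qed.

End DistributionFunctions.

Section WeakConvergence.
Context (R : realType).

Definition weakly_converges (G : nat -> R -> R) (F : R -> R) :=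
  forall t, {for t, continuous F} -> G n t @[n --> \oo] --> F t.

Context (G : nat -> R -> R) (F : R -> R).
Hypothesis ndG : \forall n \near \oo, {homo G n : x y / x <= y}.
Hypothesis ndF : {homo F : x y / x <= y}.
Hypothesis GF : weakly_converges G F.
Context (I : Type) (f : set_system I) (Ff : Filter f) (n_ : I -> nat) (s_ : I -> R) (s : R).
Hypothesis n_oo : n_ i @[i --> f] --> \oo.
Hypothesis s_s : s_ i @[i --> f] --> s.

(** The argument of [G] moves and [F] may jump at its limit [s], so only a comparison with a
    strictly smaller point holds. A continuity point in between carries the weak convergence. *)
Lemma weakly_converges_ge s' e : s' < s -> 0 < e ->
  \forall i \near f, F s' - e <= G (n_ i) (s_ i).
Proof.
move=> s's e0; have [c /andP[s'c cs] Fc] := nondecreasing_continuity_point ndF s's.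
have /cvgrPdist_lt/(_ _ e0) H1 := GF Fc.
have H2 : \forall i \near f, c < s_ i by exact: cvgr_gt s_s _ cs.
have H3 : \forall i \near f, `|F c - G (n_ i) c| < e by exact: (n_oo H1).
have H4 : \forall i \near f, {homo G (n_ i) : x y / x <= y} by exact: (n_oo ndG).
near=> i; apply: (@le_trans _ _ (G (n_ i) c)); last first.
  have h : {homo G (n_ i) : x y / x <= y} by near: i.
  by apply/h/ltW; near: i.
have : `|F c - G (n_ i) c| < e by near: i.
by move/(le_lt_trans (ler_norm _)); have := ndF (ltW s'c); lra.
Unshelve. all: by end_near. Qed.

Lemma weakly_converges_le s' e : s < s' -> 0 < e ->
  \forall i \near f, G (n_ i) (s_ i) <= F s' + e.
Proof.
move=> s's e0; have [c /andP[s'c cs] Fc] := nondecreasing_continuity_point ndF s's.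
have /cvgrPdist_lt/(_ _ e0) H1 := GF Fc.
have H2 : \forall i \near f, s_ i < c by exact: cvgr_lt s_s _ s'c.
have H3 : \forall i \near f, `|F c - G (n_ i) c| < e by exact: (n_oo H1).
have H4 : \forall i \near f, {homo G (n_ i) : x y / x <= y} by exact: (n_oo ndG).
near=> i; apply: (@le_trans _ _ (G (n_ i) c)).
  have h : {homo G (n_ i) : x y / x <= y} by near: i.
  by apply/h/ltW; near: i.
have : `|F c - G (n_ i) c| < e by near: i.
rewrite distrC => /(le_lt_trans (ler_norm _)); have := ndF (ltW cs); lra.
Unshelve. all: by end_near. Qed.

End WeakConvergence.

Lemma fine_probability_le d (T : measurableType d) (R : realType) (P : probability T R)
    (A B : set T) : measurable A -> measurable B -> A `<=` B -> fine (P A) <= fine (P B).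
Proof.
by move=> mA mB AB; apply: fine_le; rewrite ?fin_num_measure// le_measure ?inE.
Qed.

Section DistributionFunction.
Context (R : realType) d (T : measurableType d) (P : probability T R) (Z : T -> R).
Hypothesis mZ : measurable_fun setT Z.

Definition distribution_function s := fine (P [set z | Z z <= s]).

Lemma measurable_sublevel s : measurable [set z | Z z <= s].
Proof.
rewrite (_ : [set z | Z z <= s] = Z @^-1` [set` `]-oo, s]]); last first.
  by apply/seteqP; split => z; rewrite /= in_itv.
by rewrite -[X in measurable X]setTI; exact: mZ.
Qed.

Lemma distribution_function_homo : {homo distribution_function : x y / x <= y}.
Proof.
move=> x y xy; apply: fine_probability_le; try exact: measurable_sublevel.
by move=> z /= /le_trans; apply.
Qed.

Let ZRV : {RV P >-> R} := mfun_Sub (mem_set mZ).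

Lemma distribution_functionE s : distribution_function s = fine (cdf ZRV s).
Proof.
rewrite /distribution_function /cdf /distribution /pushforward; congr (fine (P _)).
Qed.

Lemma cvg_distribution_functionN : distribution_function x @[x --> -oo] --> (0 : R).
Proof. by rewrite (funext distribution_functionE); exact/fine_cvg/cvg_cdfNy0. Qed.

Lemma cvg_distribution_functiony : distribution_function x @[x --> +oo] --> (1 : R).
Proof. by rewrite (funext distribution_functionE); exact/fine_cvg/cvg_cdfy1. Qed.

Lemma sublevel_distribution_function s :
  P [set z | Z z <= s] = (distribution_function s)%:E.
Proof. by rewrite /distribution_function fineK// fin_num_measure//; exact: measurable_sublevel. Qed.

Lemma continuous_distribution_function t :
  {for t, continuous (fun s : R => P [set z | Z z <= s])} <->
  {for t, continuous distribution_function}.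
Proof.
rewrite /prop_for (funext sublevel_distribution_function); split => [/fine_cvg//|].
by move=> H; apply: cvg_EFin => //; exact: nearW.
Qed.

End DistributionFunction.

Lemma cvg_in_distribution_weakly d d' (T : measurableType d) (T' : measurableType d')
    (R : realType) (P : probability T R) Y (P' : probability T' R) (Z : T' -> R) :
  measurable_fun setT Z -> cvg_in_distribution P Y P' Z ->
  weakly_converges (fun n t => fine (P [set w | (Y n w <= t%:E)%E])) (distribution_function P' Z).
Proof.
move=> mZ H t /(continuous_distribution_function P' mZ) /H.
by rewrite sublevel_distribution_function// => /fine_cvg.
Qed.

Section FirstPassage.
Context (R : realType).

(** Passage times are integers or infinite, hence the truncation of [r]. Since the truncation of a
    negative number is 0, the sign of [r] has to be recorded. *)
Lemma first_passage_le (n : int) (X : path_space) (r : R) :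
  (first_passage R n X <= r%:E)%E <-> 0 <= r /\ hit n (Num.truncn r) X.
Proof.
split => [|[r0 [j jr Xj]]]; last first.
  apply: (@le_trans _ _ (j%:R)%:E); first by apply: ereal_inf_lbound; exists j.
  rewrite lee_fin; apply: (@le_trans _ _ (Num.truncn r)%:R); first by rewrite ler_nat.
  by rewrite truncn_le.
move=> Hr; have [[j jr1 Xj]|H] := pselect (exists2 j, (j%:R <= r) & X j = n).
  have r0 : 0 <= r by apply: le_trans jr1.
  by split => //; exists j => //; rewrite truncn_ge_nat.
exfalso; have {}H j : X j = n -> r < j%:R.
  by move=> Xj; rewrite ltNge; apply/negP => jr; apply: H; exists j.
move: Hr; apply/negP; rewrite -ltNge.
have [[j Xj]|Hn] := pselect (exists j, X j = n); last first.
  rewrite /first_passage (_ : [set k | _] = set0) ?image_set0 ?ereal_inf0 ?ltry//.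
  by rewrite -subset0 => j Xj; apply: Hn; exists j.
have ex : exists j, X j == n by exists j; exact/eqP.
case: (ex_minnP ex) => m /eqP Xm mmin.
apply: (@lt_le_trans _ _ (m%:R)%:E); first by rewrite lte_fin H.
apply: le_ereal_inf_tmp => _ [i /= /eqP Xi <-]; rewrite lee_fin ler_nat; exact: mmin.
Qed.

Lemma normalized_passage_le (n : int) (X : path_space) (c b t : R) : 0 < b ->
  ((first_passage R n X - c%:E) * (b^-1)%:E <= t%:E)%E <->
  (first_passage R n X <= (c + t * b)%:E)%E.
Proof.
move=> b0; rewrite lee_pdivrMr// -EFinM leeBlDr// addeC -EFinD addrC.
by [].
Qed.

Context (PP : probability path_space R).

Lemma measurable_normalized_passage (n : int) (c b t : R) : 0 < b -> measurable
  [set X | ((first_passage R n X - c%:E) * (b^-1)%:E <= t%:E)%E].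
Proof.
move=> b0; have [r0|r0] := lerP 0 (c + t * b).
  rewrite (_ : [set X | _] = hit n (Num.truncn (c + t * b))); first exact: measurable_hit.
  by apply/seteqP; split => X /=; rewrite (normalized_passage_le _ _ _ _ b0) first_passage_le;
    [case|split].
rewrite (_ : [set X | _] = set0)// -subset0 => X /=.
by rewrite (normalized_passage_le _ _ _ _ b0) first_passage_le => -[]; rewrite leNgt r0.
Qed.

Lemma normalized_passage_nat (n : int) (k : nat) (c b : R) : 0 < b ->
  [set X | ((first_passage R n X - c%:E) * (b^-1)%:E <= ((k%:R - c) / b)%:E)%E] = hit n k.
Proof.
move=> b0; apply/seteqP; split => X /=; rewrite (normalized_passage_le _ _ _ _ b0)
  divfK ?gt_eqF// [c + _]addrC subrK first_passage_le natrK.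
  by case.
by split.
Qed.

End FirstPassage.

(** * Inversion of the first passage times *)

(** One-sided bounds at nearby points [t'] suffice at a continuity point of the limit; this is how
    limit laws are proved below. *)
Lemma squeeze_continuity (R : realType) (H : nat -> R) (L : R -> R) (t : R) :
  {for t, continuous L} ->
  (forall t' e, t < t' -> 0 < e -> \forall k \near \oo, H k <= L t' + e) ->
  (forall t' e, t' < t -> 0 < e -> \forall k \near \oo, L t' - e <= H k) ->
  H k @[k --> \oo] --> L t.
Proof.
move=> Lc up lo; apply/cvgrPdist_le => e e0.
have e20 : 0 < e / 2 by rewrite divr_gt0.
have /cvgrPdist_lt/(_ _ e20)/nbhs_ballP[r /= r0 Hr] := Lc.
have rr : 0 < r / 2 < r by rewrite divr_gt0//= ltr_pdivrMr// ltr_pMr// ltr1n.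
have [h1 h2] : `|L t - L (t + r / 2)| < e / 2 /\ `|L t - L (t - r / 2)| < e / 2.
  split; apply: Hr; rewrite /ball/=.
    by rewrite opprD addNKr normrN gtr0_norm; case/andP: rr.
  by rewrite opprB addrC subrK gtr0_norm; case/andP: rr.
near=> k.
have u : H k <= L (t + r / 2) + e / 2 by near: k; apply: up => //; rewrite ltrDl; case/andP: rr.
have l : L (t - r / 2) - e / 2 <= H k.
  by near: k; apply: lo => //; rewrite ltrBlDr ltrDl; case/andP: rr.
move: h1 h2; rewrite !ltr_norml => /andP[h1 h1'] /andP[h2 h2'].
by rewrite ler_norml; apply/andP; split; lra.
Unshelve. all: by end_near. Qed.

Section Inversion.
Context (R : realType) (PP : probability path_space R).
Hypothesis PP_nn : PP nearest_neighbour = 1%E.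
Hypothesis PP_backtrack : forall eps : R, 0 < eps ->
  exists m : nat, forall n k : nat, (PP (backtrack n (n + m)%N k) <= eps%:E)%E.
Context (nu : probability (measurableTypeR R) R) (Z : R -> R).
Hypothesis mZ : measurable_fun setT (Z : measurableTypeR R -> R).
Context (c b : nat -> R).
Hypothesis b0 : \forall n \near \oo, 0 < b n.
Hypothesis T_law : cvg_in_distribution PP
    (fun n X => (first_passage R n%:Z X - (c n)%:E) * ((b n)^-1)%:E)%E nu Z.
Let F := distribution_function nu Z.
Let G n t := fine (PP [set X | ((first_passage R n%:Z X - (c n)%:E) * ((b n)^-1)%:E <= t%:E)%E]).

Let ndF : {homo F : x y / x <= y}.
Proof. exact: distribution_function_homo. Qed.

Lemma passage_df_homo : \forall n \near \oo, {homo G n : x y / x <= y}.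
Proof.
near=> n => x y xy.
have bn0 : 0 < b n by near: n.
apply: fine_probability_le; try exact: measurable_normalized_passage.
by move=> X /= /le_trans; apply; rewrite lee_fin.
Unshelve. all: by end_near. Qed.

Let GF : weakly_converges G F.
Proof. exact: cvg_in_distribution_weakly. Qed.

Section Along.
Context (I : Type) (f : set_system I) {Ff : Filter f} (n_ k_ : I -> nat) (s : R).
Hypothesis n_oo : n_ i @[i --> f] --> \oo.

Lemma passage_le s' e :
  ((k_ i)%:R - c (n_ i)) / b (n_ i) @[i --> f] --> s -> s < s' -> 0 < e ->
  \forall i \near f, fine (PP (hit (n_ i) (k_ i))) <= F s' + e.
Proof.
move=> s_s ss' e0; have := weakly_converges_le passage_df_homo ndF GF Ff n_oo s_s ss' e0.
have : \forall i \near f, 0 < b (n_ i) by exact: (n_oo b0).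
by apply: filterS2 => i bi; rewrite /G normalized_passage_nat.
Qed.

Lemma passage_ge s' e :
  ((k_ i)%:R - c (n_ i)) / b (n_ i) @[i --> f] --> s -> s' < s -> 0 < e ->
  \forall i \near f, F s' - e <= fine (PP (hit (n_ i) (k_ i))).
Proof.
move=> s_s ss' e0; have := weakly_converges_ge passage_df_homo ndF GF Ff n_oo s_s ss' e0.
have : \forall i \near f, 0 < b (n_ i) by exact: (n_oo b0).
by apply: filterS2 => i bi; rewrite /G normalized_passage_nat.
Qed.

End Along.

Lemma measurable_position (n : int) k : measurable [set X : path_space | n <= X k].
Proof.
apply: (@measurable_finite_horizon k) => X Y XY /=.
by rewrite XY.
Qed.

Lemma position_hit (n k : nat) : fine (PP [set X | n%:Z <= X k]) <= fine (PP (hit n k)).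
Proof.
have mp := measurable_position n k.
apply: fine_le; rewrite ?fin_num_measure//; try exact: measurable_hit.
rewrite -(probability_setI1 measurable_nearest_neighbour mp PP_nn).
apply: le_measure; rewrite ?inE; [|exact: measurable_hit|].
  by apply: measurableI => //; exact: measurable_nearest_neighbour.
by move=> X [XN]; exact: nearest_neighbour_hit.
Qed.

Lemma hit_position e : 0 < e ->
  exists m : nat, forall n k : nat, fine (PP (hit (n + m)%N k)) <= fine (PP [set X | n%:Z <= X k]) + e.
Proof.
move=> e0; have [m Hm] := PP_backtrack e0; exists m => n k.
have mp := measurable_position n k.
have mb : measurable (backtrack n (n + m)%N k).
  exact: (measurable_finite_horizon (@finite_horizon_backtrack _ _ _)).
have mh := measurable_hit (n + m)%N k.
rewrite -lee_fin EFinD !fineK ?fin_num_measure//.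
rewrite -(probability_setI1 measurable_nearest_neighbour mh PP_nn).
apply: (@le_trans _ _ (PP ([set X | n%:Z <= X k] `|` backtrack n (n + m)%N k))).
  apply: le_measure; rewrite ?inE.
  - by apply: measurableI => //; exact: measurable_nearest_neighbour.
  - exact: measurableU.
  exact: hit_subset_backtrack.
by apply: le_trans (probability_setU_le _ _ _) _ => //; exact: leeD2l.
Qed.

Context (c' b' : nat -> R).
Let H k t := fine (PP [set X : path_space | ((X k)%:~R - c' k) / b' k <= t]).

(** For an integer position, exceeding [r] means being at least its floor plus 1. Truncation is the
    floor only for nonnegative [r]. *)
Lemma normalized_position k t : 0 < b' k -> 0 <= c' k + t * b' k ->
  [set X : path_space | ((X k)%:~R - c' k) / b' k <= t] =
  ~` [set X | ((Num.truncn (c' k + t * b' k)).+1)%:Z <= X k].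
Proof.
move=> bk r0; set r := c' k + t * b' k.
have E (X : path_space) : (((X k)%:~R - c' k) / b' k <= t) = ((X k)%:~R <= r).
  by rewrite ler_pdivrMr// lerBlDl.
have tr := truncn_itv r0; move/andP: tr => [tr1 tr2].
apply/seteqP; split => X /=; rewrite E => Xr.
  apply/negP; rewrite -ltNge ltNge; apply/negP => nX.
  have : (Num.truncn r).+1%:R <= (X k)%:~R :> R.
    by rewrite -[leLHS]/((Num.truncn r).+1%:Z%:~R) ler_int.
  by move=> /(lt_le_trans tr2)/lt_le_trans/(_ Xr); rewrite ltxx.
apply: le_trans tr1; move/negP: Xr; rewrite -ltNge => Xr.
by rewrite -[leRHS]/((Num.truncn r)%:Z%:~R) ler_int; lia.
Qed.

Section AtPoint.
Context (t s : R).
Let r k := c' k + t * b' k.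
Let N k := (Num.truncn (r k)).+1.
Hypothesis b'0 : \forall k \near \oo, 0 < b' k.
Hypothesis r_oo : r k @[k --> \oo] --> +oo.
Hypothesis r_s : forall m : nat,
  (k%:R - c (N k + m)%N) / b (N k + m)%N @[k --> \oo] --> s.

Let HE : \forall k \near \oo, H k t = 1 - fine (PP [set X : path_space | (N k)%:Z <= X k]).
Proof.
near=> k.
have bk : 0 < b' k by near: k.
have rk : 0 <= r k by near: k; move/cvgryPge : r_oo; exact.
have mp := measurable_position (N k)%:Z k.
by rewrite /H normalized_position// probability_setC// fineB// fin_num_measure.
Unshelve. all: by end_near. Qed.

Let N_oo m : (N k + m)%N @[k --> \oo] --> \oo.
Proof.
apply/cvgnyPge => A; have /cvgryPge/(_ A%:R) := r_oo.
apply: filterS => k Ar; apply: leq_trans (leq_addr _ _).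
by rewrite /N ltnW// ltnS truncn_ge_nat// (le_trans _ Ar).
Qed.

(** Being at or above level [N k] at time [k] requires having hit it, so no backtracking term arises
    and [r_s] is used with shift 0. *)
Lemma position_df_ge s' e : s < s' -> 0 < e -> \forall k \near \oo, 1 - F s' - e <= H k t.
Proof.
move=> ss' e0.
have r0 : (k%:R - c (N k)) / b (N k) @[k --> \oo] --> s.
  by have := r_s 0%N; under eq_fun do rewrite addn0.
have N0 : N k @[k --> \oo] --> \oo by have := N_oo 0%N; under eq_fun do rewrite addn0.
have h : \forall k \near \oo, fine (PP (hit (N k) k)) <= F s' + e.
  exact: (@passage_le nat \oo _ N id s N0 s' e r0 ss' e0).
near=> k; have -> : H k t = 1 - fine (PP [set X : path_space | (N k)%:Z <= X k]) by near: k.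
have : fine (PP (hit (N k) k)) <= F s' + e by near: k.
by have := position_hit (N k) k; lra.
Unshelve. all: by end_near. Qed.

(** Here the level must be raised by a fixed [m] that makes backtracking improbable, which is why
    [r_s] allows an arbitrary constant shift of the level. *)
Lemma position_df_le s' e : s' < s -> 0 < e -> \forall k \near \oo, H k t <= 1 - F s' + e.
Proof.
move=> ss' e0; have e20 : 0 < e / 2 by rewrite divr_gt0.
have [m Hm] := hit_position e20.
have h : \forall k \near \oo, F s' - e / 2 <= fine (PP (hit (N k + m)%N k)).
  exact: (@passage_ge nat \oo _ (fun k => N k + m)%N id s (N_oo m) s' _ (r_s m) ss' e20).
near=> k; have -> : H k t = 1 - fine (PP [set X : path_space | (N k)%:Z <= X k]) by near: k.
have : F s' - e / 2 <= fine (PP (hit (N k + m)%N k)) by near: k.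
by have := Hm (N k) k; lra.
Unshelve. all: by end_near. Qed.

End AtPoint.

Lemma measurable_normalized_position k t :
  measurable [set X : path_space | ((X k)%:~R - c' k) / b' k <= t].
Proof. by apply: (@measurable_finite_horizon k) => X Y XY /=; rewrite XY. Qed.

Lemma normalized_position_df_homo k : {homo H k : x y / x <= y}.
Proof.
move=> x y xy; apply: fine_probability_le; try exact: measurable_normalized_position.
by move=> X /= /le_trans; apply.
Qed.

End Inversion.

(** * Regularly varying norming, 1 < alpha <= 2 *)

Section PowerAsymptotics.
Context (R : realType) (I : Type) (F : set_system I) {FF : Filter F}.
Implicit Types f : I -> R.

Lemma cvgr_ln f (l : R) : 0 < l -> f i @[i --> F] --> l -> ln (f i) @[i --> F] --> ln l.
Proof. by move=> l0 fl; apply: (cvg_comp _ _ fl); exact: continuous_ln. Qed.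

Lemma cvgr_powR f (l p : R) : 0 < l -> f i @[i --> F] --> l -> f i `^ p @[i --> F] --> l `^ p.
Proof.
move=> l0 fl; rewrite {2}/powR gt_eqF//.
have H : expR (p * ln (f i)) @[i --> F] --> expR (p * ln l).
  apply: (@cvg_comp _ _ _ (fun i => p * ln (f i)) expR F (nbhs (p * ln l))).
    by apply: cvgMr; exact: cvgr_ln.
  exact: continuous_expR.
apply: cvg_trans H; apply: near_eq_cvg.
have : \forall i \near F, 0 < f i by exact: cvgr_gt fl _ l0.
by apply: filterS => i fi; rewrite /powR gt_eqF.
Qed.

Lemma cvgry_powR f p : 0 < p -> f i @[i --> F] --> +oo -> f i `^ p @[i --> F] --> +oo.
Proof.
move=> p0 /cvgryPge foo; apply/cvgryPge => M.
have := foo (`|M| `^ p^-1); apply: filterS => i fi.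
apply: le_trans (ler_norm M) _.
rewrite -[leLHS]powRr1// -(mulVf (lt0r_neq0 p0)) powRrM.
apply: ge0_ler_powR => //; rewrite ?nnegrE ?powR_ge0//; first exact: ltW.
by apply: le_trans fi; exact: powR_ge0.
Qed.

Lemma cvgr0_powR f p : 0 < p -> (\forall i \near F, 0 <= f i) ->
  f i @[i --> F] --> 0 -> f i `^ p @[i --> F] --> 0.
Proof.
move=> p0 f0 /cvgrPdist_le fl; apply/cvgrPdist_le => e e0.
have := fl _ (powR_gt0 p^-1 e0); apply: filterS2 f0 => i fi.
rewrite !sub0r !normrN (ger0_norm fi) (ger0_norm (powR_ge0 _ _)) => h.
rewrite -[leRHS](powRr1 (ltW e0)) -(mulVf (lt0r_neq0 p0)) powRrM.
by apply: ge0_ler_powR => //; rewrite ?nnegrE ?powR_ge0//; exact: ltW.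
Qed.

Lemma cvgry_ln f : f i @[i --> F] --> +oo -> ln (f i) @[i --> F] --> +oo.
Proof.
move=> /cvgryPge foo; apply/cvgryPge => M; have := foo (expR M); apply: filterS => i fi.
by rewrite -[leLHS]expRK ler_ln ?posrE ?expR_gt0// (lt_le_trans (expR_gt0 M)).
Qed.

Lemma cvgr_inv0 f : f i @[i --> F] --> +oo -> (f i)^-1 @[i --> F] --> 0.
Proof.
move=> /cvgryPge foo; apply/cvgrPdist_le => e e0; have := foo e^-1; apply: filterS => i fi.
have f0 : 0 < f i by apply: lt_le_trans fi; rewrite invr_gt0.
by rewrite sub0r normrN gtr0_norm ?invr_gt0// -[leRHS]invrK lef_pV2// posrE invr_gt0.
Qed.

Lemma cvgr_ln_ratio0 f : f i @[i --> F] --> +oo -> ln (f i) / f i @[i --> F] --> 0.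
Proof.
move=> foo; have H : 2 * (f i `^ 2^-1)^-1 @[i --> F] --> 0.
  by rewrite -(mulr0 (2 : R)); apply: cvgMr; apply: cvgr_inv0; exact: cvgry_powR.
have H0 : (fun=> 0 : R) i @[i --> F] --> (0 : R) by exact: cvg_cst.
apply: squeeze_cvgr H0 H; move/cvgryPge/(_ 1) : foo; apply: filterS => i n1.
have n0 : 0 < f i by exact: lt_le_trans n1.
rewrite divr_ge0 ?ln_ge0 ?(ltW n0)//= ler_pdivrMr//.
(* The square root trick: ln f = 2 ln (sqrt f), which is below 2 sqrt f. *)
have E : f i = f i `^ 2^-1 * f i `^ 2^-1.
  by rewrite powR12_sqrt ?(ltW n0)// -expr2 sqr_sqrtr// ltW.
have q0 : 0 < f i `^ 2^-1 by exact: powR_gt0.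
rewrite [X in _ * X]E mulrA mulfVK ?gt_eqF//.
have -> : ln (f i) = 2 * ln (f i `^ 2^-1).
  by rewrite ln_powR mulrA divff ?mul1r.
by rewrite ler_pM2l// ltW// ln_sublinear.
Qed.

Lemma cvgr_ln_ratio1 f g (l : R) : 0 < l -> g i @[i --> F] --> +oo ->
  f i / g i @[i --> F] --> l -> ln (f i) / ln (g i) @[i --> F] --> (1 : R).
Proof.
move=> l0 goo fg.
have H : ln (f i / g i) / ln (g i) + 1 @[i --> F] --> ln l * 0 + (1 : R).
  apply: cvgD; last exact: cvg_cst.
  by apply: cvgM; [exact: cvgr_ln|apply: cvgr_inv0; exact: cvgry_ln].
rewrite mulr0 add0r in H; apply: cvg_trans H; apply: near_eq_cvg.
have h : \forall i \near F, 0 < f i / g i by exact: cvgr_gt fg _ l0.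
move/cvgryPgt/(_ 1) : goo; apply: filterS2 h => i fgi g1.
have g0 : 0 < g i by exact: lt_trans g1.
have f0 : 0 < f i by move: fgi; rewrite pmulr_lgt0// invr_gt0.
have lg0 := ln_gt0 g1.
by rewrite ln_div ?posrE// mulrBl divff ?gt_eqF// subrK.
Qed.

End PowerAsymptotics.

Section NaturalSequences.
Context (R : realType).

Context (n_ : nat -> nat) (l : R).
Hypothesis l0 : 0 < l.
Hypothesis n_l : (n_ k)%:R / k%:R @[k --> \oo] --> l.

Lemma natr_ratio_oo : (n_ k)%:R @[k --> \oo] --> (+oo : set_system R).
Proof.
have h : \forall k \near \oo, l / 2 < (n_ k)%:R / k%:R.
  by apply: cvgr_gt n_l _ _; rewrite ltr_pdivrMr// ltr_pMr// ltr1n.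
apply/cvgryPge => M; near=> k.
have k0 : 0 < k%:R :> R by rewrite ltr0n; near: k; exact: nbhs_infty_gt.
have : l / 2 < (n_ k)%:R / k%:R by near: k.
rewrite ltr_pdivlMr// => /ltW; apply: le_trans.
by rewrite -ler_pdivrMl ?divr_gt0//; near: k; exact: nbhs_infty_ger.
Unshelve. all: by end_near. Qed.

Lemma nat_ratio_oo : n_ k @[k --> \oo] --> \oo.
Proof.
apply/cvgnyPge => A; have /cvgryPge/(_ A%:R) := natr_ratio_oo.
by apply: filterS => k; rewrite ler_nat.
Qed.

End NaturalSequences.

(** * Limit laws for the position that are reflections of those for the passage times *)

Section Reflection.
Context (R : realType) (PP : probability path_space R).
Hypothesis PP_nn : PP nearest_neighbour = 1%E.
Hypothesis PP_backtrack : forall eps : R, 0 < eps ->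
  exists m : nat, forall n k : nat, (PP (backtrack n (n + m)%N k) <= eps%:E)%E.
Context (nu : probability (measurableTypeR R) R) (Z : R -> R).
Hypothesis mZ : measurable_fun setT (Z : measurableTypeR R -> R).
Context (c b : nat -> R).
Hypothesis b0 : \forall n \near \oo, 0 < b n.
Hypothesis T_law : cvg_in_distribution PP
    (fun n X => (first_passage R n%:Z X - (c n)%:E) * ((b n)^-1)%:E)%E nu Z.
Context (c' b' : nat -> R).
Hypothesis b'0 : \forall k \near \oo, 0 < b' k.

Lemma cvg_in_distribution_df (H : nat -> path_space -> R) (Z' : R -> R) :
  measurable_fun setT (Z' : measurableTypeR R -> R) ->
  (forall k t, measurable [set X | H k X <= t]) ->
  (forall t, {for t, continuous (distribution_function nu Z')} ->
    fine (PP [set X | H k X <= t]) @[k --> \oo] --> distribution_function nu Z' t) ->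
  cvg_in_distribution PP (fun k X => (H k X)%:E) nu Z'.
Proof.
move=> mZ' mH HH t /(continuous_distribution_function nu mZ')/HH h.
rewrite sublevel_distribution_function//; apply: cvg_EFin.
  by apply: nearW => k; apply: fin_num_measure; exact: mH.
exact: h.
Qed.

(** If the normalized passage argument tends to [- t], the distribution function of the position
    tends to 1 - F(-t). At a continuity point this is the distribution function of [- Z]. *)
Lemma position_cvg_reflected :
  (forall t, c' k + t * b' k @[k --> \oo] --> +oo) ->
  (forall (t : R) (m : nat), let n k := ((Num.truncn (c' k + t * b' k)).+1 + m)%N in
    (k%:R - c (n k)) / b (n k) @[k --> \oo] --> - t) ->
  cvg_in_distribution PP (fun k (X : path_space) => (((X k)%:~R - c' k) / b' k)%:E)
    nu (fun s => - Z s).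
Proof.
move=> r_oo r_s; have mZ' : measurable_fun setT ((fun s => - Z s) : measurableTypeR R -> R).
  exact: measurableT_comp.
apply: (@cvg_in_distribution_df (fun k X => ((X k)%:~R - c' k) / b' k)) => //.
  by move=> k t; exact: measurable_normalized_position.
move=> t Lc; apply: squeeze_continuity => // t' e tt' e0.
  have tt'' : - t' < - t by rewrite ltrN2.
  have := position_df_le PP_nn PP_backtrack mZ b0 T_law b'0 (r_oo t) (r_s t) tt'' e0.
  apply: filterS => k /le_trans; apply; rewrite lerD2r lerBlDr.
  rewrite /distribution_function -fineD ?fin_num_measure//; try exact: measurable_sublevel.
  rewrite -lee_fin fineK; last by rewrite fin_numD !fin_num_measure//; exact: measurable_sublevel.
  rewrite -[1%:E](@probability_setT _ _ _ nu).
  apply: le_trans (probability_setU_le _ _ _); try exact: measurable_sublevel.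
  apply: le_measure; rewrite ?inE//; first by apply: measurableU; exact: measurable_sublevel.
  by move=> z _ /=; have [zt|zt] := leP (Z z) (- t'); [right|left; rewrite lerNl ltW].
(* A midpoint, so that the events Z <= s' and - Z <= t' are disjoint even if [Z] has an atom at
   [- t']. *)
pose s' := - ((t + t') / 2).
have ss' : - t < s' by rewrite ltrN2 ltr_pdivrMr//; lra.
have := position_df_ge PP_nn mZ b0 T_law b'0 (r_oo t) (r_s t) ss' e0.
apply: filterS => k; apply: le_trans; rewrite lerD2r lerBrDr.
rewrite /distribution_function -fineD ?fin_num_measure//; try exact: measurable_sublevel.
rewrite -lee_fin fineK; last by rewrite fin_numD !fin_num_measure//; exact: measurable_sublevel.
rewrite -measureU; try exact: measurable_sublevel.
  by apply: probability_le1; apply: measurableU; exact: measurable_sublevel.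
rewrite -subset0 => z [/=]; rewrite lerNl /s' => h1 h2.
by have := le_trans h1 h2; rewrite lerN2 ler_pdivrMr//; lra.
Qed.

End Reflection.

Section LinearCentering.
Context (R : realType) (A B kappa : R) (D : nat -> R).
Hypotheses (A0 : 0 < A) (B0 : 0 < B) (kappa0 : 0 < kappa).
Hypothesis D0 : \forall k \near \oo, 0 < D k.
Hypothesis D_oo : D k @[k --> \oo] --> +oo.
Hypothesis D_lin : D k / k%:R @[k --> \oo] --> 0.
Hypothesis D_reg : forall n_ : nat -> nat, (n_ k)%:R / k%:R @[k --> \oo] --> A^-1 ->
  D (n_ k) / D k @[k --> \oo] --> kappa.
Context (t : R).
(** Solving k = A n + s B D(n) to first order gives n = k/A - s B D(n)/A. With [n] of order k/A,
    [D n] is about [kappa * D k]; this produces the norming, with t = - s. *)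
Let r k := A^-1 * k%:R + t * (A^-1 * kappa * B * D k).

Let r_ratio : r k / k%:R @[k --> \oo] --> A^-1.
Proof.
have H : A^-1 + t * (A^-1 * kappa * B) * (D k / k%:R) @[k --> \oo] -->
    A^-1 + t * (A^-1 * kappa * B) * 0.
  by apply: cvgD; [exact: cvg_cst|exact: cvgMr].
rewrite mulr0 addr0 in H; apply: cvg_trans H; apply: near_eq_cvg; near=> k.
have k0 : k%:R != 0 :> R by rewrite pnatr_eq0 -lt0n; near: k; exact: nbhs_infty_gt.
by rewrite /r; field; rewrite k0 lt0r_neq0.
Unshelve. all: by end_near. Qed.

Lemma linear_centering_oo : r k @[k --> \oo] --> +oo.
Proof.
have A2 : 0 < A^-1 / 2 by rewrite divr_gt0 ?invr_gt0.
have h : \forall k \near \oo, A^-1 / 2 < r k / k%:R.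
  by apply: cvgr_gt r_ratio _ _; rewrite ltr_pdivrMr// ltr_pMr ?invr_gt0// ltr1n.
apply/cvgryPge => M; near=> k.
have k0 : 0 < k%:R :> R by rewrite ltr0n; near: k; exact: nbhs_infty_gt.
have : A^-1 / 2 < r k / k%:R by near: k.
rewrite ltr_pdivlMr// => /ltW; apply: le_trans.
by rewrite -ler_pdivrMl//; near: k; exact: nbhs_infty_ger.
Unshelve. all: by end_near. Qed.

Lemma linear_centering_cvg (m : nat) : let n k := ((Num.truncn (r k)).+1 + m)%N in
  (k%:R - A * (n k)%:R) / (B * D (n k)) @[k --> \oo] --> - t.
Proof.
move=> n; have nr : \forall k \near \oo, 0 <= (n k)%:R - r k <= m.+1%:R.
  near=> k; have rk : 0 <= r k by near: k; move/cvgryPge : linear_centering_oo; exact.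
  have /andP[h1 h2] := truncn_itv rk.
  by rewrite /n natrD -(natr1 (Num.truncn _)) -(natr1 m); move: h1 h2; rewrite -natr1; have := ler0n R m; lra.
have bounded (d : nat -> R) : d k @[k --> \oo] --> +oo ->
    ((n k)%:R - r k) / d k @[k --> \oo] --> 0.
  move=> d_oo; have H : m.+1%:R * (d k)^-1 @[k --> \oo] --> 0.
    by rewrite -(mulr0 m.+1%:R); apply: cvgMr; exact: cvgr_inv0.
  apply: squeeze_cvgr (cvg_cst 0) H; near=> k.
  have /andP[h1 h2] : 0 <= (n k)%:R - r k <= m.+1%:R by near: k.
  have dk : 0 < d k by near: k; move/cvgryPgt : d_oo; exact.
  by rewrite divr_ge0 ?(ltW dk)//= ler_pM2r ?invr_gt0.
have n_ratio : (n k)%:R / k%:R @[k --> \oo] --> A^-1.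
  have H : ((n k)%:R - r k) / k%:R + r k / k%:R @[k --> \oo] --> 0 + A^-1.
    by apply: cvgD => //; apply: bounded; exact: cvgr_idn.
  by rewrite add0r in H; apply: cvg_trans H; apply: near_eq_cvg; apply: nearW => k;
    rewrite -mulrDl subrK.
have Dn := D_reg n_ratio; have Ai : 0 < A^-1 by rewrite invr_gt0.
have D0n : \forall k \near \oo, 0 < D (n k) by exact: (nat_ratio_oo Ai n_ratio) D0.
(* Decomposition of k - A n into - A (n - r k), a bounded rounding error, and - t kappa B D(k), both
   divided by B D(n). *)
have H : - (A / B) * (((n k)%:R - r k) / D k) * (D (n k) / D k)^-1 - t * kappa * (D (n k) / D k)^-1
    @[k --> \oo] --> - (A / B) * 0 * kappa^-1 - t * kappa * kappa^-1.
  apply: cvgB; last by apply: cvgMr; apply: cvgV => //; exact: lt0r_neq0.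
  apply: cvgM; last by apply: cvgV => //; exact: lt0r_neq0.
  by apply: cvgMr; exact: bounded.
rewrite mulr0 mul0r sub0r mulfK ?lt0r_neq0// in H.
apply: cvg_trans H; apply: near_eq_cvg; near=> k.
have Dk0 : D k != 0 by apply: lt0r_neq0; near: k.
have Dnk0 : D (n k) != 0 by apply: lt0r_neq0; near: k.
have := lt0r_neq0 A0; have := lt0r_neq0 B0.
by rewrite /r => hA hB; field; rewrite Dk0 Dnk0 hA hB.
Unshelve. all: by end_near. Qed.

End LinearCentering.

Section RegularVariation.
Context (R : realType) (A : R) (A0 : 0 < A).

(** For p = 1/alpha the constant [kappa] is A^(-1/alpha); with the factor 1/A it gives the power
    A^(-(1 + 1/alpha)) of the norming. *)
Lemma powR_regular (p : R) (n_ : nat -> nat) : (n_ k)%:R / k%:R @[k --> \oo] --> A^-1 ->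
  (n_ k)%:R `^ p / k%:R `^ p @[k --> \oo] --> A `^ (- p).
Proof.
have Ai : 0 < A^-1 by rewrite invr_gt0.
move=> nA; rewrite powRN -powR_inv1 ?powR_ge0// -powRrM mulrN1.
rewrite (_ : A `^ (- p) = A^-1 `^ p); last first.
  by rewrite -(powR_inv1 (ltW A0)) -powRrM mulN1r.
have H : ((n_ k)%:R / k%:R) `^ p @[k --> \oo] --> A^-1 `^ p by exact: cvgr_powR.
apply: cvg_trans H; apply: near_eq_cvg; near=> k.
by rewrite powRM// ?invr_ge0// -(powR_inv1 (ler0n R k)) -powRrM mulN1r powRN.
Unshelve. all: by end_near. Qed.

Lemma powR_sublinear (p : R) : p < 1 -> k%:R `^ p / k%:R @[k --> \oo] --> (0 : R).
Proof.
move=> p1; have H : (k%:R `^ (1 - p) : R)^-1 @[k --> \oo] --> 0.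
  by apply: cvgr_inv0; apply: cvgry_powR; [rewrite subr_gt0|exact: cvgr_idn].
apply: cvg_trans H; apply: near_eq_cvg; near=> k.
have k0 : 0 < k%:R :> R by rewrite ltr0n; near: k; exact: nbhs_infty_gt.
rewrite powRB; last by rewrite gt_eqF// implybT.
by rewrite powRr1 ?(ltW k0)// invf_div.
Unshelve. all: by end_near. Qed.

(** The logarithm varies slowly, so only the square root matters: [kappa] is A^(-1/2), and A^(-3/2)
    results. *)
Lemma xlogx_regular (n_ : nat -> nat) : (n_ k)%:R / k%:R @[k --> \oo] --> A^-1 ->
  ((n_ k)%:R * ln (n_ k)%:R) `^ 2^-1 / (k%:R * ln k%:R) `^ 2^-1 @[k --> \oo] --> A `^ (- 2^-1).
Proof.
have Ai : 0 < A^-1 by rewrite invr_gt0.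
move=> nA; rewrite (_ : A `^ (- _) = (A^-1 * 1) `^ 2^-1); last first.
  by rewrite mulr1 -(powR_inv1 (ltW A0)) -powRrM mulN1r.
have H : ((n_ k)%:R / k%:R) * (ln (n_ k)%:R / ln k%:R) @[k --> \oo] --> A^-1 * 1.
  by apply: cvgM => //; apply: cvgr_ln_ratio1 Ai _ nA; exact: cvgr_idn.
rewrite mulr1 in H *; have H' : (((n_ k)%:R / k%:R) * (ln (n_ k)%:R / ln k%:R)) `^ 2^-1 @[k --> \oo] --> A^-1 `^ 2^-1.
  exact: cvgr_powR.
apply: cvg_trans H'; apply: near_eq_cvg; near=> k.
have k1 : 1 <= k%:R :> R by rewrite ler1n; near: k; exact: nbhs_infty_gt.
have n0 : 1 <= (n_ k)%:R :> R by near: k; move/cvgryPge : (natr_ratio_oo Ai nA); exact.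
have kl0 : 0 <= k%:R * ln k%:R :> R by rewrite mulr_ge0 ?ln_ge0.
rewrite mulf_div [LHS]powRM ?invr_ge0 ?mulr_ge0 ?ln_ge0//.
by rewrite -(powR_inv1 kl0) -powRrM mulN1r powRN.
Unshelve. all: by end_near. Qed.

Lemma xlogx_sublinear : (k%:R * ln k%:R) `^ 2^-1 / k%:R @[k --> \oo] --> (0 : R).
Proof.
have H0 : \forall k \near \oo, 0 <= ln k%:R / k%:R :> R.
  near=> k; rewrite divr_ge0// ln_ge0// ler1n; near: k; exact: nbhs_infty_gt.
have h0 : 0 < 2^-1 :> R by [].
have H : (ln k%:R / k%:R) `^ 2^-1 @[k --> \oo] --> (0 : R).
  exact: cvgr0_powR (cvgr_ln_ratio0 (@cvgr_idn R)).
apply: cvg_trans H; apply: near_eq_cvg; near=> k.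
have k1 : 1 <= k%:R :> R by rewrite ler1n; near: k; exact: nbhs_infty_gt.
have k0 : 0 < k%:R :> R by apply: lt_le_trans k1.
have l0 := ln_ge0 k1.
rewrite !powRM ?invr_ge0//.
rewrite -(powR_inv1 (ltW k0)) -powRrM mulN1r.
have E : (k%:R : R) `^ (-1) = k%:R `^ (- 2^-1) * k%:R `^ (- 2^-1).
  by rewrite -powRD; [congr (_ `^ _); lra|apply/implyP => _; rewrite gt_eqF].
rewrite E powRN; have := powR_gt0 2^-1 k0; set q := _ `^ 2^-1 => q0.
by field; rewrite gt_eqF.
Unshelve. all: by end_near. Qed.

Lemma xlogx_oo : (k%:R * ln k%:R) `^ 2^-1 @[k --> \oo] --> (+oo : set_system R).
Proof.
apply: cvgry_powR => //; apply/cvgryPge => M.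
have /cvgryPge ln_oo : ln k%:R @[k --> \oo] --> (+oo : set_system R).
  by apply: cvgry_ln; exact: cvgr_idn.
 near=> k.
have k1 : 1 <= k%:R :> R by rewrite ler1n; near: k; exact: nbhs_infty_gt.
have : 1 <= ln k%:R :> R.
  by near: k; exact: ln_oo.
move=> l1; apply: (@le_trans _ _ k%:R); last by rewrite ler_peMr.
by near: k; exact: nbhs_infty_ger.
Unshelve. all: by end_near. Qed.

End RegularVariation.

(** The general argument yields the reflected law; symmetry of the normal density removes the
    reflection. *)
Lemma normal_prob_opp (R : realType) (t : R) :
  normal_prob (0 : R) 1 [set z | - z <= t] = normal_prob (0 : R) 1 [set z | z <= t].
Proof.
have n0 : (1 : R) != 0 by exact: oner_neq0.
rewrite /normal_prob.
rewrite (_ : [set z | z <= t] = [set` `]-oo, - - t]]); last first.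
  by apply/seteqP; split => z; rewrite opprK /= in_itv.
rewrite (_ : [set z | - z <= t] = [set` `[- t, +oo[]); last first.
  by apply/seteqP; split => z; rewrite /= in_itv/= andbT lerNl.
rewrite ge0_integration_by_substitutionNy.
- apply: eq_integral => x _; congr (_%:E).
  by rewrite /normal_pdf /= (negbTE n0) /normal_fun !subr0 sqrrN.
- by apply: continuous_subspaceT => x; exact: continuous_normal_pdf.
- by move=> x _; exact: normal_pdf_ge0.
Qed.

Section StableCases.
Context (R : realType) (PP : probability path_space R).
Hypothesis PP_nn : PP nearest_neighbour = 1%E.
Hypothesis PP_backtrack : forall eps : R, 0 < eps ->
  exists m : nat, forall n k : nat, (PP (backtrack n (n + m)%N k) <= eps%:E)%E.
Context (alpha A B : R).
Hypotheses (A0 : 0 < A) (B0 : 0 < B).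

Lemma position_cvg_linear (nu : probability (measurableTypeR R) R) (D : nat -> R) (kappa : R) :
  0 < kappa ->
  (\forall k \near \oo, 0 < D k) ->
  D k @[k --> \oo] --> +oo ->
  D k / k%:R @[k --> \oo] --> 0 ->
  (forall n_ : nat -> nat, (n_ k)%:R / k%:R @[k --> \oo] --> A^-1 ->
     D (n_ k) / D k @[k --> \oo] --> kappa) ->
  cvg_in_distribution PP
    (fun n X => (first_passage R n%:Z X - (A * n%:R)%:E) * ((B * D n)^-1)%:E)%E nu (fun s => s) ->
  cvg_in_distribution PP
    (fun k (X : path_space) => (((X k)%:~R - A^-1 * k%:R) / (A^-1 * kappa * B * D k))%:E)
    nu (fun s => - s).
Proof.
move=> k0 D0 D_oo D_lin D_reg T_law.
apply: (@position_cvg_reflected _ _ PP_nn PP_backtrack nu (fun s => s) _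
    (fun n => A * n%:R) (fun n => B * D n) _ T_law (fun k => A^-1 * k%:R)
    (fun k => A^-1 * kappa * B * D k)) => //.
- by move: D0; apply: filterS => k Dk; rewrite mulr_gt0.
- by move: D0; apply: filterS => k Dk; rewrite !mulr_gt0 ?invr_gt0.
- by move=> t; exact: linear_centering_oo.
- by move=> t m n; exact: linear_centering_cvg.
Qed.

Lemma position_cvg_stable (nu : probability (measurableTypeR R) R) : 1 < alpha < 2 ->
  cvg_in_distribution PP
    (fun n X => (first_passage R n%:Z X - (A * n%:R)%:E) * ((B * n%:R `^ alpha^-1)^-1)%:E)%E
    nu (fun s => s) ->
  cvg_in_distribution PP
    (fun k (X : path_space) => (((X k)%:~R - A^-1 * k%:R) /
       (A `^ (- (1 + alpha^-1)) * B * k%:R `^ alpha^-1))%:E) nu (fun s => - s).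
Proof.
move=> /andP[a1 _] T_law; have a0 : 0 < alpha by apply: lt_trans a1.
have ai0 : 0 < alpha^-1 by rewrite invr_gt0.
have -> : A `^ (- (1 + alpha^-1)) = A^-1 * A `^ (- alpha^-1).
  rewrite opprD powRD ?powR_inv1 ?ltW//.
  by apply/implyP => _; rewrite gt_eqF.
apply: position_cvg_linear => //.
- by rewrite powR_gt0.
- near=> k; rewrite powR_gt0// ltr0n; near: k; exact: nbhs_infty_gt.
- by apply: cvgry_powR => //; exact: cvgr_idn.
- by apply: powR_sublinear; rewrite invf_lt1.
- by move=> n_; exact: powR_regular.
Unshelve. all: by end_near. Qed.

Lemma position_cvg_normal :
  cvg_in_distribution PP
    (fun n X => (first_passage R n%:Z X - (A * n%:R)%:E) *
                ((B * (n%:R * ln n%:R) `^ 2^-1)^-1)%:E)%E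
    (normal_prob (0 : R) 1) (fun s => s) ->
  cvg_in_distribution PP
    (fun k (X : path_space) => (((X k)%:~R - A^-1 * k%:R) /
       (A `^ (- (3 / 2)) * B * (k%:R * ln k%:R) `^ 2^-1))%:E) (normal_prob (0 : R) 1) (fun s => s).
Proof.
move=> T_law.
have -> : A `^ (- (3 / 2)) = A^-1 * A `^ (- 2^-1).
  rewrite -(powR_inv1 (ltW A0)) -powRD; first by congr (_ `^ _); lra.
  by apply/implyP => _; rewrite gt_eqF.
have D0 : \forall k \near \oo, 0 < (k%:R * ln k%:R) `^ 2^-1 :> R.
  near=> k; rewrite powR_gt0// mulr_gt0 ?ltr0n ?ln_gt0 ?ltr1n//; near: k; exact: nbhs_infty_gt.
have H := position_cvg_linear (powR_gt0 _ A0) D0 (@xlogx_oo R) (@xlogx_sublinear R)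
  (@xlogx_regular R A A0) T_law.
have E : (fun s : R => normal_prob (0 : R) 1 [set z | z <= s]) =
    (fun s : R => normal_prob (0 : R) 1 [set z | - z <= s]).
  by apply/funext => s; rewrite normal_prob_opp.
by move=> t /= tc; have := H t; rewrite /= -E normal_prob_opp; exact.
Unshelve. all: by end_near. Qed.

End StableCases.

(** * The case alpha < 1 *)

Section GammaFinite.
Context (R : realType) (alpha : R) (alpha01 : 0 < alpha < 1).
Let mu := @lebesgue_measure R.
Local Open Scope ereal_scope.

Lemma integral_powRN_itv (e : R) : (0 < e < 1)%R ->
  \int[mu]_(x in `[e, 1%R]) (x `^ (- alpha))%:E <= ((1 - alpha)^-1)%:E.
Proof.
move=> /andP[e0 e1]; have /andP[a0 a1] := alpha01.
have a1' : (0 < 1 - alpha)%R by rewrite subr_gt0.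
pose F (x : R) := ((1 - alpha)^-1 * x `^ (1 - alpha))%R.
have dF (x : R) : (0 < x)%R -> is_derive x 1%R F (x `^ (- alpha))%R.
  move=> x0; have := is_derive1_powR (1 - alpha)%R x0 => h.
  have h' : is_derive x 1%R F ((1 - alpha)^-1 *: ((1 - alpha) * x `^ (1 - alpha - 1)) : R)%R.
    exact: is_deriveZ.
  rewrite (_ : (x `^ (- alpha) = (1 - alpha)^-1 *: ((1 - alpha) * x `^ (1 - alpha - 1)) :> R)%R)//.
  by rewrite /GRing.scale/= mulrA mulVf ?gt_eqF// mul1r; congr (_ `^ _)%R; lra.
have cF (x : R) : (0 < x)%R -> {for x, continuous F}.
  by move=> x0; apply: differentiable_continuous; apply/derivable1_diffP; case: (dF _ x0).
have cf : {within `[e, 1%R], continuous (fun x => x `^ (- alpha))%R}.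
  apply: continuous_in_subspaceT => x; rewrite inE/= in_itv/= => /andP[ex _].
  apply: differentiable_continuous; apply/derivable1_diffP.
  by apply: derivable_powR; rewrite in_itv/= andbT (lt_le_trans e0).
rewrite (continuous_FTC2 e1 cf (F := F)).
- rewrite -EFinB lee_fin /F powR1 mulr1 gerBl mulr_ge0 ?powR_ge0// invr_ge0; exact: ltW.
- split.
  + move=> x; rewrite in_itv/= => /andP[ex _].
    by case: (dF x (lt_trans e0 ex)).
  + by apply: cvg_at_right_filter; exact: cF.
  + by apply: cvg_at_left_filter; exact: cF.
- move=> x; rewrite in_itv/= => /andP[ex _].
  by rewrite derive1E; case: (dF x (lt_trans e0 ex)).
Qed.

(** The antiderivative bounds the integral over [e, 1] independently of [e]; exhausting ]0, 1] by
    such intervals passes the bound to the limit. *)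
Lemma integral_powRN_lty : \int[mu]_(x in `]0%R, 1%R]) (x `^ (- alpha))%:E < +oo.
Proof.
have /andP[a0 a1] := alpha01.
pose S (n : nat) : set R := [set` `[(n.+2%:R^-1)%R, 1%R]].
have US : [set` `]0%R, 1%R]] = \bigcup_n S n.
  apply/seteqP; split => x; rewrite /= ?in_itv/=.
    move=> /andP[x0 x1]; exists (Num.truncn x^-1) => //; rewrite /S/= in_itv/= x1 andbT.
    rewrite invf_ple ?posrE// -natr1 ltW//.
    by rewrite (lt_trans (truncnS_gt _))// ltrDl.
  move=> [n _]; rewrite /S/= in_itv/= => /andP[h ->]; rewrite andbT.
  by apply: lt_le_trans h; rewrite invr_gt0.
have mf : measurable_fun setT (fun x : R => (x `^ (- alpha))%:E).
  by apply/measurable_EFinP; exact: measurable_powR.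
rewrite US; apply: (@le_lt_trans _ _ ((1 - alpha)^-1)%:E); last exact: ltry.
have H : \int[mu]_(x in S n) (x `^ (- alpha))%:E @[n --> \oo] -->
    \int[mu]_(x in \bigcup_n S n) (x `^ (- alpha))%:E.
  apply: ge0_nondecreasing_set_cvg_integral => //.
  - move=> m n mn; apply/subsetPset => x; rewrite /S/= !in_itv/= => /andP[h ->].
    by rewrite andbT (le_trans _ h)// lef_pV2 ?posrE// ler_nat.
  - by move=> n; exact: measurable_itv.
  - by move=> n; exact: measurable_funTS.
  - by move=> n x _; rewrite lee_fin powR_ge0.
rewrite -(cvg_lim _ H)//; apply: lime_le; first by apply/cvg_ex; eexists; exact: H.
apply: nearW => n; apply: integral_powRN_itv.
by rewrite invr_gt0 ltr0n/= invf_lt1// ltr1n.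
Qed.

(* [Gamma] is a real-valued integral, hence 0 if it diverges: convergence is part
   of this statement. *)
Lemma Gamma_gt0 : (0 < Gamma (1 - alpha))%R.
Proof.
have /andP[a0 a1] := alpha01.
rewrite /Gamma (_ : 1 - alpha - 1 = - alpha)%R; last by lra.
pose f (x : R) := (x `^ (- alpha) * expR (- x))%R.
have f0 x : (0 <= f x)%R by rewrite mulr_ge0 ?powR_ge0 ?expR_ge0.
have mf : measurable_fun setT (EFin \o f).
  apply/measurable_EFinP; apply: measurable_funM; first exact: measurable_powR.
  by apply: measurableT_comp => //; exact: measurable_funN.
(* The integrand is at most x^(-alpha) on ]0, 1] and at most the exponential density beyond 1. *)
have fin : \int[mu]_(x in `]0%R, +oo[) (f x)%:E < +oo.
  rewrite (_ : [set` `]0%R, +oo[] = [set` `]0%R, 1%R]] `|` [set` `]1%R, +oo[]); last first.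
    apply/seteqP; split => x; rewrite /= ?in_itv/= ?andbT.
      by move=> x0; have [x1|x1] := leP x 1%R; [left; rewrite x0|right].
    by move=> [/andP[]//|]; exact: lt_trans.
  rewrite ge0_integral_setU//=; last 3 first.
  - exact: measurable_funTS.
  - by move=> x _; rewrite lee_fin.
  - apply/disj_setPRL => x /=; rewrite !in_itv/= andbT => x1.
    by move=> /andP[_]; rewrite leNgt x1.
  rewrite lte_add_pinfty//.
    apply: le_lt_trans integral_powRN_lty; apply: ge0_le_integral => //.
    - by move=> x _; rewrite lee_fin.
    - exact: measurable_funTS.
    - by apply: measurable_funTS; apply/measurable_EFinP; exact: measurable_powR.
    move=> x; rewrite /= in_itv/= => /andP[x0 _].
    by rewrite lee_fin ler_piMr ?powR_ge0// -expR0 ler_expR lerNl oppr0 ltW.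
  apply: (@le_lt_trans _ _ (\int[mu]_x (exponential_pdf 1%R x)%:E)); last first.
    by rewrite integral_exponential_pdf// ltry.
  rewrite integral_mkcond; apply: ge0_le_integral => //.
  - by move=> x _; apply: erestrict_ge0 => y _; rewrite lee_fin.
  - by apply/(measurable_restrictT _ _).1 => //; exact: measurable_funTS.
  - by apply/measurable_EFinP; exact: measurable_exponential_pdf.
  move=> x _; rewrite patchE; case: ifPn => [|_]; last by rewrite lee_fin exponential_pdf_ge0.
  rewrite inE/= in_itv/= andbT => x1; have x0 : (0 <= x)%R by rewrite ltW// (lt_trans _ x1).
  rewrite lee_fin exponential_pdfE// mul1r mulN1r ler_piMl ?expR_ge0//.
  rewrite powRN invf_le1; last by rewrite powR_gt0// (lt_trans _ x1).
  by rewrite -(powRr0 x) ler_powR// ltW.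
apply: fine_gt0; rewrite fin andbT.
(* For positivity: on [1/2, 1] the integrand is at least exp(-1). *)
apply: (@lt_le_trans _ _ (\int[mu]_(x in `[2^-1%R, 1%R]) (expR (-1))%:E)).
  rewrite integral_cst//= lebesgue_measure_itv/= lte_fin invf_lt1// ltr1n -EFinB -EFinM lte_fin.
  by rewrite mulr_gt0 ?expR_gt0// subr_gt0 invf_lt1// ltr1n.
apply: (@le_trans _ _ (\int[mu]_(x in `[2^-1%R, 1%R]) (f x)%:E)).
  apply: ge0_le_integral => //.
  - exact: measurable_funTS.
  move=> x; rewrite /= in_itv/= => /andP[x2 x1]; rewrite lee_fin /f.
  have x0 : (0 < x)%R by rewrite (lt_le_trans _ x2)// invr_gt0.
  rewrite (@le_trans _ _ (expR (- x)))// ?ler_expR ?lerN2//.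
  rewrite ler_peMl ?expR_ge0// powRN invf_ge1 ?powR_gt0//.
  by rewrite -(powRr0 x) ger_powR ?x0// ltW.
apply: ge0_subset_integral => //.
- exact: measurable_funTS.
- by move=> x _; rewrite lee_fin.
- by move=> x; rewrite /= !in_itv/= andbT => /andP[+ _]; apply: lt_le_trans; rewrite invr_gt0.
Qed.

End GammaFinite.

(* The Laplace transform is at least nu ]-oo, 0] on [0, +oo[, and tends to 0. *)
Lemma stable_law_gt0 (R : realType) (alpha : R) (nu : probability (measurableTypeR R) R) :
  0 < alpha < 1 -> stable_law alpha nu -> nu [set z | z <= 0] = 0%E.
Proof.
move=> a01 [/(_ a01) H _ _]; have /andP[a0 _] := a01.
pose p := fine (nu [set z | z <= 0]).
have mid : measurable_fun setT (@idfun (measurableTypeR R)) by exact: measurable_id.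
have mN : measurable ([set z | z <= 0] : set (measurableTypeR R)).
  exact: (measurable_sublevel mid).
have pE : nu [set z | z <= 0] = p%:E by rewrite fineK// fin_num_measure.
rewrite pE; congr (_%:E); apply/eqP; rewrite eq_le fine_ge0// andbT leNgt; apply/negP => p0.
have E u : 0 <= u -> (p%:E <= \int[nu]_s (expR (- u * s))%:E)%E.
  move=> u0; rewrite -pE -[nu _]mul1e -integral_cst//.
  apply: (@le_trans _ _ (\int[nu]_(s in [set z | (z <= 0)%R]) (expR (- u * s))%:E)%E).
    apply: ge0_le_integral => //.
    - apply: measurable_funTS; apply/measurable_EFinP; apply: measurableT_comp => //.
    by move=> x /= x0; rewrite lee_fin -expR0 ler_expR mulr_le0 ?oppr_le0.
  apply: ge0_subset_integral => //.
  apply/measurable_EFinP; apply: measurableT_comp => //; exact: measurable_funM.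
(* Chosen so that Gamma(1 - alpha) u^alpha = 1 - ln p: the Laplace transform at [u] is then p/e,
   below the lower bound [p]. *)
pose u := ((1 - ln p) / Gamma (1 - alpha)) `^ alpha^-1.
have G0 := Gamma_gt0 a01.
have p1 : p <= 1 by rewrite -lee_fin -pE probability_le1.
have lp : ln p <= 0 by exact: ln_le0.
have q0 : 0 <= (1 - ln p) / Gamma (1 - alpha) by rewrite divr_ge0 ?(ltW G0)//; lra.
have u0 : 0 <= u by exact: powR_ge0.
have := H u u0; rewrite -powRrM mulVf ?gt_eqF// powRr1// mulrC divfK ?gt_eqF//.
rewrite unlock => /(congr1 oppe); rewrite oppeK => Hl.
have : (lne p%:E <= (- (1 - ln p))%:E)%E.
  rewrite EFinN -Hl lee_lne//; first exact: E.
  - by rewrite in_itv/= lee_fin (ltW p0) leey.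
  - rewrite in_itv/= leey andbT; apply: le_trans (E _ u0).
    by rewrite lee_fin ltW.
by rewrite lne_EFin// lee_fin; lra.
Qed.

Section SubLinear.
Context (R : realType) (PP : probability path_space R).
Hypothesis PP_nn : PP nearest_neighbour = 1%E.
Hypothesis PP_backtrack : forall eps : R, 0 < eps ->
  exists m : nat, forall n k : nat, (PP (backtrack n (n + m)%N k) <= eps%:E)%E.
Context (nu : probability (measurableTypeR R) R) (alpha B : R).
Hypotheses (a01 : 0 < alpha < 1) (B0 : 0 < B).
Hypothesis nu_gt0 : nu [set z | z <= 0] = 0%E.
Hypothesis T_law : cvg_in_distribution PP
  (fun n X => (first_passage R n%:Z X - 0%:E) * ((B * n%:R `^ alpha^-1)^-1)%:E)%E nu (fun s => s).
Let r (t : R) (k : nat) : R := 0 + t * (B `^ (- alpha) * k%:R `^ alpha).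

Lemma sublinear_oo t : 0 < t -> r t k @[k --> \oo] --> +oo.
Proof.
have /andP[a0 _] := a01; move=> t0; apply/cvgryPge => M.
have /cvgryPge/(_ (M / (t * B `^ (- alpha)))) : k%:R `^ alpha @[k --> \oo] --> (+oo : set_system R).
  by apply: cvgry_powR => //; exact: cvgr_idn.
apply: filterS => k; rewrite ler_pdivrMr ?mulr_gt0 ?powR_gt0// /r add0r => /le_trans; apply.
by rewrite mulrC mulrA.
Qed.

(** With [n] equivalent to t B^(-alpha) k^alpha, the quotient k / (B n^(1/alpha)) tends to
    t^(-1/alpha). A constant shift of the level is negligible because [r t k] diverges. *)
Lemma sublinear_cvg t m : 0 < t -> let n k := ((Num.truncn (r t k)).+1 + m)%N in
  (k%:R - 0) / (B * (n k)%:R `^ alpha^-1) @[k --> \oo] --> t `^ (- alpha^-1).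
Proof.
have /andP[a0 _] := a01; move=> t0 n.
have r_oo := sublinear_oo t0.
have rat : (n k)%:R / r t k @[k --> \oo] --> (1 : R).
  have H : m.+1%:R * (r t k)^-1 + 1 @[k --> \oo] --> (1 : R).
    rewrite [X in _ --> X](_ : 1 = m.+1%:R * 0 + 1); last by rewrite mulr0 add0r.
    by apply: cvgD; [apply: cvgMr; exact: cvgr_inv0|exact: cvg_cst].
  have H1 : (fun=> 1 : R) k @[k --> \oo] --> (1 : R) by exact: cvg_cst.
  apply: squeeze_cvgr H1 H; near=> k.
  have rk : 0 < r t k by near: k; move/cvgryPgt : r_oo; exact.
  have /andP[h1 h2] := truncn_itv (ltW rk).
  rewrite ler_pdivlMr// mul1r /n natrD (le_trans (ltW h2)) ?lerDl//=.
  rewrite ler_pdivrMr// mulrDl mulfVK ?gt_eqF// mul1r.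
  by rewrite -(natr1 (Num.truncn _)) -(natr1 m); move: h1; lra.
have rat' : t `^ (- alpha^-1) * ((n k)%:R / r t k) `^ (- alpha^-1) @[k --> \oo] -->
    t `^ (- alpha^-1) * 1 `^ (- alpha^-1).
  by apply: cvgMr; exact: cvgr_powR.
rewrite powR1 mulr1 in rat'; apply: cvg_trans rat'; apply: near_eq_cvg; near=> k.
have rk : 0 < r t k by near: k; move/cvgryPgt : r_oo; exact.
have k0 : 0 < k%:R :> R by rewrite ltr0n; near: k; exact: nbhs_infty_gt.
have nk0 : 0 < (n k)%:R :> R by rewrite ltr0n /n addSn.
rewrite subr0 powRM ?invr_ge0 ?(ltW rk)// -(powR_inv1 (ltW rk)) -powRrM mulrNN mul1r.
rewrite {1}/r add0r !powRM ?mulr_ge0 ?powR_ge0 ?(ltW t0)// -!powRrM mulfV ?gt_eqF//.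
rewrite mulNr mulfV ?gt_eqF// powRr1 ?(ltW k0)// powR_inv1 ?(ltW B0)// !powRN.
have := powR_gt0 alpha^-1 t0; have := powR_gt0 alpha^-1 nk0.
set x := _ `^ alpha^-1; set y := _ `^ alpha^-1 => x0 y0.
by field; rewrite !gt_eqF.
Unshelve. all: by end_near. Qed.

Let F := distribution_function nu (fun s : R => s).
Let mid : measurable_fun setT (fun s : measurableTypeR R => s).
Proof. exact: measurable_id. Qed.
Let mpow : measurable_fun setT (fun s : measurableTypeR R => s `^ (- alpha)).
Proof. exact: measurable_powR. Qed.

Let F0 : F 0 = 0. Proof. by rewrite /F /distribution_function nu_gt0. Qed.

Let Fpos x : 0 < x -> 1 - F (x `^ (- alpha^-1)) <= distribution_function nu (fun s => s `^ (- alpha)) x.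
Proof.
have /andP[a0 _] := a01; move=> x0.
rewrite lerBlDr /F /distribution_function -fineD ?fin_num_measure//; try exact: measurable_sublevel.
rewrite -lee_fin fineK; last by rewrite fin_numD !fin_num_measure//; exact: measurable_sublevel.
rewrite -[1%:E](@probability_setT _ _ _ nu).
apply: le_trans (probability_setU_le _ _ _); try exact: measurable_sublevel.
apply: le_measure; rewrite ?inE//; first by apply: measurableU; exact: measurable_sublevel.
move=> z _ /=; have [zt|zt] := leP z (x `^ (- alpha^-1)); [by right|left].
have y0 : 0 < x `^ (- alpha^-1) by exact: powR_gt0.
have z0 : 0 < z by exact: lt_trans zt.
rewrite powRN invf_ple ?posrE ?powR_gt0//.
rewrite -[leLHS](powRr1 (ltW _)) ?invr_gt0//.
rewrite (_ : x^-1 `^ 1 = (x `^ (- alpha^-1)) `^ alpha).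
  by rewrite ge0_ler_powR ?nnegrE ?ltW.
by rewrite -powRrM mulNr mulVf ?gt_eqF// powRr1 ?invr_ge0 ?powR_inv1 ?ltW.
Qed.

(** For z > 0 the map z |-> z^(-alpha) is decreasing, so z^(-alpha) <= x < y excludes z <=
    y^(-1/alpha). *)
Let Fneg x y : x < y -> 0 < y ->
  distribution_function nu (fun s => s `^ (- alpha)) x <= 1 - F (y `^ (- alpha^-1)).
Proof.
have /andP[a0 _] := a01; move=> xy y0.
rewrite lerBrDr /F /distribution_function -fineD ?fin_num_measure//; try exact: measurable_sublevel.
(* The zero added on the right is the mass of ]-oo, 0], which pays for the points where the real
   power is not the intended one. *)
rewrite -[leRHS]addr0 -F0 /F /distribution_function.
have m0 := measurable_sublevel mid 0; have mx := measurable_sublevel mpow x.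
have my := measurable_sublevel mid (y `^ (- alpha^-1)).
rewrite -lee_fin fineK; last by rewrite fin_numD !fin_num_measure.
rewrite EFinD fineK ?fin_num_measure//.
apply: (@le_trans _ _ (nu ([set z | (z `^ (- alpha) <= x)%R] `\` [set z | (z <= 0)%R]) +
  nu [set z | (z <= y `^ (- alpha^-1))%R] + nu [set z | (z <= 0)%R])%E).
  rewrite addeAC leeD2r//.
  apply: le_trans (probability_setU_le _ _ _) => //; last exact: measurableD.
  apply: le_measure; rewrite ?inE//; first by apply: measurableU => //; exact: measurableD.
  by move=> z zx; have [z0|z0] := pselect (z <= 0); [right|left].
rewrite leeD2r// -measureU//; try exact: measurableD.
  by apply: probability_le1; apply: measurableU => //; exact: measurableD.
rewrite -subset0 => z [/= [zx /negP]]; rewrite -ltNge => z0 zy.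
have h : y <= z `^ (- alpha).
  rewrite powRN -[leLHS]invrK lef_pV2 ?posrE ?invr_gt0 ?powR_gt0//.
  rewrite (_ : y^-1 = (y `^ (- alpha^-1)) `^ alpha).
    by apply: ge0_ler_powR; rewrite ?nnegrE ?powR_ge0//; exact: ltW.
  by rewrite -powRrM mulNr mulVf ?gt_eqF// powR_inv1 ?ltW.
by have := le_trans h zx; rewrite leNgt xy.
Qed.

(* As s `^ (- alpha) is 1 for s < 0 and 0 for s = 0, the limit is meaningful only
   because nu ]-oo, 0] = 0. *)
Lemma position_cvg_sublinear :
  cvg_in_distribution PP
    (fun k (X : path_space) => (((X k)%:~R - 0) / (B `^ (- alpha) * k%:R `^ alpha))%:E)
    nu (fun s => s `^ (- alpha)).
Proof.
have /andP[a0 _] := a01.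
have b0 : \forall n \near \oo, 0 < B * n%:R `^ alpha^-1 :> R.
  by near=> n; rewrite mulr_gt0// powR_gt0// ltr0n; near: n; exact: nbhs_infty_gt.
have b'0 : \forall k \near \oo, 0 < B `^ (- alpha) * k%:R `^ alpha :> R.
  by near=> n; rewrite mulr_gt0// powR_gt0// ltr0n; near: n; exact: nbhs_infty_gt.
have up t s' e : 0 < t -> s' < t `^ (- alpha^-1) -> 0 < e -> \forall k \near \oo,
    fine (PP [set X | ((X k)%:~R - 0) / (B `^ (- alpha) * k%:R `^ alpha) <= t]) <= 1 - F s' + e.
  move=> t0 ts e0.
  exact: (position_df_le PP_nn PP_backtrack mid b0 T_law b'0 (sublinear_oo t0)
    (fun m => sublinear_cvg m t0) ts e0).
have lo t s' e : 0 < t -> t `^ (- alpha^-1) < s' -> 0 < e -> \forall k \near \oo,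
    1 - F s' - e <= fine (PP [set X | ((X k)%:~R - 0) / (B `^ (- alpha) * k%:R `^ alpha) <= t]).
  move=> t0 ts e0.
  exact: (position_df_ge PP_nn mid b0 T_law b'0 (sublinear_oo t0)
    (fun m => sublinear_cvg m t0) ts e0).
have dec x y : 0 < x -> x < y -> y `^ (- alpha^-1) < x `^ (- alpha^-1).
  move=> x0 xy; have y0 : 0 < y by exact: lt_trans xy.
  by rewrite !powRN ltf_pV2 ?posrE ?powR_gt0// gt0_ltr_powR ?invr_gt0 ?nnegrE ?ltW.
apply: (@cvg_in_distribution_df _ _ _
  (fun k X => ((X k)%:~R - 0) / (B `^ (- alpha) * k%:R `^ alpha))) => //.
  by move=> k t; exact: (measurable_normalized_position (fun=> 0)
    (fun k => B `^ (- alpha) * k%:R `^ alpha)).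
move=> t Lc; have [t0|t0] := ltP 0 t.
  apply: squeeze_continuity => // t' e tt' e0.
    have t'0 := lt_trans t0 tt'; have := up t _ _ t0 (dec _ _ t0 tt') e0.
    by apply: filterS => k /le_trans; apply; rewrite lerD2r; exact: Fpos.
  (* A point strictly between [t'] and [t] that stays positive even when [t'] does not. *)
  pose y := Num.max ((t + t') / 2) (t / 2).
  have y0 : 0 < y by rewrite lt_max [0 < t / 2]divr_gt0// orbT.
  have yt : y < t by rewrite gt_max !ltr_pdivrMr//; apply/andP; split; lra.
  have t'y : t' < y by rewrite lt_max ltr_pdivlMr//; apply/orP; left; lra.
  have := lo t _ _ t0 (dec _ _ y0 yt) e0.
  by apply: filterS => k; apply: le_trans; rewrite lerD2r; exact: Fneg.
have L0 : distribution_function nu (fun s => s `^ (- alpha)) t = 0.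
  apply/eqP; rewrite eq_le fine_ge0// andbT -F0; apply: fine_probability_le.
  - exact: measurable_sublevel.
  - exact: measurable_sublevel.
  move=> z /= zt; rewrite leNgt; apply/negP => z0.
  by have := lt_le_trans (powR_gt0 (- alpha) z0) (le_trans zt t0); rewrite ltxx.
rewrite L0; apply/cvgrPdist_le => e e0; have e20 : 0 < e / 2 by rewrite divr_gt0.
have /cvgrPdist_lt/(_ _ e20)[M [_ HM]] := cvg_distribution_functiony nu mid.
(* For t <= 0 the probability is bounded by its value at a small positive [t1], chosen so that
   t1^(-1/alpha) = s' + 1 lies beyond the level where [F] is within e/2 of 1. *)
pose s' := Num.max (M + 1) 1; pose t1 := (s' + 1) `^ (- alpha).
have s'0 : 0 < s' by rewrite lt_max ltr01 orbT.
have s'10 : 0 < s' + 1 by rewrite ltr_wpDr.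
have t10 : 0 < t1 by exact: powR_gt0.
have s't : s' < t1 `^ (- alpha^-1).
  by rewrite /t1 -powRrM mulrNN mulfV ?gt_eqF// powRr1 ?ltrDl// ltW.
have := up t1 _ _ t10 s't e20; apply: filterS => k h.
rewrite sub0r normrN ger0_norm ?fine_ge0//.
apply: (@le_trans _ _ (fine (PP [set X | ((X k)%:~R - 0) / (B `^ (- alpha) * k%:R `^ alpha) <= t1]))).
  by apply: (@normalized_position_df_homo _ PP (fun=> 0) (fun k => B `^ (- alpha) * k%:R `^ alpha)); apply: le_trans t0 (ltW t10).
apply: (le_trans h).
have : M < s' by rewrite lt_max ltrDl ltr01.
by move/HM; rewrite -/F => /(le_lt_trans (ler_norm _)); lra.
Unshelve. all: by end_near. Qed.

End SubLinear.

(** * The case alpha = 1 *)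

Section LogScale.
Context (R : realType) (n : nat -> nat).
Hypothesis n_oo : n i @[i --> \oo] --> \oo.
Let nR i : R := (n i)%:R.
Let nR_oo : nR i @[i --> \oo] --> +oo.
Proof.
apply/cvgryPge => M; have /cvgnyPge/(_ (Num.truncn M).+1) := n_oo.
by apply: filterS => i ni; rewrite (le_trans (ltW (truncnS_gt M)))// ler_nat.
Qed.

(** The reciprocal of n / ln n: for alpha = 1, about y n / ln n further levels take a time of order
    [n], the size of the fluctuations. *)
Let scale i : R := ln (nR i) / nR i.

Lemma scale_cvg0 : scale i @[i --> \oo] --> 0.
Proof. exact: cvgr_ln_ratio0. Qed.

Lemma cvg_scale_round (w z : nat -> R) (c y : R) :
  (\forall i \near \oo, `|w i - z i| <= c) ->
  z i * scale i @[i --> \oo] --> y -> w i * scale i @[i --> \oo] --> y.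
Proof.
move=> wz zy.
have H : (w i - z i) * scale i @[i --> \oo] --> 0.
  apply/cvgrPdist_le => e e0; have c0 : 0 < `|c| + 1 by rewrite ltr_wpDl.
  have /cvgrPdist_le/(_ _ (divr_gt0 e0 c0)) := scale_cvg0.
  apply: filterS2 wz => i h; rewrite !sub0r !normrN ler_pdivlMr// => h'; rewrite normrM.
  apply: le_trans h'; rewrite mulrC ler_wpM2l//.
  by rewrite (le_trans h)// (le_trans (ler_norm c))// lerDl.
have H' : (w i - z i) * scale i + z i * scale i @[i --> \oo] --> 0 + y by exact: cvgD.
rewrite add0r in H'; apply: cvg_trans H'; apply: near_eq_cvg; apply: nearW => i.
by rewrite -mulrDl subrK.
Qed.

Section Scaled.
Context (w : nat -> nat) (y : R).
Hypothesis y0 : 0 < y.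
Hypothesis w_y : (w i)%:R * scale i @[i --> \oo] --> y.

Let lnn_oo : ln (nR i) @[i --> \oo] --> +oo.
Proof. exact: cvgry_ln. Qed.

Let n_ln0 : \forall i \near \oo, 1 < nR i /\ 0 < ln (nR i).
Proof.
by move/cvgryPgt/(_ 1) : nR_oo; apply: filterS => i n1; split => //; exact: ln_gt0.
Qed.

Lemma scaled_ratio0 : (w i)%:R / nR i @[i --> \oo] --> 0.
Proof.
have H : (w i)%:R * scale i * (ln (nR i))^-1 @[i --> \oo] --> y * 0.
  by apply: cvgM => //; exact: cvgr_inv0.
rewrite mulr0 in H; apply: cvg_trans H; apply: near_eq_cvg.
move: n_ln0; apply: filterS => i [n1 l0]; rewrite /scale.
by field; rewrite !gt_eqF// (lt_trans _ n1).
Qed.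

Lemma scaled_natr_oo : (w i)%:R @[i --> \oo] --> (+oo : set_system R).
Proof.
have h1 : \forall i \near \oo, y / 2 < (w i)%:R * scale i.
  by apply: cvgr_gt w_y _ _; rewrite ltr_pdivrMr// ltr_pMr// ltr1n.
apply/cvgryPge => M.
have Me : 0 < y / 2 / (`|M| + 1) by rewrite !divr_gt0// ltr_wpDl.
have h2 : \forall i \near \oo, scale i < y / 2 / (`|M| + 1) by exact: cvgr_lt scale_cvg0 _ Me.
near=> i.
have [n1 l0] : 1 < nR i /\ 0 < ln (nR i) by near: i.
have s0 : 0 < scale i by rewrite divr_gt0// (lt_trans _ n1).
have k1 : y / 2 < (w i)%:R * scale i by near: i.
have k2 : scale i < y / 2 / (`|M| + 1) by near: i.
apply: (@le_trans _ _ (`|M| + 1)); first by rewrite ler_wpDr// ler_norm.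
rewrite -(ler_pM2r s0) (le_trans _ (ltW k1))//.
by move: k2; rewrite ltr_pdivlMr 1?mulrC; [exact: ltW|rewrite ltr_wpDl].
Unshelve. all: by end_near. Qed.

Lemma scaled_oo : w i @[i --> \oo] --> \oo.
Proof.
apply/cvgnyPge => A; have /cvgryPge/(_ A%:R) := scaled_natr_oo.
by apply: filterS => k; rewrite ler_nat.
Qed.

Lemma scaled_inv_oo : nR i / (w i)%:R @[i --> \oo] --> +oo.
Proof.
apply/cvgryPge => M.
have Me : 0 < (`|M| + 1)^-1 by rewrite invr_gt0 ltr_wpDl.
have h2 : \forall i \near \oo, (w i)%:R / nR i < (`|M| + 1)^-1.
  by exact: cvgr_lt scaled_ratio0 _ Me.
have h3 : \forall i \near \oo, 1 <= (w i)%:R :> R by move/cvgryPge : scaled_natr_oo; exact.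
near=> i.
have [n1 l0] : 1 < nR i /\ 0 < ln (nR i) by near: i.
have w1 : 1 <= (w i)%:R :> R by near: i.
have w0 : 0 < (w i)%:R :> R by apply: lt_le_trans w1.
have k2 : (w i)%:R / nR i < (`|M| + 1)^-1 by near: i.
apply: (@le_trans _ _ (`|M| + 1)); first by rewrite ler_wpDr// ler_norm.
rewrite -[leLHS]invrK -[leRHS]invf_div.
by rewrite lef_pV2 ?posrE ?divr_gt0// ?ltW// (lt_trans _ n1).
Unshelve. all: by end_near. Qed.

(** Writing ln w as ln(w scale) + ln n - ln ln n, the first term converges and the last is
    negligible against ln n. *)
Lemma scaled_ln : ln (w i)%:R / ln (nR i) @[i --> \oo] --> (1 : R).
Proof.
have l1 : ln ((w i)%:R * scale i) / ln (nR i) @[i --> \oo] --> ln y * 0.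
  by apply: cvgM; [exact: cvgr_ln|exact: cvgr_inv0].
have l2 : ln (ln (nR i)) / ln (nR i) @[i --> \oo] --> 0 by exact: cvgr_ln_ratio0.
have H : ln ((w i)%:R * scale i) / ln (nR i) + (1 - ln (ln (nR i)) / ln (nR i))
    @[i --> \oo] --> ln y * 0 + (1 - 0).
  by apply: cvgD => //; apply: cvgB => //; exact: cvg_cst.
rewrite mulr0 add0r subr0 in H; apply: cvg_trans H; apply: near_eq_cvg.
have h3 : \forall i \near \oo, 1 <= (w i)%:R :> R by move/cvgryPge : scaled_natr_oo; exact.
near=> i.
have [n1 l0] : 1 < nR i /\ 0 < ln (nR i) by near: i.
have w0 : 0 < (w i)%:R :> R by apply: (@lt_le_trans _ _ 1) => //; near: i.
have n0 : 0 < nR i by exact: lt_trans n1.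
rewrite /scale lnM ?posrE ?divr_gt0// ln_div ?posrE//.
by field; rewrite gt_eqF.
Unshelve. all: by end_near. Qed.

(** a(w) is equivalent to w ln w, hence to w ln n, and the latter divided by [n] is [w] times the
    scale. *)
Lemma scaled_nlogn (a : nat -> R) : asymp_equiv \oo a (fun n => n%:R * ln n%:R) ->
  a (w i) / nR i @[i --> \oo] --> y.
Proof.
move=> ha; have aw : a (w i) / ((w i)%:R * ln (w i)%:R) @[i --> \oo] --> (1 : R).
  exact: (cvg_comp _ _ scaled_oo ha).
have H : a (w i) / ((w i)%:R * ln (w i)%:R) * ((w i)%:R * scale i) * (ln (w i)%:R / ln (nR i))
    @[i --> \oo] --> 1 * y * 1.
  by apply: cvgM; [exact: cvgM|exact: scaled_ln].
rewrite mul1r mulr1 in H; apply: cvg_trans H; apply: near_eq_cvg.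
have h3 : \forall i \near \oo, 1 < (w i)%:R :> R by move/cvgryPgt : scaled_natr_oo; exact.
near=> i.
have [n1 l0] : 1 < nR i /\ 0 < ln (nR i) by near: i.
have w1 : 1 < (w i)%:R :> R by near: i.
have w0 : 0 < (w i)%:R :> R by exact: lt_trans w1.
have n0 : 0 < nR i by exact: lt_trans n1.
have lw := ln_gt0 w1.
by rewrite /scale; field; rewrite !gt_eqF.
Unshelve. all: by end_near. Qed.

End Scaled.
End LogScale.

Section Products.
Context (R : realType) (I : Type) (F : set_system I) {FF : Filter F}.
Implicit Types f g : I -> R.

Lemma cvgrM_gt0_y f g (l : R) : 0 < l -> f i @[i --> F] --> l -> g i @[i --> F] --> +oo ->
  f i * g i @[i --> F] --> +oo.
Proof.
move=> l0 fl /cvgryPge goo; apply/cvgryPge => M.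
have l2 : 0 < l / 2 by rewrite divr_gt0.
have h1 : \forall i \near F, l / 2 < f i.
  by apply: cvgr_gt fl _ _; rewrite ltr_pdivrMr// ltr_pMr// ltr1n.
have := goo (`|M| / (l / 2)); apply: filterS2 h1 => i fi gi.
apply: le_trans (ler_norm M) _.
have g0 : 0 <= g i by apply: le_trans gi; rewrite divr_ge0// ltW.
move: gi; rewrite ler_pdivrMr// => /le_trans; apply.
by rewrite mulrC ler_wpM2r// ltW.
Qed.

Lemma cvgrM_lt0_y f g (l : R) : l < 0 -> f i @[i --> F] --> l -> g i @[i --> F] --> +oo ->
  f i * g i @[i --> F] --> -oo.
Proof.
move=> l0 fl goo; have Nl0 : 0 < - l by rewrite oppr_gt0.
have /cvgryPge H : - f i * g i @[i --> F] --> +oo.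
  by apply: (cvgrM_gt0_y Nl0) => //; exact: cvgN.
by apply/cvgrNyPle => M; have := H (- M); apply: filterS => i; rewrite mulNr lerN2.
Qed.

Lemma cvgny_natr (n : I -> nat) : n i @[i --> F] --> \oo ->
  (n i)%:R @[i --> F] --> (+oo : set_system R).
Proof.
move=> n_oo; apply/cvgryPge => M; have /cvgnyPge/(_ (Num.truncn M).+1) := n_oo.
by apply: filterS => i ni; rewrite (le_trans (ltW (truncnS_gt M)))// ler_nat.
Qed.

End Products.

(** * Increments of the centering for alpha = 1, with [q n t] for P(T_n <= t) and [o k u v] for
    P(S_k outside [u, v]) *)

Section Centering.
Context (R : realType) (G : nat -> R -> R) (F : R -> R) (q : nat -> nat -> R)
  (a : nat -> R) (A B mu : R) (o : nat -> nat -> nat -> R).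
Hypotheses (A0 : 0 < A) (B0 : 0 < B) (mu0 : 0 < mu).
Hypothesis ndG : \forall n \near \oo, {homo G n : x y / x <= y}.
Hypothesis ndF : {homo F : x y / x <= y}.
Hypothesis GF : weakly_converges G F.
Hypothesis F0 : F x @[x --> -oo] --> 0.
Hypothesis F1 : F x @[x --> +oo] --> (1 : R).
Hypothesis qG : \forall n \near \oo, forall t : nat, q n t = G n ((t%:R - A * a n) / (B * n%:R)).
Hypothesis a_equiv : asymp_equiv \oo a (fun n => n%:R * ln n%:R).
Hypothesis q_upper : forall n t1 t2 k u v : nat,
  1 - q (n + u)%N (t1 + t2)%N <= (1 - q v t1) + (1 - q n t2) + o k u v.
Hypothesis q_lower : forall n t1 t2 k u v : nat,
  q (n + v)%N (t1 + t2)%N <= q u t1 + q n t2 + o k u v.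
Hypothesis o_small : forall d e : R, 0 < d -> 0 < e -> exists K, forall k u v : nat,
  (K <= k)%N -> u%:R <= k%:R * (mu - d) -> k%:R * (mu + d) <= v%:R -> o k u v <= e.

Lemma q_ge (s : R) : \forall n \near \oo, forall t : nat,
  A * a n + s * (B * n%:R) <= t%:R -> G n s <= q n t.
Proof.
near=> n => t h.
have -> : q n t = G n ((t%:R - A * a n) / (B * n%:R)) by move: t {h}; near: n.
have n0 : 0 < n%:R :> R by rewrite ltr0n; near: n; exact: nbhs_infty_gt.
have hom : {homo G n : x y / x <= y} by near: n.
by apply: hom; rewrite ler_pdivlMr ?mulr_gt0//; lra.
Unshelve. all: by end_near. Qed.

Lemma q_le (s : R) : \forall n \near \oo, forall t : nat,
  t%:R <= A * a n + s * (B * n%:R) -> q n t <= G n s.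
Proof.
near=> n => t h.
have -> : q n t = G n ((t%:R - A * a n) / (B * n%:R)) by move: t {h}; near: n.
have n0 : 0 < n%:R :> R by rewrite ltr0n; near: n; exact: nbhs_infty_gt.
have hom : {homo G n : x y / x <= y} by near: n.
by apply: hom; rewrite ler_pdivrMr ?mulr_gt0//; lra.
Unshelve. all: by end_near. Qed.

(** Tightness of the limit law: once the normalized time passes every bound, passage is almost
    certain. [q_cvg0] is the opposite end. *)
Lemma q_cvg1 (v t : nat -> nat) (e : R) : v i @[i --> \oo] --> \oo ->
  ((t i)%:R - A * a (v i)) / (v i)%:R @[i --> \oo] --> +oo -> 0 < e ->
  \forall i \near \oo, 1 - e <= q (v i) (t i).
Proof.
move=> v_oo t_oo e0; have e20 : 0 < e / 2 by rewrite divr_gt0.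
have /cvgrPdist_lt/(_ _ e20)[M [_ HM]] := F1.
have M1 : M < M + 1 by rewrite ltrDl.
have [s /andP[Ms _] sc] := nondecreasing_continuity_point ndF M1.
have Fs := HM _ Ms.
have /cvgrPdist_lt/(_ _ e20) Gs := GF sc.
have qs : \forall i \near \oo, forall t : nat,
    A * a (v i) + s * (B * (v i)%:R) <= t%:R -> G (v i) s <= q (v i) t by exact: v_oo (q_ge s).
have Gv : \forall i \near \oo, `|F s - G (v i) s| < e / 2 by exact: v_oo Gs.
have v0 : \forall i \near \oo, (0 < v i)%N by exact: v_oo (nbhs_infty_gt 0).
move/cvgryPge/(_ (s * B)) : t_oo => ts.
near=> i.
have vi0 : 0 < (v i)%:R :> R by rewrite ltr0n; near: i.
have h1 : s * B <= ((t i)%:R - A * a (v i)) / (v i)%:R by near: i.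
have h2 : `|F s - G (v i) s| < e / 2 by near: i.
have h3 : G (v i) s <= q (v i) (t i).
  have : forall t : nat, A * a (v i) + s * (B * (v i)%:R) <= t%:R -> G (v i) s <= q (v i) t by near: i.
  by apply; move: h1; rewrite ler_pdivlMr//; lra.
apply: le_trans h3; move: Fs h2 => /(le_lt_trans (ler_norm _)) h4 /(le_lt_trans (ler_norm _)) h5.
lra.
Unshelve. all: by end_near. Qed.

Lemma q_cvg0 (v t : nat -> nat) (e : R) : v i @[i --> \oo] --> \oo ->
  ((t i)%:R - A * a (v i)) / (v i)%:R @[i --> \oo] --> -oo -> 0 < e ->
  \forall i \near \oo, q (v i) (t i) <= e.
Proof.
move=> v_oo t_oo e0; have e20 : 0 < e / 2 by rewrite divr_gt0.
have /cvgrPdist_lt/(_ _ e20)[M [_ HM]] := F0.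
have M1 : M - 1 < M by rewrite ltrBlDr ltrDl.
have [s /andP[_ Ms] sc] := nondecreasing_continuity_point ndF M1.
have Fs := HM _ Ms.
have /cvgrPdist_lt/(_ _ e20) Gs := GF sc.
have qs : \forall i \near \oo, forall t : nat,
    t%:R <= A * a (v i) + s * (B * (v i)%:R) -> q (v i) t <= G (v i) s by exact: v_oo (q_le s).
have Gv : \forall i \near \oo, `|F s - G (v i) s| < e / 2 by exact: v_oo Gs.
have v0 : \forall i \near \oo, (0 < v i)%N by exact: v_oo (nbhs_infty_gt 0).
move/cvgrNyPle/(_ (s * B)) : t_oo => ts.
near=> i.
have vi0 : 0 < (v i)%:R :> R by rewrite ltr0n; near: i.
have h1 : ((t i)%:R - A * a (v i)) / (v i)%:R <= s * B by near: i.
have h2 : `|F s - G (v i) s| < e / 2 by near: i.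
have h3 : q (v i) (t i) <= G (v i) s.
  have : forall t : nat, t%:R <= A * a (v i) + s * (B * (v i)%:R) -> q (v i) t <= G (v i) s by near: i.
  by apply; move: h1; rewrite ler_pdivrMr//; lra.
apply: (le_trans h3); move: Fs h2; rewrite sub0r normrN distrC.
move=> /(le_lt_trans (ler_norm _)) h4 /(le_lt_trans (ler_norm _)) h5.
lra.
Unshelve. all: by end_near. Qed.

Lemma a_over_n_oo : a n / n%:R @[n --> \oo] --> +oo.
Proof.
have aoo : \forall n \near \oo, 2^-1 < a n / (n%:R * ln n%:R).
  by apply: cvgr_gt a_equiv _ _; rewrite invf_lt1// ltr1n.
have l_oo : ln n%:R @[n --> \oo] --> (+oo : set_system R) by apply: cvgry_ln; exact: cvgr_idn.
apply/cvgryPge => M; near=> n.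
have n1 : 1 < n%:R :> R by rewrite ltr1n; near: n; exact: nbhs_infty_gt.
have n0 : 0 < n%:R :> R by exact: lt_trans n1.
have ln0 := ln_gt0 n1.
have h1 : 2^-1 < a n / (n%:R * ln n%:R) by near: n.
have h2 : 2 * M <= ln n%:R by near: n; move/cvgryPge : l_oo; exact.
rewrite ler_pdivlMr//; move: h1; rewrite ltr_pdivlMr ?mulr_gt0//; nra.
Unshelve. all: by end_near. Qed.

(* For t near A a(n) + s B n, P (T_n <= t) is about F(s); if A a(m) exceeded
   A a(n) + e by more than eta B n, then P (T_m <= t + e) would be at most about
   F(s - eta), which is smaller than F(s) for a suitable s. *)
Lemma centering_compare (m n : nat -> nat) (e : nat -> int) (K : R) :
  m i @[i --> \oo] --> \oo -> n i @[i --> \oo] --> \oo ->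
  (n i)%:R / (m i)%:R @[i --> \oo] --> (1 : R) ->
  (\forall i \near \oo, - K * (n i)%:R <= (e i)%:~R) ->
  (forall eps : R, 0 < eps -> \forall i \near \oo, forall t t' : nat,
     t'%:Z = t%:Z + e i -> q (n i) t <= q (m i) t' + eps) ->
  forall eta : R, 0 < eta ->
  \forall i \near \oo, A * a (m i) - (e i)%:~R - A * a (n i) <= eta * B * (n i)%:R.
Proof.
move=> m_oo n_oo nm eK comp eta eta0.
have [s [s' [/andP[s's ss'] Fs's cs cs']]] := nondecreasing_increase_point ndF F0 F1 eta0.
(* Two approximations of [F] and the comparison of the two probabilities cost [eps] each; a quarter
   of the jump leaves a contradiction. *)
pose eps := (F s - F s') / 4; have eps0 : 0 < eps by rewrite divr_gt0// subr_gt0.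
have /cvgrPdist_lt/(_ _ eps0) Gs := GF cs; have /cvgrPdist_lt/(_ _ eps0) Gs' := GF cs'.
have Gn : \forall i \near \oo, `|F s - G (n i) s| < eps by exact: n_oo Gs.
have Gm : \forall i \near \oo, `|F s' - G (m i) s'| < eps by exact: m_oo Gs'.
have qn : \forall i \near \oo, forall t : nat,
    A * a (n i) + s * (B * (n i)%:R) <= t%:R -> G (n i) s <= q (n i) t by exact: n_oo (q_ge s).
have qm : \forall i \near \oo, forall t : nat,
    t%:R <= A * a (m i) + s' * (B * (m i)%:R) -> q (m i) t <= G (m i) s' by exact: m_oo (q_le s').
have n0 : \forall i \near \oo, (0 < n i)%N by exact: n_oo (nbhs_infty_gt 0).
have m0 : \forall i \near \oo, (0 < m i)%N by exact: m_oo (nbhs_infty_gt 0).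
(* The offset [e] may be negative of order [n]. As a(n)/n diverges, the times considered remain
   nonnegative after adding it. *)
have an' : \forall n \near \oo, (`|K| + `|s| * B) / A <= a n / n%:R.
  by move/cvgryPge : a_over_n_oo; exact.
have an : \forall i \near \oo, (`|K| + `|s| * B) / A <= a (n i) / (n i)%:R by exact: n_oo an'.
have nR_oo : (n i)%:R @[i --> \oo] --> (+oo : set_system R).
  exact: cvgny_natr.
(* Bound for the normalized time t': the factor n/m converts the norming B n into B m, and the last
   term comes from rounding the time up. The limit s - eta lies below s'. *)
have lim : (s - eta) * ((n i)%:R / (m i)%:R) + B^-1 * ((m i)%:R)^-1 @[i --> \oo] --> s - eta.
  rewrite -[X in _ --> X]addr0 -[X in _ --> X + _]mulr1 -[X in _ --> _ + X](mulr0 B^-1).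
  apply: cvgD; apply: cvgMr => //; apply: cvgr_inv0.
  exact: cvgny_natr.
have lims' : \forall i \near \oo,
    (s - eta) * ((n i)%:R / (m i)%:R) + B^-1 * ((m i)%:R)^-1 < s'.
  by apply: cvgr_lt lim _ _; rewrite ltrBlDr.
near=> i; rewrite leNgt; apply/negP => Hlt.
have ni0 : 0 < (n i)%:R :> R by rewrite ltr0n; near: i.
have mi0 : 0 < (m i)%:R :> R by rewrite ltr0n; near: i.
have ani : (`|K| + `|s| * B) / A <= a (n i) / (n i)%:R by near: i.
have eKi : - K * (n i)%:R <= (e i)%:~R by near: i.
pose x := A * a (n i) + s * (B * (n i)%:R).
have Ax : `|K| * (n i)%:R <= x.
  move: ani; rewrite ler_pdivrMr// mulrAC ler_pdivlMr// /x.
  have : - (`|s| * (B * (n i)%:R)) <= s * (B * (n i)%:R).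
    rewrite -mulNr ler_pM2r ?mulr_gt0//; exact: lerNnormlW.
  by lra.
have x0 : 0 <= x by apply: le_trans Ax; rewrite mulr_ge0// ltW.
have Kx : K * (n i)%:R <= x.
  by apply: le_trans Ax; rewrite ler_pM2r// ler_norm.
pose t := (Num.truncn x).+1.
have xt : x < t%:R by exact: truncnS_gt.
have [t' tt'] : exists t' : nat, t'%:Z = t%:Z + e i.
  have : 0 <= t%:Z + e i.
    rewrite -(ler_int R) intrD -[t%:Z%:~R]/(t%:R).
    by apply: ltW; lra.
  by move=> te; exists (absz (t%:Z + e i)); rewrite gez0_abs.
have t'R : t'%:R = t%:R + (e i)%:~R :> R.
  by rewrite -[LHS]/(t'%:Z%:~R) tt' intrD.
have h1 : q (n i) t <= q (m i) t' + eps.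
  have : forall t t' : nat, t'%:Z = t%:Z + e i -> q (n i) t <= q (m i) t' + eps.
    by near: i; exact: comp.
  exact.
have h2 : G (n i) s <= q (n i) t.
  have : forall t : nat, A * a (n i) + s * (B * (n i)%:R) <= t%:R -> G (n i) s <= q (n i) t by near: i.
  by apply; exact: ltW.
have t_le : t%:R <= x + 1.
  by have /andP[h _] := truncn_itv x0; rewrite /t -natr1 lerD2r.
have lt_s' : (s - eta) * ((n i)%:R / (m i)%:R) + B^-1 * ((m i)%:R)^-1 < s' by near: i.
have h3 : q (m i) t' <= G (m i) s'.
  have : forall t : nat, t%:R <= A * a (m i) + s' * (B * (m i)%:R) -> q (m i) t <= G (m i) s' by near: i.
  apply; rewrite t'R.
  have : (s - eta) * (B * (n i)%:R) + 1 < s' * (B * (m i)%:R).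
    have Bm : 0 < B * (m i)%:R by rewrite mulr_gt0.
    move: lt_s'; rewrite -(ltr_pM2r Bm); congr (_ < _).
    by field; rewrite !gt_eqF.
  by move: t_le Hlt; rewrite /x => ? ? ?; lra.
have h4 : `|F s - G (n i) s| < eps by near: i.
have h5 : `|F s' - G (m i) s'| < eps by near: i.
move: h4 h5; rewrite (distrC (F s')) => /(le_lt_trans (ler_norm _)) h4 /(le_lt_trans (ler_norm _)) h5.
have : F s - F s' = 4 * eps by rewrite /eps mulrC divfK.
lra.
Unshelve. all: by end_near. Qed.

Section Increment.
Context (n m : nat -> nat) (x : R).
Hypothesis n_oo : n i @[i --> \oo] --> \oo.
Hypothesis x0 : 0 < x.
Let scale i : R := ln (n i)%:R / (n i)%:R.
Hypothesis m_x : (m i)%:R * scale i @[i --> \oo] --> x.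

Let nR_oo : (n i)%:R @[i --> \oo] --> (+oo : set_system R).
Proof. exact: cvgny_natr. Qed.

Let n0 : \forall i \near \oo, 0 < (n i)%:R :> R.
Proof. by move/cvgryPgt : nR_oo; exact. Qed.

Let m_n0 : (m i)%:R / (n i)%:R @[i --> \oo] --> (0 : R).
Proof. exact: (scaled_ratio0 n_oo m_x). Qed.

Let nm_n : (n i + m i)%:R / (n i)%:R @[i --> \oo] --> (1 : R).
Proof.
have H : 1 + (m i)%:R / (n i)%:R @[i --> \oo] --> (1 + 0 : R) by apply: cvgD => //; exact: cvg_cst.
rewrite addr0 in H; apply: cvg_trans H; apply: near_eq_cvg; move: n0; apply: filterS => i ni.
by rewrite natrD mulrDl divff// gt_eqF.
Qed.

Let n_nm : (n i)%:R / (n i + m i)%:R @[i --> \oo] --> (1 : R).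
Proof.
have H : ((n i + m i)%:R / (n i)%:R)^-1 @[i --> \oo] --> (1 : R)^-1.
  by apply: cvgV => //; exact: oner_neq0.
rewrite invr1 in H; apply: cvg_trans H; apply: near_eq_cvg; apply: nearW => i.
by rewrite invf_div.
Qed.

Let nm_oo : (n i + m i)%N @[i --> \oo] --> \oo.
Proof.
apply/cvgnyPge => M; have /cvgnyPge/(_ M) := n_oo.
by apply: filterS => i /leq_trans; apply; exact: leq_addr.
Qed.

Let truncn_ratio (d : R) : 0 <= d ->
  (Num.truncn (d * (n i)%:R))%:R / (n i)%:R @[i --> \oo] --> d.
Proof.
move=> d0; have H : d - ((n i)%:R)^-1 @[i --> \oo] --> d - 0.
  by apply: cvgB; [exact: cvg_cst|exact: cvgr_inv0].
rewrite subr0 in H; have H' : (fun=> d) i @[i --> \oo] --> d by exact: cvg_cst.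
apply: squeeze_cvgr H H'; move: n0; apply: filterS => i ni.
have dn : 0 <= d * (n i)%:R by rewrite mulr_ge0// ltW.
have /andP[h1 h2] := truncn_itv dn.
rewrite ler_pdivrMr// h1 andbT ler_pdivlMr// mulrBl mulVf ?gt_eqF//.
by move: h2; rewrite -natr1; lra.
Qed.

Let passage_ratio (w t : nat -> nat) (y d : R) : 0 < y ->
  (w i)%:R * scale i @[i --> \oo] --> y ->
  (t i)%:R / (n i)%:R @[i --> \oo] --> d ->
  ((t i)%:R - A * a (w i)) / (n i)%:R @[i --> \oo] --> d - A * y.
Proof.
move=> y0 w_y t_d.
have H : (t i)%:R / (n i)%:R - A * (a (w i) / (n i)%:R) @[i --> \oo] --> d - A * y.
  by apply: cvgB => //; apply: cvgMr; exact: (scaled_nlogn n_oo y0 w_y a_equiv).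
apply: cvg_trans H; apply: near_eq_cvg; apply: nearW => i.
by rewrite mulrBl mulrA.
Qed.

Let ratio_split (w t : nat -> nat) (y : R) : 0 < y ->
  (w i)%:R * scale i @[i --> \oo] --> y -> \forall i \near \oo,
  ((t i)%:R - A * a (w i)) / (n i)%:R * ((n i)%:R / (w i)%:R) = ((t i)%:R - A * a (w i)) / (w i)%:R.
Proof.
move=> y0 w_y; move: n0; apply: filterS => i ni.
by rewrite mulrA divfK// gt_eqF.
Qed.

(** Pick [k] slightly above m/mu, so that with high probability S_k lies between [m] and a level [v]
    only slightly larger. Passing [v] takes at most about A x n, so T_(n+m) exceeds a copy of T_n by
    little more than that. *)
Lemma increment_le (eta : R) : 0 < eta ->
  \forall i \near \oo, a (n i + m i)%N - a (n i) <= (x + eta) * (n i)%:R.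
Proof.
move=> eta0; pose c := A * x; pose eta' := A * eta / 2.
have c0 : 0 < c by rewrite mulr_gt0.
have e'0 : 0 < eta' by rewrite divr_gt0// mulr_gt0.
(* Small enough for c (1 + th) < (c + eta') (1 - th). As d = mu th, this says that passing [v],
   about A y n, takes less than the allotted time (c + eta') n. *)
pose th := eta' / (4 * c + 4 * eta').
have th0 : 0 < th by rewrite divr_gt0//; lra.
have th1 : th * (4 * c + 4 * eta') = eta' by rewrite divfK// gt_eqF//; lra.
have th4 : 4 * th <= 1 by nra.
pose d := mu * th; have d0 : 0 < d by rewrite mulr_gt0.
have mud : 0 < mu - d by rewrite subr_gt0 -[ltRHS]mulr1 ltr_pM2l//; lra.
have mud' : 0 < mu + d by rewrite addr_gt0.
pose k i := (Num.truncn ((m i)%:R / (mu - d))).+1.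
pose v i := (Num.truncn ((k i)%:R * (mu + d))).+1.
pose y := x * ((mu + d) / (mu - d)).
have y0 : 0 < y by rewrite mulr_gt0// divr_gt0.
have kP i : (m i)%:R / (mu - d) < (k i)%:R <= (m i)%:R / (mu - d) + 1.
  have /andP[h1 h2] : _ <= (m i)%:R / (mu - d) < _ := truncn_itv (divr_ge0 (ler0n R _) (ltW mud)).
  by rewrite h2 /k -natr1 lerD2r.
have vP i : (k i)%:R * (mu + d) < (v i)%:R <= (k i)%:R * (mu + d) + 1.
  have kmu : 0 <= (k i)%:R * (mu + d) by rewrite mulr_ge0// ltW.
  have /andP[h1 h2] := truncn_itv kmu.
  by rewrite h2 /v -natr1 lerD2r.
have v_y : (v i)%:R * scale i @[i --> \oo] --> y.
  apply: (@cvg_scale_round _ _ n_oo (fun i => (v i)%:R) (fun i => (m i)%:R * ((mu + d) / (mu - d))) (mu + d + 1)).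
    apply: nearW => i; have /andP[h1 h2] := kP i; have /andP[h3 h4] := vP i.
    have E : (m i)%:R * ((mu + d) / (mu - d)) = (m i)%:R / (mu - d) * (mu + d) by rewrite mulrA mulrAC.
    have h5 : (m i)%:R * ((mu + d) / (mu - d)) <= (k i)%:R * (mu + d).
      by rewrite E ler_pM2r// ltW.
    have h6 : (k i)%:R * (mu + d) <= (m i)%:R * ((mu + d) / (mu - d)) + (mu + d).
      by move: h2; rewrite -(ler_pM2r mud') mulrDl mul1r E.
    by rewrite ler_norml; apply/andP; split; lra.
  rewrite /y; under eq_fun do rewrite mulrAC.
  by apply: cvgMl.
have Ay : A * y < c + eta'.
  rewrite /y mulrA -/c mulrA ltr_pdivrMr// /d.
  suff : c * (1 + th) < (c + eta') * (1 - th) by nra.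
  nra.
pose t1 i := Num.truncn ((c + eta') * (n i)%:R).
have t1_n : (t1 i)%:R / (n i)%:R @[i --> \oo] --> c + eta'.
  by apply: truncn_ratio; rewrite addr_ge0// ltW.
have v_big : ((t1 i)%:R - A * a (v i)) / (v i)%:R @[i --> \oo] --> +oo.
  have H : ((t1 i)%:R - A * a (v i)) / (n i)%:R * ((n i)%:R / (v i)%:R) @[i --> \oo] --> +oo.
    apply: (@cvgrM_gt0_y _ _ _ _ _ _ (c + eta' - A * y)).
    - by rewrite subr_gt0.
    - exact: passage_ratio.
    - exact: (scaled_inv_oo n_oo y0 v_y).
  by apply: cvg_trans H; apply: near_eq_cvg; exact: ratio_split y0 v_y.
(* Makes [eta2 * B] equal to [eta']; the two errors [eta'] together amount to [A * eta]. *)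
pose eta2 := A * eta / (2 * B).
have eta20 : 0 < eta2 by rewrite divr_gt0// mulr_gt0.
have m_oo := scaled_natr_oo n_oo x0 m_x.
have comp : forall eps : R, 0 < eps -> \forall i \near \oo, forall t t' : nat,
     t'%:Z = t%:Z + (t1 i)%:Z -> q (n i) t <= q (n i + m i)%N t' + eps.
  move=> eps eps0; have eps20 : 0 < eps / 2 by rewrite divr_gt0.
  have [K HK] := o_small d0 eps20.
  have q1 := q_cvg1 (scaled_oo n_oo y0 v_y) v_big eps20.
  near=> i => t t' tt'.
  have Kk : (K <= k i)%N.
    rewrite /k ltnW// ltnS truncn_ge_nat ?divr_ge0 ?(ltW mud)// ler_pdivlMr//.
    by near: i; move/cvgryPge : m_oo; exact.
  have /andP[h1 h2] := kP i; have /andP[h3 h4] := vP i.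
  have h5 : (m i)%:R <= (k i)%:R * (mu - d) by rewrite -ler_pdivrMr// ltW.
  have h6 := HK (k i) (m i) (v i) Kk h5 (ltW h3).
  have h7 : 1 - eps / 2 <= q (v i) (t1 i) by near: i.
  have -> : t' = (t1 i + t)%N by apply/eqP; rewrite -eqz_nat tt' PoszD addrC.
  by have := q_upper (n i) (t1 i) t (k i) (m i) (v i); lra.
have K0 : \forall i \near \oo, - 0 * (n i)%:R <= (t1 i)%:Z%:~R :> R.
  by apply: nearW => i; rewrite oppr0 mul0r ler0n.
have := @centering_compare (fun i => n i + m i)%N n (fun i => (t1 i)%:Z) 0 nm_oo n_oo n_nm K0 comp
  eta2 eta20.
move: n0; apply: filterS2 => i ni h.
have cn0 : 0 <= (c + eta') * (n i)%:R by rewrite mulr_ge0 ?ltW// addr_gt0.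
have /andP[h1 _] := truncn_itv cn0; rewrite -/(t1 i) in h1.
rewrite -(ler_pM2l A0) mulrBr.
have E : eta2 * B * (n i)%:R = eta' * (n i)%:R.
  by rewrite /eta2 /eta'; field; rewrite gt_eqF.
have E2 : A * ((x + eta) * (n i)%:R) = (c + eta') * (n i)%:R + eta' * (n i)%:R.
  by rewrite /eta' /c; field.
rewrite E2; move: h; rewrite E -[(t1 i)%:Z%:~R]/((t1 i)%:R); lra.
Unshelve. all: by end_near. Qed.

(** The mirror argument: [k] is slightly below m/mu, so S_k lies between [u] and [m]. Reaching [u]
    takes at least about (c - eta') n, and [centering_compare] is applied with the two levels
    exchanged and a negative offset. *)
Lemma increment_ge (eta : R) : 0 < eta ->
  \forall i \near \oo, (x - eta) * (n i)%:R <= a (n i + m i)%N - a (n i).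
Proof.
move=> eta0; pose c := A * x; pose eta' := Num.min (A * eta / 2) (c / 2).
have c0 : 0 < c by rewrite mulr_gt0.
have e'0 : 0 < eta' by rewrite lt_min !divr_gt0// mulr_gt0.
have e'A : eta' <= A * eta / 2 by rewrite ge_min lexx.
have e'c : eta' <= c / 2 by rewrite ge_min lexx orbT.
pose th := eta' / (4 * c + 4 * eta').
have th0 : 0 < th by rewrite divr_gt0//; lra.
have th1 : th * (4 * c + 4 * eta') = eta' by rewrite divfK// gt_eqF//; lra.
have th4 : 4 * th <= 1 by nra.
pose d := mu * th; have d0 : 0 < d by rewrite mulr_gt0.
have mud : 0 < mu - d by rewrite subr_gt0 -[ltRHS]mulr1 ltr_pM2l//; lra.
have mud' : 0 < mu + d by rewrite addr_gt0.
pose k i := Num.truncn ((m i)%:R / (mu + d)).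
pose u i := Num.truncn ((k i)%:R * (mu - d)).
pose y := x * ((mu - d) / (mu + d)).
have y0 : 0 < y by rewrite mulr_gt0// divr_gt0.
have kP i : (k i)%:R <= (m i)%:R / (mu + d) < (k i)%:R + 1.
  by rewrite natr1; exact: truncn_itv (divr_ge0 (ler0n R _) (ltW mud')).
have uP i : (u i)%:R <= (k i)%:R * (mu - d) < (u i)%:R + 1.
  by rewrite natr1; apply: truncn_itv; rewrite mulr_ge0// ltW.
have u_y : (u i)%:R * scale i @[i --> \oo] --> y.
  apply: (@cvg_scale_round _ _ n_oo (fun i => (u i)%:R) (fun i => (m i)%:R * ((mu - d) / (mu + d))) (mu - d + 1)).
    apply: nearW => i; have /andP[h1 h2] := kP i; have /andP[h3 h4] := uP i.
    have E : (m i)%:R * ((mu - d) / (mu + d)) = (m i)%:R / (mu + d) * (mu - d) by rewrite mulrA mulrAC.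
    have h5 : (k i)%:R * (mu - d) <= (m i)%:R * ((mu - d) / (mu + d)).
      by rewrite E ler_pM2r.
    have h6 : (m i)%:R * ((mu - d) / (mu + d)) <= (k i)%:R * (mu - d) + (mu - d).
      by move/ltW: h2; rewrite -(ler_pM2r mud) mulrDl mul1r E.
    by rewrite ler_norml; apply/andP; split; lra.
  rewrite /y; under eq_fun do rewrite mulrAC.
  by apply: cvgMl.
have Ay : c - eta' < A * y.
  rewrite /y mulrA -/c mulrA ltr_pdivlMr// /d.
  suff : (c - eta') * (1 + th) < c * (1 - th) by nra.
  nra.
pose t1 i := Num.truncn ((c - eta') * (n i)%:R).
have ce0 : 0 < c - eta' by lra.
have t1_n : (t1 i)%:R / (n i)%:R @[i --> \oo] --> c - eta' by apply: truncn_ratio; rewrite ltW.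
have u_small : ((t1 i)%:R - A * a (u i)) / (u i)%:R @[i --> \oo] --> -oo.
  have H : ((t1 i)%:R - A * a (u i)) / (n i)%:R * ((n i)%:R / (u i)%:R) @[i --> \oo] --> -oo.
    apply: (@cvgrM_lt0_y _ _ _ _ _ _ (c - eta' - A * y)).
    - by rewrite subr_lt0.
    - exact: passage_ratio.
    - exact: (scaled_inv_oo n_oo y0 u_y).
  by apply: cvg_trans H; apply: near_eq_cvg; exact: ratio_split y0 u_y.
(* As m < n eventually, the comparison costs at most A eta n / 4. With [eta'] at most A eta / 2,
   another quarter is left for rounding [t1] down, hence the requirement n >= 4/(A eta) below. *)
pose eta2 := A * eta / (8 * B).
have eta20 : 0 < eta2 by rewrite divr_gt0// mulr_gt0.
have m_oo := scaled_natr_oo n_oo x0 m_x.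
have comp : forall eps : R, 0 < eps -> \forall i \near \oo, forall t t' : nat,
     t'%:Z = t%:Z + - (t1 i)%:Z -> q (n i + m i)%N t <= q (n i) t' + eps.
  move=> eps eps0; have eps20 : 0 < eps / 2 by rewrite divr_gt0.
  have [K HK] := o_small d0 eps20.
  have q1 := q_cvg0 (scaled_oo n_oo y0 u_y) u_small eps20.
  near=> i => t t' tt'.
  have Kk : (K <= k i)%N.
    rewrite /k truncn_ge_nat ?divr_ge0 ?(ltW mud')// ler_pdivlMr//.
    by near: i; move/cvgryPge : m_oo; exact.
  have /andP[h1 h2] := kP i; have /andP[h3 h4] := uP i.
  have h5 : (k i)%:R * (mu + d) <= (m i)%:R by rewrite -ler_pdivlMr.
  have h6 := HK (k i) (u i) (m i) Kk h3 h5.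
  have h7 : q (u i) (t1 i) <= eps / 2 by near: i.
  have -> : t = (t1 i + t')%N by apply/eqP; rewrite -eqz_nat PoszD tt' addrC subrK.
  by have := q_lower (n i) (t1 i) t' (k i) (u i) (m i); lra.
have t1c i : (t1 i)%:R <= (c - eta') * (n i)%:R.
  have cn0 : 0 <= (c - eta') * (n i)%:R by rewrite mulr_ge0// ltW.
  by have /andP[] := truncn_itv cn0.
have K0 : \forall i \near \oo, - c * (n i + m i)%:R <= (- (t1 i)%:Z)%:~R :> R.
  apply: nearW => i; rewrite mulNr intrN lerN2; apply: le_trans (t1c i) _.
  by rewrite natrD; have := ler0n R (n i); have := ler0n R (m i); nra.
have H := @centering_compare n (fun i => n i + m i)%N (fun i => - (t1 i)%:Z) c n_oo nm_oo nm_n K0 comp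
  eta2 eta20.
have mn1 : \forall i \near \oo, (m i)%:R / (n i)%:R < 1 :> R by exact: cvgr_lt m_n0 _ ltr01.
near=> i.
have h : A * a (n i) - (- (t1 i)%:Z)%:~R - A * a (n i + m i)%N <= eta2 * B * (n i + m i)%:R by near: i.
have ni : 0 < (n i)%:R :> R by near: i.
have mni : (m i)%:R / (n i)%:R < 1 :> R by near: i.
have big : 4 / (A * eta) <= (n i)%:R by near: i; move/cvgryPge : nR_oo; exact.
have cn0 : 0 <= (c - eta') * (n i)%:R by rewrite mulr_ge0// ltW.
have /andP[_ h2] := truncn_itv cn0; rewrite -/(t1 i) -natr1 in h2.
rewrite -(ler_pM2l A0) mulrBr.
have E : eta2 * B * (n i + m i)%:R = A * eta / 8 * ((n i)%:R + (m i)%:R).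
  by rewrite /eta2 natrD; field; rewrite gt_eqF.
have mn : (m i)%:R < (n i)%:R :> R by move: mni; rewrite ltr_pdivrMr// mul1r.
have one : 4 <= (n i)%:R * (A * eta) by rewrite -ler_pdivrMr ?mulr_gt0.
have h3 : eta' * (n i)%:R <= A * eta / 2 * (n i)%:R by rewrite ler_pM2r.
have Ae : 0 < A * eta by rewrite mulr_gt0.
have h4 : A * eta / 8 * ((n i)%:R + (m i)%:R) <= A * eta / 4 * (n i)%:R by nra.
have E2 : A * ((x - eta) * (n i)%:R) = c * (n i)%:R - A * eta * (n i)%:R by rewrite /c; ring.
rewrite E2; move: h; rewrite E intrN opprK -[(t1 i)%:Z%:~R]/((t1 i)%:R) => h.
move: h2; rewrite mulrBl => h2; lra.
Unshelve. all: by end_near. Qed.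

Lemma increment_cvg : (a (n i + m i)%N - a (n i)) / (n i)%:R @[i --> \oo] --> x.
Proof.
apply/cvgrPdist_le => e e0; have h1 := increment_le e0; have h2 := increment_ge e0.
near=> i.
have ni : 0 < (n i)%:R :> R by near: i.
have k1 : a (n i + m i)%N - a (n i) <= (x + e) * (n i)%:R by near: i.
have k2 : (x - e) * (n i)%:R <= a (n i + m i)%N - a (n i) by near: i.
rewrite -ler_pdivrMr// in k1; rewrite -ler_pdivlMr// in k2.
by rewrite ler_norml; apply/andP; split; lra.
Unshelve. all: by end_near. Qed.

End Increment.

End Centering.

(** * Two-sided increments of the centering and its inverse *)

Section RegularCentering.
Context (R : realType) (a : nat -> R).
Hypothesis a_equiv : asymp_equiv \oo a (fun n => n%:R * ln n%:R).
Hypothesis a_increment : forall (n m : nat -> nat) (x : R), n i @[i --> \oo] --> \oo -> 0 < x ->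
  (m i)%:R * (ln (n i)%:R / (n i)%:R) @[i --> \oo] --> x ->
  (a (n i + m i)%N - a (n i)) / (n i)%:R @[i --> \oo] --> x.

(** Extends the increments from positive to arbitrary real [x]: both [p] and [q] are compared with a
    lower level [z] at distance about b q / ln q, with b > |x|, and the two positive increments x +
    b and b are subtracted. *)
Lemma centering_regular (p q : nat -> nat) (x : R) : q i @[i --> \oo] --> \oo ->
  ((p i)%:R - (q i)%:R) * (ln (q i)%:R / (q i)%:R) @[i --> \oo] --> x ->
  (a (p i) - a (q i)) / (q i)%:R @[i --> \oo] --> x.
Proof.
move=> q_oo pq_x; pose b := `|x| + 1.
have b0 : 0 < b by rewrite ltr_wpDl.
have xb0 : 0 < x + b by rewrite /b; have := lerNnormlW (lexx `|x|); lra.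
have qR_oo : (q i)%:R @[i --> \oo] --> (+oo : set_system R) by exact: cvgny_natr.
have lq_oo : ln (q i)%:R @[i --> \oo] --> (+oo : set_system R) by exact: cvgry_ln.
have q1 : \forall i \near \oo, 1 < (q i)%:R :> R by move/cvgryPgt : qR_oo; exact.
pose d i := Num.truncn (b * ((q i)%:R / ln (q i)%:R)).
pose sc i : R := ln (q i)%:R / (q i)%:R.
have d_b : (d i)%:R * sc i @[i --> \oo] --> b.
  apply: (@cvg_scale_round _ _ q_oo _ (fun i => b * ((q i)%:R / ln (q i)%:R)) 1).
    move: q1; apply: filterS => i qi; have q0 : 0 < (q i)%:R :> R by exact: lt_trans qi.
    have z0 : 0 <= b * ((q i)%:R / ln (q i)%:R).
      by rewrite mulr_ge0 ?(ltW b0)// divr_ge0 ?ln_ge0 ?(ltW qi).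
    have /andP[h1 h2] := truncn_itv z0; rewrite -natr1 in h2.
    by rewrite ler_norml /d; apply/andP; split; lra.
  have H : (fun=> b) i @[i --> \oo] --> b by exact: cvg_cst.
  apply: cvg_trans H; apply: near_eq_cvg; move: q1; apply: filterS => i qi.
  have q0 : 0 < (q i)%:R :> R by exact: lt_trans qi.
  by have l0 := ln_gt0 qi; field; rewrite !gt_eqF.
have d_q : (d i)%:R / (q i)%:R @[i --> \oo] --> (0 : R) by exact: (scaled_ratio0 q_oo d_b).
have dq : \forall i \near \oo, (d i <= q i)%N.
  have h : \forall i \near \oo, (d i)%:R / (q i)%:R < 1 :> R by exact: cvgr_lt d_q _ ltr01.
  move: q1 h; apply: filterS2 => i qi; have q0 : 0 < (q i)%:R :> R by exact: lt_trans qi.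
  by rewrite ltr_pdivrMr// mul1r ltr_nat => /ltnW.
pose z i := (q i - d i)%N.
have zE : \forall i \near \oo, (z i)%:R = (q i)%:R - (d i)%:R :> R.
  by move: dq; apply: filterS => i dqi; rewrite natrB.
have z_q : (z i)%:R / (q i)%:R @[i --> \oo] --> (1 : R).
  have H : 1 - (d i)%:R / (q i)%:R @[i --> \oo] --> (1 - 0 : R).
    by apply: cvgB => //; exact: cvg_cst.
  rewrite subr0 in H; apply: cvg_trans H; apply: near_eq_cvg; move: q1 zE; apply: filterS2 => i qi ->.
  by rewrite mulrBl divff// gt_eqF// (lt_trans _ qi).
have zR_oo : (z i)%:R @[i --> \oo] --> (+oo : set_system R).
  have H : (z i)%:R / (q i)%:R * (q i)%:R @[i --> \oo] --> (+oo : set_system R).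
    exact: cvgrM_gt0_y z_q qR_oo.
  apply: cvg_trans H; apply: near_eq_cvg; move: q1; apply: filterS => i qi.
  by rewrite divfK// gt_eqF// (lt_trans _ qi).
have z_oo : z i @[i --> \oo] --> \oo.
  by apply/cvgnyPge => M; move/cvgryPge/(_ M%:R) : zR_oo; apply: filterS => i; rewrite ler_nat.
have z1 : \forall i \near \oo, 1 < (z i)%:R :> R by move/cvgryPgt : zR_oo; exact.
have lz : ln (z i)%:R / ln (q i)%:R @[i --> \oo] --> (1 : R) by exact: cvgr_ln_ratio1 z_q.
have base (w : nat -> nat) (y : R) : 0 < y -> (w i)%:R * sc i @[i --> \oo] --> y ->
    (a (z i + w i)%N - a (z i)) / (q i)%:R @[i --> \oo] --> y.
  move=> y0 wy.
  have H : (w i)%:R * sc i * (ln (z i)%:R / ln (q i)%:R) * ((z i)%:R / (q i)%:R)^-1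
      @[i --> \oo] --> y * 1 * 1^-1.
    by apply: cvgM; [exact: cvgM|apply: cvgV => //; exact: oner_neq0].
  rewrite invr1 !mulr1 in H.
  have {}H : (w i)%:R * (ln (z i)%:R / (z i)%:R) @[i --> \oo] --> y.
    apply: cvg_trans H; apply: near_eq_cvg; move: q1 z1; apply: filterS2 => i qi zi.
    have q0 : 0 < (q i)%:R :> R by exact: lt_trans qi.
    have z0 : 0 < (z i)%:R :> R by exact: lt_trans zi.
    by have l0 := ln_gt0 qi; rewrite /sc; field; rewrite !gt_eqF.
  have H' : (a (z i + w i)%N - a (z i)) / (z i)%:R * ((z i)%:R / (q i)%:R) @[i --> \oo] --> y * 1.
    by apply: cvgM => //; exact: a_increment.
  rewrite mulr1 in H'; apply: cvg_trans H'; apply: near_eq_cvg; move: z1; apply: filterS => i zi.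
  by rewrite mulrA divfK// gt_eqF// (lt_trans _ zi).
have pd : ((p i)%:R - (q i)%:R + (d i)%:R) * sc i @[i --> \oo] --> x + b.
  have H : ((p i)%:R - (q i)%:R) * sc i + (d i)%:R * sc i @[i --> \oo] --> x + b by exact: cvgD.
  by apply: cvg_trans H; apply: near_eq_cvg; apply: nearW => i; rewrite -mulrDl.
have pz : \forall i \near \oo, (z i <= p i)%N.
  have h : \forall i \near \oo, 0 < ((p i)%:R - (q i)%:R + (d i)%:R) * sc i by exact: cvgr_gt pd _ xb0.
  move: q1 zE h; apply: filterS3 => i qi zi.
  have s0 : 0 < sc i by rewrite divr_gt0 ?ln_gt0// (lt_trans _ qi).
  by rewrite pmulr_lgt0// => h; rewrite -(ler_nat R) zi; lra.
have e1 := base _ _ b0 d_b.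
have p_b : (p i - z i)%:R * sc i @[i --> \oo] --> x + b.
  apply: cvg_trans pd; apply: near_eq_cvg; move: pz zE; apply: filterS2 => i pzi zi.
  by rewrite natrB// zi opprB addrA addrAC.
have e2 := base _ _ xb0 p_b.
have H : (a (z i + (p i - z i))%N - a (z i)) / (q i)%:R - (a (z i + d i)%N - a (z i)) / (q i)%:R
  @[i --> \oo] --> x + b - b by exact: cvgB.
rewrite addrK in H; apply: cvg_trans H; apply: near_eq_cvg; move: pz dq; apply: filterS2 => i pzi dqi.
by rewrite subnKC// subnK// -mulrBl; congr (_ / _); ring.
Qed.

Context (A B : R).
Hypotheses (A0 : 0 < A) (B0 : 0 < B).

Let a_oo : a n @[n --> \oo] --> +oo.
Proof.
have H : a n / (n%:R * ln n%:R) * (n%:R * ln n%:R) @[n --> \oo] --> +oo.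
  apply: cvgrM_gt0_y a_equiv _ => //; apply/cvgryPge => M.
  have /cvgryPge/(_ 1) : ln n%:R @[n --> \oo] --> (+oo : set_system R).
    by apply: cvgry_ln; exact: cvgr_idn.
  have := nbhs_infty_ger M; apply: filterS2 => n Mn l1; apply: (le_trans Mn).
  by rewrite ler_peMr.
apply: cvg_trans H; apply: near_eq_cvg; have := nbhs_infty_gt 1; apply: filterS => n n1.
have n0 : 0 < n%:R :> R by rewrite ltr0n ltnW.
have l0 : 0 < ln n%:R :> R by rewrite ln_gt0// ltr1n.
by rewrite divfK// mulf_neq0// gt_eqF.
Qed.

Let level_ex (k : nat) : exists n, k%:R <= A * a n.
Proof.
move/cvgryPge/(_ (k%:R / A)) : a_oo => [n _ /(_ n (leqnn n)) h].
by exists n; rewrite mulrC -ler_pdivrMr.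
Qed.

(** A generalized inverse of A a(n), defined as a least index because [a] need not be monotone. The
    centering of the walk will be A times this level. *)
Definition level (k : nat) : nat := ex_minn (level_ex k).

Let level_ge k : k%:R <= A * a (level k).
Proof. by rewrite /level; case: ex_minnP. Qed.

Let level_lt k n : (n < level k)%N -> A * a n < k%:R.
Proof.
rewrite /level; case: ex_minnP => m _ hm nm; rewrite ltNge; apply/negP => /hm.
by rewrite leqNgt nm.
Qed.

Lemma level_oo : level k @[k --> \oo] --> \oo.
Proof.
have H M : \forall k \near \oo, forall n, (n < M)%N -> A * a n < k%:R.
  elim: M => [|M IH]; first exact: nearW.
  have := nbhs_infty_gtr (A * a M); apply: filterS2 IH => k IH kM n.
  by rewrite ltnS leq_eqVlt => /predU1P[->//|]; exact: IH.
apply/cvgnyPge => M; have := H M; apply: filterS => k Hk.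
rewrite leqNgt; apply/negP => /Hk; apply/negP; rewrite -leNgt; exact: level_ge.
Qed.

Let LR_oo : (level k)%:R @[k --> \oo] --> (+oo : set_system R).
Proof. by apply: cvgny_natr; exact: level_oo. Qed.

Let L1 : \forall k \near \oo, 1 < (level k)%:R :> R.
Proof. by move/cvgryPgt : LR_oo; exact. Qed.

(** By minimality, [k] lies between the values of A a at the level and at its predecessor. One step
    of [a] is negligible against the level, by regularity with x = 0. *)
Lemma level_defect : (A * a (level k) - k%:R) / (level k)%:R @[k --> \oo] --> 0.
Proof.
pose q k := (level k).-1.
have q_oo : q k @[k --> \oo] --> \oo.
  apply/cvgnyPge => M; have /cvgnyPge/(_ M.+1) := level_oo.
  by apply: filterS => k; rewrite /q; case: (level k).
have L0 : \forall k \near \oo, (1 < level k)%N by move: L1; apply: filterS => k; rewrite ltr1n.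
have H0 : (a (level k) - a (q k)) / (q k)%:R @[k --> \oo] --> 0.
  apply: (centering_regular q_oo); have H0 := @scale_cvg0 R q q_oo.
  apply: cvg_trans H0; apply: near_eq_cvg; move: L0; apply: filterS => k Lk.
  by rewrite -natrB ?leq_pred// /q -subn1 subKn ?mul1r// ltnW.
have H : A * ((a (level k) - a (q k)) / (q k)%:R) @[k --> \oo] --> A * 0 by exact: cvgMr.
rewrite mulr0 in H; have H' : (fun=> 0 : R) k @[k --> \oo] --> (0 : R) by exact: cvg_cst.
apply: squeeze_cvgr H' H; move: L0; apply: filterS => k Lk.
have q0 : 0 < (q k)%:R :> R by rewrite ltr0n /q -subn1 subn_gt0.
have h1 := level_ge k.
have h2 : A * a (q k) < k%:R by apply: level_lt; rewrite /q prednK// ltnW.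
have qL : (q k)%:R <= (level k)%:R :> R by rewrite ler_nat leq_pred.
have L00 : 0 < (level k)%:R :> R by exact: lt_le_trans qL.
rewrite divr_ge0 ?subr_ge0 ?(ltW L00)//=.
apply: (@le_trans _ _ ((A * a (level k) - k%:R) / (q k)%:R)).
  by rewrite ler_wpM2l ?subr_ge0// lef_pV2.
by rewrite mulrA ler_pM2r ?invr_gt0// mulrBr lerD2l lerN2 ltW.
Qed.

Let level_xlogx : k%:R / ((level k)%:R * ln (level k)%:R) @[k --> \oo] --> A.
Proof.
have H1 : a (level k) / ((level k)%:R * ln (level k)%:R) @[k --> \oo] --> (1 : R).
  exact: (cvg_comp _ _ level_oo a_equiv).
have H2 : (A * a (level k) - k%:R) / (level k)%:R * (ln (level k)%:R)^-1 @[k --> \oo] --> (0 * 0 : R).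
  by apply: cvgM; [exact: level_defect|apply: cvgr_inv0; exact: cvgry_ln].
have H : A * (a (level k) / ((level k)%:R * ln (level k)%:R)) -
    (A * a (level k) - k%:R) / (level k)%:R * (ln (level k)%:R)^-1 @[k --> \oo] --> A * 1 - 0 * 0.
  by apply: cvgB => //; exact: cvgMr.
rewrite mulr1 mul0r subr0 in H; apply: cvg_trans H; apply: near_eq_cvg; move: L1.
apply: filterS => k L.
have L0 : 0 < (level k)%:R :> R by exact: lt_trans L.
by have l0 := ln_gt0 L; field; rewrite !gt_eqF.
Qed.

Let level_ln : ln k%:R / ln (level k)%:R @[k --> \oo] --> (1 : R).
Proof.
have lL_oo : ln (level k)%:R @[k --> \oo] --> (+oo : set_system R) by exact: cvgry_ln.
have h1 : ln (k%:R / ((level k)%:R * ln (level k)%:R)) / ln (level k)%:R @[k --> \oo] --> ln A * 0.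
  by apply: cvgM; [exact: cvgr_ln|exact: cvgr_inv0].
have h2 : ln (ln (level k)%:R) / ln (level k)%:R @[k --> \oo] --> (0 : R) by exact: cvgr_ln_ratio0.
have H : ln (k%:R / ((level k)%:R * ln (level k)%:R)) / ln (level k)%:R +
    (1 + ln (ln (level k)%:R) / ln (level k)%:R) @[k --> \oo] --> ln A * 0 + (1 + 0 : R).
  by apply: cvgD => //; apply: cvgD => //; exact: cvg_cst.
rewrite mulr0 add0r addr0 in H; apply: cvg_trans H; apply: near_eq_cvg; move: L1 (nbhs_infty_gt 0).
apply: filterS2 => k L k0.
have L0 : 0 < (level k)%:R :> R by exact: lt_trans L.
have l0 := ln_gt0 L; have kR : 0 < k%:R :> R by rewrite ltr0n.
rewrite ln_div ?posrE ?mulr_gt0// lnM ?posrE//.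
by field; rewrite gt_eqF.
Qed.

(** With L the level, k is equivalent to A L ln L and ln k to ln L; dividing, A L is equivalent to k
    / ln k. *)
Lemma level_equiv : asymp_equiv \oo (fun k => A * (level k)%:R) (fun k => k%:R * (ln k%:R)^-1).
Proof.
have H : A * (k%:R / ((level k)%:R * ln (level k)%:R))^-1 * (ln k%:R / ln (level k)%:R)
    @[k --> \oo] --> A * A^-1 * 1.
  apply: cvgM => //; apply: cvgMr; apply: cvgV => //; exact: lt0r_neq0.
rewrite mulr1 divff ?gt_eqF// in H; apply: cvg_trans H; apply: near_eq_cvg.
move: L1 (nbhs_infty_gt 1); apply: filterS2 => k L k1.
have L0 : 0 < (level k)%:R :> R by exact: lt_trans L.
have l0 := ln_gt0 L; have kR : 0 < k%:R :> R by rewrite ltr0n ltnW.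
have lk0 : 0 < ln k%:R :> R by rewrite ln_gt0// ltr1n.
by field; rewrite !gt_eqF.
Qed.

Section AtPoint.
Context (t : R).
Let r k := A^-1 * (A * (level k)%:R) + t * (A ^- 2 * B * k%:R * (ln k%:R) ^- 2).

(** As L / ln L is equivalent to k / (A ln(k)^2), the displacement t B k / (A ln k)^2 equals t B / A
    in units of L / ln L. *)
Let r_scale : (r k - (level k)%:R) * (ln (level k)%:R / (level k)%:R) @[k --> \oo] --> t * B / A.
Proof.
have H : t * (A ^- 2 * B) * (k%:R / ((level k)%:R * ln (level k)%:R)) *
   (ln k%:R / ln (level k)%:R)^-1 * (ln k%:R / ln (level k)%:R)^-1
    @[k --> \oo] --> t * (A ^- 2 * B) * A * 1^-1 * 1^-1.
  have i1 : (ln k%:R / ln (level k)%:R)^-1 @[k --> \oo] --> (1^-1 : R).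
    by apply: cvgV => //; exact: oner_neq0.
  by apply: cvgM => //; apply: cvgM => //; exact: cvgMr.
rewrite (_ : _ * A * _ * _ = t * B / A) in H; last by field; rewrite gt_eqF.
apply: cvg_trans H; apply: near_eq_cvg.
move: L1 (nbhs_infty_gt 1); apply: filterS2 => k L k1.
have L0 : 0 < (level k)%:R :> R by exact: lt_trans L.
have l0 := ln_gt0 L; have kR : 0 < k%:R :> R by rewrite ltr0n ltnW.
have lk0 : 0 < ln k%:R :> R by rewrite ln_gt0// ltr1n.
by rewrite /r; field; rewrite !gt_eqF.
Qed.

Lemma level_centering_oo : r k @[k --> \oo] --> +oo.
Proof.
have H0 : (r k - (level k)%:R) * (ln (level k)%:R / (level k)%:R) * (ln (level k)%:R)^-1 + 1
    @[k --> \oo] --> t * B / A * 0 + 1.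
  apply: cvgD; last exact: cvg_cst.
  by apply: cvgM => //; apply: cvgr_inv0; exact: cvgry_ln.
rewrite mulr0 add0r in H0.
have H : ((r k - (level k)%:R) * (ln (level k)%:R / (level k)%:R) * (ln (level k)%:R)^-1 + 1) *
  (level k)%:R @[k --> \oo] --> +oo by exact: cvgrM_gt0_y ltr01 H0 LR_oo.
apply: cvg_trans H; apply: near_eq_cvg; move: L1; apply: filterS => k L.
have L0 : 0 < (level k)%:R :> R by exact: lt_trans L.
by have l0 := ln_gt0 L; field; rewrite !gt_eqF.
Qed.

Lemma level_centering_cvg (m : nat) : let n k := ((Num.truncn (r k)).+1 + m)%N in
  (k%:R - A * a (n k)) / (B * (n k)%:R) @[k --> \oo] --> - t.
Proof.
move=> n.
have n_scale : ((n k)%:R - (level k)%:R) * (ln (level k)%:R / (level k)%:R) @[k --> \oo] --> t * B / A.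
  apply: (@cvg_scale_round _ _ level_oo (fun k => (n k)%:R - (level k)%:R)
    (fun k => r k - (level k)%:R) m.+1%:R) => //.
  move/cvgryPge/(_ 0) : level_centering_oo; apply: filterS => k r0.
  have /andP[h1 h2] := truncn_itv r0.
  rewrite (_ : _ - _ - _ = (n k)%:R - r k); last by ring.
  rewrite ler_norml /n natrD -(natr1 (Num.truncn _)) -(natr1 m).
  by move: h1 h2; rewrite -natr1; have := ler0n R m => ? ? ?; apply/andP; split; lra.
have n_L : (n k)%:R / (level k)%:R @[k --> \oo] --> (1 : R).
  have H : ((n k)%:R - (level k)%:R) * (ln (level k)%:R / (level k)%:R) * (ln (level k)%:R)^-1 + 1
      @[k --> \oo] --> t * B / A * 0 + 1.
    apply: cvgD; last exact: cvg_cst.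
    by apply: cvgM => //; apply: cvgr_inv0; exact: cvgry_ln.
  rewrite mulr0 add0r in H; apply: cvg_trans H; apply: near_eq_cvg; move: L1.
  apply: filterS => k L; have L0 : 0 < (level k)%:R :> R by exact: lt_trans L.
  by have l0 := ln_gt0 L; field; rewrite !gt_eqF.
have an := centering_regular level_oo n_scale.
(* Splits k - A a(n) into the defect at the level L, which is o(L), and - A (a(n) - a(L)), which is
   about - t B L. Dividing by B n, with n equivalent to L, leaves - t. *)
have H : (- ((A * a (level k) - k%:R) / (level k)%:R) - A * ((a (n k) - a (level k)) / (level k)%:R)) *
    ((n k)%:R / (level k)%:R)^-1 * B^-1 @[k --> \oo] --> (- 0 - A * (t * B / A)) * 1^-1 * B^-1.
  apply: cvgMl; apply: cvgM; last by apply: cvgV => //; exact: oner_neq0.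
  by apply: cvgB; [apply: cvgN; exact: level_defect|exact: cvgMr].
rewrite (_ : _ * _ * B^-1 = - t) in H; last by field; rewrite !gt_eqF.
apply: cvg_trans H; apply: near_eq_cvg; move: L1; apply: filterS => k L.
have L0 : 0 < (level k)%:R :> R by exact: lt_trans L.
have n0 : 0 < (n k)%:R :> R by rewrite ltr0n /n addSn.
by field; rewrite !gt_eqF.
Qed.

End AtPoint.
End RegularCentering.

Section CriticalCase.
Context (R : realType) d (Omega : measurableType d) (P : probability Omega R)
  (Y0 : Omega -> (nat * R)%type) (Y : int -> Omega -> (nat * R)%type)
  (Pq : (int -> R) -> probability path_space R) (PP : probability path_space R).
Hypothesis mY : forall i, measurable_fun setT (Y i).
Hypothesis mY0 : measurable_fun setT Y0.
Hypothesis iidY : iid_copies P Y0 Y.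
Hypothesis range0 : {ae P, forall w, (0 < (Y0 w).1)%N /\ 0 < (Y0 w).2 < 1}.
Hypothesis quenched : forall omega : int -> R, (forall n, 0 < omega n < 1) ->
                quenched_law omega (Pq omega).
Hypothesis annealed : annealed_law P (fun w => env (sequence_of Y w)) Pq PP.
Hypothesis gap_lty : (\int[P]_w ((Y0 w).1%:R%:E : \bar R) < +oo)%E.
Hypothesis PP_backtrack : forall eps : R, 0 < eps ->
  exists m : nat, forall n k : nat, (PP (backtrack n (n + m)%N k) <= eps%:E)%E.
Let seqw := sequence_of Y.

(** Gaps are almost surely at least 1, hence so is their mean. *)
Lemma mean_gap_gt0 : 0 < mean_gap P Y0.
Proof.
have mg : measurable_fun setT (fun w => ((Y0 w).1%:R%:E : \bar R)).
  by apply/measurable_EFinP; apply: measurableT_comp => //; exact: measurableT_comp.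
have h : (1 <= \int[P]_w ((Y0 w).1%:R%:E : \bar R))%E.
  rewrite -[1%E](@probability_setT _ _ _ P) -[X in (X <= _)%E]mul1e -integral_cst//.
  apply: ae_ge0_le_integral => //.
  by move: range0; apply: filterS => w [gw _] _; rewrite lee_fin ler1n.
by apply: fine_gt0; rewrite gap_lty andbT (lt_le_trans _ h).
Qed.

Context (nu : probability (measurableTypeR R) R) (A B C1 : R) (a : nat -> R).
Hypotheses (A0 : 0 < A) (B0 : 0 < B).
Hypothesis a_equiv : asymp_equiv \oo a (fun n => n%:R * ln n%:R).
Hypothesis T_law : cvg_in_distribution PP
  (fun n X => (first_passage R n%:Z X - (A * a n)%:E) * ((B * n%:R)^-1)%:E)%E nu (fun s => C1 + s).

Let mZ : measurable_fun setT (fun s : measurableTypeR R => C1 + s).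
Proof. exact: measurable_funD. Qed.

Let b0 : \forall n \near \oo, 0 < B * n%:R.
Proof.
have := nbhs_infty_gt 0; apply: filterS => n n0; by rewrite mulr_gt0// ltr0n.
Qed.

Let q (n t : nat) : R := fine (PP (hit n t)).
Let o (k u v : nat) : R := fine (P (seqw @^-1` outside k u v)).

Let m_outside k u v : measurable (seqw @^-1` outside k u v).
Proof.
have mS := measurable_sequence_of mY; rewrite -[X in measurable X]setTI.
by apply: mS => //; exact: measurable_outside.
Qed.

Let notq (n t : nat) : PP (~` hit n t) = (1 - q n t)%:E.
Proof.
have mh := measurable_hit n t.
by rewrite probability_setC// EFinB /q fineK// fin_num_measure.
Qed.

Let q_upper (n t1 t2 k u v : nat) :
  1 - q (n + u)%N (t1 + t2)%N <= (1 - q v t1) + (1 - q n t2) + o k u v.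
Proof.
rewrite -lee_fin !EFinD -!EFinB -!notq /o fineK ?fin_num_measure//.
exact: (annealed_not_hit_le mY mY0 iidY range0 quenched annealed).
Qed.

Let q_lower (n t1 t2 k u v : nat) :
  q (n + v)%N (t1 + t2)%N <= q u t1 + q n t2 + o k u v.
Proof.
rewrite -lee_fin !EFinD /q /o !fineK ?fin_num_measure//; try exact: measurable_hit.
exact: (annealed_hit_le mY mY0 iidY range0 quenched annealed).
Qed.

Let o_small (de e : R) : 0 < de -> 0 < e -> exists K, forall k u v : nat,
  (K <= k)%N -> u%:R <= k%:R * (mean_gap P Y0 - de) ->
  k%:R * (mean_gap P Y0 + de) <= v%:R -> o k u v <= e.
Proof.
move=> de0 e0; have [K HK] := S_concentrated mY mY0 iidY gap_lty de0 e0.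
exists K => k u v Kk uk kv; rewrite -lee_fin /o fineK ?fin_num_measure//.
pose I := [set x : int | (k%:R * (mean_gap P Y0 - de) <= x%:~R <= k%:R * (mean_gap P Y0 + de))%R].
have mI : measurable (seqw @^-1` [set y | ~ I (S_ (gaps y) k%:Z)]).
  have mS := measurable_sequence_of mY; rewrite -[X in measurable X]setTI; apply: mS => //.
  rewrite (_ : [set y | _] = ~` \bigcup_(n in [set n : nat | I n%:Z])
     [set y | S_ (gaps y) k%:Z = n%:Z]).
    by apply: measurableC; apply: bigcup_measurable => n _; exact: measurable_S.
  apply/seteqP; split => y H Hn; apply: H.
    by case: Hn => n Dn Sn; rewrite [S_ _ _]Sn.
  exists `|S_ (gaps y) k%:Z|%N; last exact: S_nat_abs.
  by move: Hn; rewrite S_nat_abs.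
apply: le_trans (HK k Kk); apply: le_measure; rewrite ?inE//.
move=> w ow hI; apply: ow; move: hI; rewrite [in X in X -> _]S_nat_abs -pmulrn.
by move=> /andP[h1 h2]; rewrite S_nat_abs !lez_nat -!(ler_nat R) (le_trans uk)//= (le_trans h2).
Qed.

Lemma position_cvg_critical : exists2 ahat : nat -> R,
  asymp_equiv \oo ahat (fun k => k%:R * (ln k%:R)^-1) &
  cvg_in_distribution PP
    (fun k (X : path_space) => (((X k)%:~R - A^-1 * ahat k) /
       (A ^- 2 * B * k%:R * (ln k%:R) ^- 2))%:E) nu (fun s => - C1 - s).
Proof.
have inc : forall (n m : nat -> nat) (x : R), n i @[i --> \oo] --> \oo -> 0 < x ->
    (m i)%:R * (ln (n i)%:R / (n i)%:R) @[i --> \oo] --> x ->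
    (a (n i + m i)%N - a (n i)) / (n i)%:R @[i --> \oo] --> x.
  move=> n m x n_oo x0 mx.
  have qG : \forall n \near \oo, forall t : nat, q n t =
      fine (PP [set X | ((first_passage R n%:Z X - (A * a n)%:E) * ((B * n%:R)^-1)%:E <=
        ((t%:R - A * a n) / (B * n%:R))%:E)%E]).
    by move: b0; apply: filterS => k bk t; rewrite normalized_passage_nat.
  exact: (@increment_cvg R (fun n t => fine (PP [set X |
      ((first_passage R n%:Z X - (A * a n)%:E) * ((B * n%:R)^-1)%:E <= t%:E)%E]))
    (distribution_function nu (fun s => C1 + s)) q a A B (mean_gap P Y0) o
    A0 B0 mean_gap_gt0 (passage_df_homo PP (fun n => A * a n) b0)
    (@distribution_function_homo _ _ _ nu _ mZ)
    (cvg_in_distribution_weakly mZ T_law) (cvg_distribution_functionN nu mZ)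
    (cvg_distribution_functiony nu mZ) qG a_equiv q_upper q_lower o_small n m x n_oo x0 mx).
exists (fun k => A * (level a_equiv A0 k)%:R); first exact: level_equiv.
have -> : (fun s : R => - C1 - s) = (fun s => - (C1 + s)) by apply/funext => s; rewrite opprD.
have PP_nn := annealed_nearest_neighbour mY mY0 iidY range0 quenched annealed.
apply: (position_cvg_reflected PP_nn PP_backtrack mZ b0 T_law).
- have := nbhs_infty_gt 1; apply: filterS => k k1.
  by rewrite !mulr_gt0 ?invr_gt0 ?exprn_gt0 ?ltr0n ?(ltnW k1)// ln_gt0// ltr1n.
- by move=> t; exact: level_centering_oo.
- by move=> t m n; exact: level_centering_cvg.
Qed.

End CriticalCase.

(** * Moments common to the three sets of assumptions, and the conclusion *)

Section Assumptions.
Context (R : realType) d (Omega : measurableType d) (P : probability Omega R)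
  (xi0 : {RV P >-> nat}) (lam0 : {RV P >-> R}).
Hypothesis range : {ae P, forall w, (0 < xi0 w)%N /\ 0 < lam0 w < 1}.
Let rho w : R := (1 - lam0 w) / lam0 w.

(** Since xi >= 1 almost surely, raising its exponent from alpha to alpha + eps only increases the
    integrand. *)
Lemma A3_moment (alpha eps : R) : 0 < alpha -> 0 < eps ->
  ('E_P[fun w => (rho w `^ alpha * (xi0 w)%:R `^ (alpha + eps))%R] < +oo)%E ->
  ('E_P[fun w => ((rho w * (xi0 w)%:R) `^ alpha)%R] < +oo)%E.
Proof.
have mrho : measurable_fun setT rho by exact: measurable_rho.
have mxi := measurable_xiR xi0.
move=> a0 e0; rewrite !expectationE; apply: le_lt_trans.
apply: ae_ge0_le_integral => //.
- by move=> w _; rewrite lee_fin powR_ge0.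
- apply/measurable_EFinP; apply: (measurableT_comp (@measurable_powR R alpha)).
  exact: measurable_funM.
- by move=> w _; rewrite lee_fin mulr_ge0 ?powR_ge0.
- apply/measurable_EFinP; apply: measurable_funM.
    exact: (measurableT_comp (@measurable_powR R _) mrho).
  exact: (measurableT_comp (@measurable_powR R _) mxi).
move: range; apply: filterS => w [x0 /andP[l0 l1]] _; rewrite lee_fin.
have r0 : 0 <= rho w by rewrite divr_ge0 ?subr_ge0 ?ltW.
rewrite powRM//.
by rewrite ler_wpM2l ?powR_ge0// ler_powR ?ler1n// lerDl ltW.
Qed.

(** Finiteness of E xi has two sources: in the first case a moment of order at least 1, in the
    others a regularly varying tail of index 2 alpha > 1. *)
Lemma assumptions_moments (alpha : R) :
  A1 P xi0 lam0 alpha \/ A2 P xi0 lam0 alpha \/ A3 P xi0 lam0 alpha ->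
  [/\ 0 < alpha <= 2, cond_star P lam0 alpha,
      (\int[P]_w ((xi0 w)%:R : R)%:E < +oo)%E &
      ('E_P[fun w => ((rho w * (xi0 w)%:R) `^ alpha)%R] < +oo)%E].
Proof.
have half : 0 < 2^-1 :> R by [].
move=> [[a02 cs mom fin]|[[/andP[a1 a2] cs [ell [sv tl l0]] _ fin]|
  [/andP[a1 a2] cs [ell [sv tl [C C0 lC]]] [eps e0 [_ fin]]]]].
- split => //; apply: integral_gap_lty_moment mom.
  by rewrite le_max lexx orbT.
- split => //; first by rewrite (lt_trans half a1).
  exact: integral_gap_lty_tail a1 sv tl l0.
- have a0 : 0 < alpha by exact: lt_trans a1.
  split => //; first by rewrite a0 ltW.
    exact: integral_gap_lty_tail a1 sv tl lC.
  exact: A3_moment fin.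
Qed.

End Assumptions.

Theorem corollary2p4 (R : realType) (d : measure_display)
  (Omega : measurableType d) (P : probability Omega R)
  (xi0 : {RV P >-> nat}) (lam0 : {RV P >-> R})
  (xi : int -> {RV P >-> nat}) (lam : int -> {RV P >-> R})
  (Pq : (int -> R) -> probability path_space R)
  (PP : probability path_space R)
  (nu : probability (measurableTypeR R) R)
  (alpha A B C1 : R)
  (range_xi_lam : {ae P, forall w, (0 < xi0 w)%N /\ 0 < lam0 w < 1})
  (copies : iid_copies P (fun w => (xi0 w, lam0 w))
                         (fun (k : int) w => (xi k w, lam k w)))
  (quenched : forall omega : int -> R, (forall n, 0 < omega n < 1) ->
                quenched_law omega (Pq omega))
  (annealed : annealed_law P
                (fun w => environment (fun k => xi k w) (fun k => lam k w)) Pq PP)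
  (stable_nu : stable_law alpha nu)
  (assumptions : A1 P xi0 lam0 alpha \/ A2 P xi0 lam0 alpha \/ A3 P xi0 lam0 alpha)
  (A_gt0 : 0 < A) (B_gt0 : 0 < B)
  (T_limits : passage_time_limits PP nu alpha A B C1) :
  walk_limits PP nu alpha A B C1.

Proof.
have [/andP[a0 a2] [Erho _ nonar] gap_lty fin] := assumptions_moments range_xi_lam assumptions.
pose Y0 w := (xi0 w, lam0 w); pose Y (k : int) w := (xi k w, lam k w).
have mY0 : measurable_fun setT Y0 by exact: measurable_fun_pair.
have mY k : measurable_fun setT (Y k) by exact: measurable_fun_pair.
have annY : annealed_law P (fun w => env (sequence_of Y w)) Pq PP by exact: annealed.
(* The exponent of the transience estimate: alpha <= 2 places it in ]0, 1]. *)
have beta01 : 0 < alpha / 2 <= 1 by rewrite divr_gt0//= ler_pdivrMr// mul1r.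
have f1 := integral_odds_sqrt_lt1 range_xi_lam a0 Erho nonar.
have f2 : (\int[P]_w ((site_odds (Y0 w) * (Y0 w).1%:R) `^ (alpha / 2))%:E < +oo)%E.
  apply: integral_powR_half_lty fin.
  by apply: measurable_funM; [exact: measurable_rho|exact: measurable_xiR].
have PP_bt := backtrack_vanish mY mY0 copies range_xi_lam quenched annY beta01 f1 f2 gap_lty.
have PP_nn := annealed_nearest_neighbour mY mY0 copies range_xi_lam quenched annY.
have [T1 T2 T3 T4] := T_limits; split => [a01|a1|a12|a2'].
- exact: (position_cvg_sublinear PP_nn PP_bt a01 B_gt0 (stable_law_gt0 a01 stable_nu) (T1 a01)).
- have [a aeq Ta] := T2 a1.
  exact: (position_cvg_critical mY mY0 copies range_xi_lam quenched annY gap_lty PP_bt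
    A_gt0 B_gt0 aeq Ta).
- exact: (position_cvg_stable PP_nn PP_bt A_gt0 B_gt0 a12 (T3 a12)).
- exact: (position_cvg_normal PP_nn PP_bt A_gt0 B_gt0 (T4 a2')).
Qed.
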